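(* Let $f$ be an inner function with $D=\sup_{z\in\mathbb D}D_h(f)(z)<1$. Then $M^{1-D}\big(f^{-1}(\{\alpha\})\cap I\big)>0$ for every $\alpha\in\partial\mathbb D$ and every arc $I\subset\partial\mathbb D$.
   Context: $D_h(f)(z)=\frac{(1-|z|^2)|f'(z)|}{1-|f(z)|^2}$. An inner function is a bounded analytic function on $\mathbb D$ with radial limits of modulus $1$ a.e. on $\partial\mathbb D$; $f^{-1}(\{\alpha\})=\{\xi\in\partial\mathbb D:\lim_{r\to1}f(r\xi)=\alpha\}$. For $0<s\le1$, $M^s(F)=\inf\{\sum_j|I_j|^s: F\subset\bigcup_j I_j,\ I_j \text{ arcs}\}$ is the $s$-dimensional Hausdorff content, with $|I|$ the normalized length of $I$. *)

(* Defs.v *)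
From Stdlib Require Import Reals.
From Coquelicot Require Import Coquelicot.
Open Scope R_scope.

Definition cis (t : R) : C := (cos t, sin t).

Definition in_disk (z : C) : Prop := Cmod z < 1.

Definition analytic_on_disk (f : C -> C) : Prop :=
  forall z, in_disk z -> exists l : C, is_derive (K := C_AbsRing) f z l.

Definition bounded_on_disk (f : C -> C) : Prop :=
  exists M : R, forall z, in_disk z -> Cmod (f z) <= M.

Definition radial_limit (f : C -> C) (xi alpha : C) : Prop :=
  filterlim (fun r : R => f (RtoC r * xi)%C) (at_left 1) (locally alpha).

Definition null_set (N : R -> Prop) : Prop :=
  forall eps : R, 0 < eps ->
    exists (a b : nat -> R) (L : R),
      (forall n, a n <= b n) /\
      (forall t, N t -> exists n, a n <= t <= b n) /\
      is_series (fun n => b n - a n) L /\ L <= eps.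

Definition inner (f : C -> C) : Prop :=
  analytic_on_disk f /\ bounded_on_disk f /\
  null_set (fun t => 0 <= t <= 2 * PI /\
     ~ (exists alpha : C, Cmod alpha = 1 /\ radial_limit f (cis t) alpha)).

Definition Dh (f : C -> C) (z : C) : R :=
  (1 - Cmod z ^ 2) * Cmod (C_derive f z) / (1 - Cmod (f z) ^ 2).

Definition preimage_bd (f : C -> C) (alpha : C) (xi : C) : Prop :=
  Cmod xi = 1 /\ radial_limit f xi alpha.

Definition arc (a b : R) (xi : C) : Prop :=
  exists t, a <= t <= b /\ xi = cis t.

Definition is_arc_param (a b : R) : Prop := a <= b <= a + 2 * PI.

Definition arc_len (a b : R) : R := (b - a) / (2 * PI).

(* x^s with the convention 0^s = 0 (s > 0) *)
Definition powr (x s : R) : R := if Req_EM_T x 0 then 0 else Rpower x s.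

Definition hcontent (s : R) (F : C -> Prop) : Rbar :=
  Glb_Rbar (fun x : R =>
    exists (a b : nat -> R),
      (forall j, is_arc_param (a j) (b j)) /\
      (forall xi, F xi -> exists j, arc (a j) (b j) xi) /\
      is_series (fun j => powr (arc_len (a j) (b j)) s) x).

(* Main.v *)
Require Import Defs.
From Stdlib Require Import Reals ZArith Lra Lia List Classical ClassicalEpsilon.
From Coquelicot Require Import Coquelicot.
Open Scope R_scope.

(** Write [z = e^(-x) cis t] with [x > 0] and let [w = (alpha + f)/(alpha - f) = U + i V], so that
    [U > 0]. The bound [Dh f <= D] becomes [|z w'(z)| <= D U / x]: the function [w], seen on a half
    plane, is a contraction of ratio [D < 1] for the hyperbolic metric. Hence [U] grows at most like
    [x^(-D)] and decays at most like [x^D] towards the boundary, and since [x^(-D)] is integrable,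
    the measures [U(x, t) dt] converge as [x -> 0] to a Stieltjes measure [dM] (the Clark measure
    of [f] at [alpha]) whose mass on [[t - x, t + x]] is at most [C x U(x, t)], with [C] depending
    only on [D]; so an arc [I] has mass at most [C' |I|^(1-D)].

    An interval of zero mass would force [U] to be [O(x)] in mean above it, against the lower
    bound [x^D]. On the other hand, at a point where [f] does not tend radially to [alpha] the
    density of [dM] is finite along a sequence of scales, and it is zero when moreover [f] has
    another unimodular radial limit, which is almost always the case; a covering argument shows
    that the set of these points has mass zero. So all the mass of an arc is carried by the points
    where [f] tends to [alpha], and small covers of that set would make this mass vanish.

    That [|f| < 1] is obtained along the way: the bound on [Dh f] prevents [|f|] from crossing
    the value [1], and if [|f| >= 1] everywhere then the mean value property, bounded convergence
    and the radial limits give [|f(0)| = 1], so the mean value of [f(0)/f] makes [f] constant. *)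

(** * Covering by intervals *)

(** No measure is constructed. [M] is the boundary value of a potential [Y] of the closed form
    [U dt - V dx], so the convergence of the measures reduces to that of [Y x t] for each fixed [t].
    A set has small mass when each of its points lies in an open interval over which the increment
    of [M] is dominated by that of one monotone function of small total variation. This notion
    survives countable unions and, by compactness, bounds the increment of [M] over an interval up
    to a factor 2, which the final contradiction can afford. The same calculus, applied to limits of
    Riemann integrals, gives bounded convergence off a null set. Two obstacles shape the rest.
    Derivatives are not known to be continuous, so closed forms are integrated by Goursat's
    subdivision. And [inner] gives only boundedness, while [Dh f] is nonpositive where [|f| > 1], so
    [|f| < 1] has to be established before the bound on [Dh f] controls the derivative. *)

Lemma increment_dominated (g h dg dh : R -> R) (a b : R) : a <= b ->
  (forall x, a <= x <= b -> is_derive g x (dg x)) ->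
  (forall x, a <= x <= b -> is_derive h x (dh x)) ->
  (forall x, a <= x <= b -> dg x <= dh x) ->
  g b - g a <= h b - h a.
Proof.
  intros Hab Hg Hh Hle.
  destruct (MVT_gen (fun x => h x - g x) a b (fun x => dh x - dg x)) as [c [Hc E]].
  - intros x Hx. rewrite Rmin_left, Rmax_right in Hx by lra.
    refine (is_derive_minus h g x _ _ (Hh x _) (Hg x _)); lra.
  - intros x Hx. rewrite Rmin_left, Rmax_right in Hx by lra.
    apply continuity_pt_filterlim, (ex_derive_continuous (fun x => h x - g x)).
    eexists. refine (is_derive_minus h g x _ _ (Hh x _) (Hg x _)); lra.
  - rewrite Rmin_left, Rmax_right in Hc by lra.
    specialize (Hle c Hc).
    assert (0 <= (dh c - dg c) * (b - a)) by (apply Rmult_le_pos; lra). lra.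
Qed.

(** The tool by which differential inequalities are integrated below: [h] is always an explicit
    primitive of the bound, so neither integrability nor continuity of the derivatives is
    involved. *)
Lemma increment_abs_dominated (g h dg dh : R -> R) (a b : R) : a <= b ->
  (forall x, a <= x <= b -> is_derive g x (dg x)) ->
  (forall x, a <= x <= b -> is_derive h x (dh x)) ->
  (forall x, a <= x <= b -> Rabs (dg x) <= dh x) ->
  Rabs (g b - g a) <= h b - h a.
Proof.
  intros Hab Hg Hh Hle. apply Rabs_le. split.
  - assert (H : - g b - - g a <= h b - h a); [|lra].
    apply (increment_dominated (fun x => - g x) h (fun x => - dg x) dh); auto.
    + intros x Hx. refine (is_derive_opp g x _ (Hg x Hx)).
    + intros x Hx. specialize (Hle x Hx). apply Rabs_le_between in Hle. lra.
  - apply (increment_dominated g h dg dh); auto.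
    intros x Hx. specialize (Hle x Hx). apply Rabs_le_between in Hle. lra.
Qed.

(** Heine-Borel, by the supremum of the points up to which a finite cover exists. The intervals are
    described by a property of their ends, so that a cover can be given by pointwise existence. *)
Lemma finite_interval_subcover (P : R -> R -> Prop) (a b : R) : a <= b ->
  (forall t, a <= t <= b -> exists p q, p < t < q /\ P p q) ->
  exists L : list (R * R), (forall I, In I L -> P (fst I) (snd I)) /\
    (forall t, a <= t <= b -> exists I, In I L /\ fst I < t < snd I).
Proof.
  intros Hab H.
  set (S := fun x => a <= x <= b /\ exists L : list (R * R),
    (forall I, In I L -> P (fst I) (snd I)) /\
    (forall t, a <= t <= x -> exists I, In I L /\ fst I < t < snd I)).
  assert (Sa : S a).
  { split; [lra|]. destruct (H a) as [p [q [Hpq HP]]]; [lra|].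
    exists ((p, q) :: nil). split.
    - intros I [<-|[]]; auto.
    - intros t Ht. exists (p, q). simpl. split; [auto|lra]. }
  destruct (completeness S) as [m [Hub Hlub]].
  { exists b. intros x [Hx _]. lra. }
  { exists a. exact Sa. }
  assert (Ham : a <= m) by (apply Hub, Sa).
  assert (Hmb : m <= b) by (apply Hlub; intros x [Hx _]; lra).
  destruct (H m) as [p [q [Hpq HP]]]; [lra|].
  assert (Hx : exists x, S x /\ p < x).
  { apply NNPP. intros N. apply (Rlt_not_le m p); [lra|].
    apply Hlub. intros x Sx. apply Rnot_lt_le. intros Hx. apply N. now exists x. }
  destruct Hx as [x [[Hx [L [HL1 HL2]]] Hpx]].
  assert (Hext : forall y, y < q -> y <= b -> a <= y -> S y).
  { intros y Hyq Hyb Hay. split; [lra|]. exists ((p, q) :: L). split.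
    - intros I [<-|HI]; auto.
    - intros t Ht. destruct (Rle_dec t x) as [Htx|Htx].
      + destruct (HL2 t) as [I [HI1 HI2]]; [lra|]. exists I. split; [now right|auto].
      + exists (p, q). split; [now left|simpl; lra]. }
  destruct (Rlt_dec b q) as [Hbq|Hbq].
  - destruct (Hext b) as [_ HL]; try lra. exact HL.
  (* If [q <= b], the interval [(p, q)] around the supremum [m] extends the cover to the midpoint of
     [m] and [q], beyond [m]. *)
  - assert ((m + q) / 2 <= m) by (apply Hub, Hext; lra). lra.
Qed.

Lemma max_snd (L : list (R * R)) (x : R) :
  (exists I, In I L /\ fst I < x < snd I) ->
  exists I, (In I L /\ fst I < x < snd I) /\
    forall J, In J L -> fst J < x -> snd J <= snd I.
Proof.
  induction L as [|K L IH]; intros [I [HI1 HI2]]; [destruct HI1|].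
  destruct (classic (exists I, In I L /\ fst I < x < snd I)) as [HE|HN].
  - destruct (IH HE) as [I' [[H1 H2] H3]].
    destruct (Rlt_dec (snd I') (snd K)) as [Hlt|Hge];
      [destruct (Rlt_dec (fst K) x) as [Hk|Hk]|].
    + exists K. split; [split; [now left|lra]|].
      intros J [<-|HJ] HJx; [lra|]. specialize (H3 J HJ HJx). lra.
    + exists I'. split; [split; [now right|auto]|].
      intros J [<-|HJ] HJx; [lra|auto].
    + exists I'. split; [split; [now right|auto]|].
      intros J [<-|HJ] HJx; [lra|auto].
  - assert (HK : K = I).
    { destruct HI1 as [E|HI1]; [exact E|]. exfalso. apply HN. now exists I. }
    subst K. exists I. split; [split; [now left|auto]|].
    intros J [<-|HJ] HJx; [lra|].
    apply Rnot_lt_le. intros HJI. apply HN. exists J. split; [auto|lra].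
Qed.

(* Greedy choice from the left: the next interval reaches furthest right among those containing
   [x], so every interval kept afterwards starts to the right of [x]. Hence every second interval
   of the chain is disjoint from the first, which gives the factor 2. *)
Lemma chain_increment (M Phi : R -> R) (e b : R) :
  (forall x y, x <= y -> M x <= M y) ->
  (forall x y, x <= y -> Phi x <= Phi y) -> (forall x, Phi x <= e) ->
  forall n (L : list (R * R)) x x', (length L <= n)%nat -> x' <= x -> x <= b ->
  (forall I, In I L -> M (snd I) - M (fst I) <= Phi (snd I) - Phi (fst I)) ->
  (forall t, x <= t <= b -> exists I, In I L /\ fst I < t < snd I) ->
  (forall I, In I L -> x' <= fst I) ->
  M b - M x <= 2 * e - Phi x' - Phi x.
Proof.
  intros HM HPhi He. induction n as [|n IH]; intros L x x' Hn Hxx Hxb HL Hcov Hleft.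
  - destruct L; [|simpl in Hn; lia]. destruct (Hcov x) as [I [[] _]]; lra.
  - destruct (max_snd L x) as [K [[HK1 HK2] HK3]]; [apply Hcov; lra|].
    pose proof (HL K HK1) as HMK. pose proof (Hleft K HK1) as HxK.
    pose proof (HPhi _ _ HxK). pose proof (HM (fst K) x ltac:(lra)).
    destruct (Rlt_dec b (snd K)) as [Hb|Hb].
    + pose proof (HM b (snd K) ltac:(lra)). pose proof (He (snd K)). pose proof (He x). lra.
    + set (L' := filter (fun J => if Rlt_dec (snd K) (snd J) then true else false) L).
      assert (HL' : forall J, In J L' <-> In J L /\ snd K < snd J).
      { intros J. unfold L'. rewrite filter_In.
        destruct (Rlt_dec (snd K) (snd J)); intuition congruence. }
      assert (Hlen : (length L' < length L)%nat).
      { clear - HK1. unfold L'. clear L'. induction L as [|J L IH]; [destruct HK1|].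
        pose proof (filter_length_le
          (fun J => if Rlt_dec (snd K) (snd J) then true else false) L).
        destruct HK1 as [<-|HK1]; simpl.
        - destruct (Rlt_dec (snd J) (snd J)); [lra|]. lia.
        - specialize (IH HK1). destruct (Rlt_dec (snd K) (snd J)); simpl; lia. }
      (* The pair [(x', x)] becomes [(x, snd K)]. Adding the increment over [K], at most
         [Phi (snd K) - Phi x'], gives the bound for [(x', x)]: the two subtracted values are what
         lets the induction close. *)
      assert (M b - M (snd K) <= 2 * e - Phi x - Phi (snd K)).
      { apply (IH L'); try lra; try lia.
        - intros I HI. apply HL. now apply HL'.
        - intros t Ht. destruct (Hcov t) as [I [HI1 HI2]]; [lra|].
          exists I. split; [|auto]. apply HL'. split; [auto|lra].
        - intros I HI. apply HL' in HI. destruct HI as [HI1 HI2].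
          apply Rnot_lt_le. intros HIx. specialize (HK3 I HI1 HIx). lra. }
      lra.
Qed.

(* A covering form of "the Stieltjes measure of [M] gives [A] mass at most [2 e]". *)
Definition Small (M : R -> R) (A : R -> Prop) (e : R) : Prop :=
  exists Phi : R -> R, (forall x y, x <= y -> Phi x <= Phi y) /\
    (forall x, 0 <= Phi x <= e) /\
    forall t, A t -> exists p q, p < t < q /\ M q - M p <= Phi q - Phi p.

(** The converse link from covers to mass: an interval is small only if [M] hardly increases over
    it. Contradictions are drawn from here, with arbitrarily small [e], so the factor 2 is
    harmless. *)
Lemma Small_interval_increment (M : R -> R) (a b e : R) :
  (forall x y, x <= y -> M x <= M y) -> a <= b ->
  Small M (fun t => a <= t <= b) e -> M b - M a <= 2 * e.
Proof.
  intros HM Hab [Phi [HPhi [He HA]]].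
  destruct (finite_interval_subcover (fun p q => M q - M p <= Phi q - Phi p) a b Hab HA)
    as [L [HL1 HL2]].
  assert (Hmin : exists m, m <= a /\ forall I, In I L -> m <= fst I).
  { clear - L. induction L as [|I L [m [Hm IH]]].
    - exists a. split; [lra|intros I []].
    - exists (Rmin m (fst I)). pose proof (Rmin_l m (fst I)). pose proof (Rmin_r m (fst I)).
      split; [lra|]. intros J [<-|HJ]; [lra|]. specialize (IH J HJ). lra. }
  destruct Hmin as [m [Hma Hm]].
  pose proof (chain_increment M Phi e b HM HPhi (fun x => proj2 (He x)) (length L) L a m
    (le_n _) Hma Hab HL1 HL2 Hm).
  pose proof (He m). pose proof (He a). lra.
Qed.

Lemma Small_mono (M : R -> R) (A B : R -> Prop) (e e' : R) :
  (forall t, A t -> B t) -> e <= e' -> Small M B e -> Small M A e'.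
Proof.
  intros HAB Hee [Phi [H1 [H2 H3]]]. exists Phi. split; [auto|]. split; [|auto].
  intros x. specialize (H2 x). lra.
Qed.

Lemma Small_or (M : R -> R) (A B : R -> Prop) (e e' : R) :
  Small M A e -> Small M B e' -> Small M (fun t => A t \/ B t) (e + e').
Proof.
  intros [Phi [H1 [H2 H3]]] [Psi [K1 [K2 K3]]].
  exists (fun x => Phi x + Psi x). split; [|split].
  - intros x y Hxy. specialize (H1 x y Hxy). specialize (K1 x y Hxy). lra.
  - intros x. specialize (H2 x). specialize (K2 x). lra.
  - intros t [Ht|Ht].
    + destruct (H3 t Ht) as [p [q [Hpq Hm]]]. exists p, q. split; [auto|].
      specialize (K1 p q ltac:(lra)). lra.
    + destruct (K3 t Ht) as [p [q [Hpq Hm]]]. exists p, q. split; [auto|].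
      specialize (H1 p q ltac:(lra)). lra.
Qed.

Lemma is_series_term_le (u : nat -> R) (l : R) (n : nat) :
  (forall k, 0 <= u k) -> is_series u l -> u n <= l.
Proof.
  intros Hu Hl.
  assert (Hs : forall m, 0 <= sum_n u m).
  { intros m. induction m as [|m IH]; [rewrite sum_O; auto|].
    rewrite sum_Sn. unfold plus; simpl. specialize (Hu (S m)). lra. }
  apply Rle_trans with (sum_n u n).
  - destruct n as [|n]; [rewrite sum_O; lra|].
    rewrite sum_Sn. unfold plus; simpl. specialize (Hs n). lra.
  - apply (is_lim_seq_incr_compare (sum_n u)); [exact Hl|].
    intros m. rewrite sum_Sn. unfold plus; simpl. specialize (Hu (S m)). lra.
Qed.

(** The witness is the sum of the chosen witnesses; since all of them are nondecreasing, an
    increment of the sum dominates the increment of each term. *)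
Lemma Small_countable_union (M : R -> R) (A : nat -> R -> Prop) (e : nat -> R) (E : R) :
  (forall n, Small M (A n) (e n)) -> is_series e E ->
  Small M (fun t => exists n, A n t) E.
Proof.
  intros HA HE.
  set (Phi := fun n => proj1_sig (constructive_indefinite_description _ (HA n))).
  assert (HPhi : forall n, (forall x y, x <= y -> Phi n x <= Phi n y) /\
    (forall x, 0 <= Phi n x <= e n) /\
    forall t, A n t -> exists p q, p < t < q /\ M q - M p <= Phi n q - Phi n p).
  { intros n. apply (proj2_sig (constructive_indefinite_description _ (HA n))). }
  clearbody Phi.
  assert (Hex : forall x, ex_series (fun n => Phi n x)).
  { intros x. apply (ex_series_le (K := R_AbsRing) (V := R_CompleteNormedModule) _ e); [|now exists E].
    intros n. destruct (HPhi n) as [_ [H _]]. specialize (H x).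
    unfold norm; simpl; unfold abs; simpl. rewrite Rabs_right; lra. }
  exists (fun x => Series (fun n => Phi n x)). split; [|split].
  - intros x y Hxy. apply Series_le; [|apply Hex].
    intros n. destruct (HPhi n) as [H1 [H2 _]]. split; [apply H2|auto].
  - intros x. split.
    + apply Rle_trans with (Phi O x); [apply (HPhi O)|].
      apply (is_series_term_le (fun n => Phi n x)); [intros n; apply (HPhi n)|].
      apply Series_correct, Hex.
    + rewrite <- (is_series_unique _ _ HE). apply Series_le; [|now exists E].
      intros n. apply (HPhi n).
  - intros t [n Hn]. destruct (HPhi n) as [_ [_ H3]].
    destruct (H3 t Hn) as [p [q [Hpq Hm]]]. exists p, q. split; [auto|].
    rewrite <- Series_minus by apply Hex.
    apply Rle_trans with (1 := Hm).
    apply (is_series_term_le (fun k => Phi k q - Phi k p)).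
    + intros k. destruct (HPhi k) as [H1 _]. specialize (H1 p q ltac:(lra)). lra.
    + apply Series_correct. exact (ex_series_minus _ _ (Hex q) (Hex p)).
Qed.

Lemma is_series_half_pow (e : R) : is_series (fun n => e * (/ 2) ^ S n) e.
Proof.
  assert (H := is_series_geom (/ 2) ltac:(rewrite Rabs_right; lra)).
  apply (is_series_scal (e * / 2)) in H.
  change (is_series (fun n => e * / 2 * (/ 2) ^ n) (e * / 2 * / (1 - / 2))) in H.
  replace (e * / 2 * / (1 - / 2)) with e in H by field.
  refine (is_series_ext _ _ _ _ H). intros n. simpl. ring.
Qed.

Definition Null (M : R -> R) (A : R -> Prop) : Prop := forall e, 0 < e -> Small M A e.

Lemma Null_countable_union (M : R -> R) (A : nat -> R -> Prop) :
  (forall n, Null M (A n)) -> Null M (fun t => exists n, A n t).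
Proof.
  intros HA e He. apply Small_countable_union with (e := fun n => e * (/ 2) ^ S n).
  - intros n. apply HA. apply Rmult_lt_0_compat; [lra|]. apply pow_lt. lra.
  - apply is_series_half_pow.
Qed.

(** Truncation to [[p, q]]: composing [M] or a linear function with it gives a monotone function
    that is constant outside the interval, hence a bounded witness for [Small]. *)
Definition clamp (p q x : R) : R := Rmax p (Rmin q x).

Lemma clamp_incr (p q x y : R) : x <= y -> clamp p q x <= clamp p q y.
Proof.
  intros. unfold clamp. apply Rle_max_compat_l. now apply Rle_min_compat_l.
Qed.

Lemma clamp_bounds (p q x : R) : p <= q -> p <= clamp p q x <= q.
Proof.
  intros. unfold clamp. split; [apply Rmax_l|]. apply Rmax_lub; [auto|apply Rmin_l].
Qed.

Lemma clamp_id (p q x : R) : p <= x <= q -> clamp p q x = x.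
Proof. intros. unfold clamp. rewrite Rmin_right, Rmax_right; lra. Qed.

Lemma Small_of_interval (M : R -> R) (p q : R) :
  (forall x y, x <= y -> M x <= M y) -> p < q ->
  Small M (fun t => p < t < q) (M q - M p).
Proof.
  intros HM Hpq. exists (fun x => M (clamp p q x) - M p). split; [|split].
  - intros x y Hxy. pose proof (HM _ _ (clamp_incr p q x y Hxy)). lra.
  - intros x. pose proof (clamp_bounds p q x ltac:(lra)) as [H1 H2].
    apply HM in H1. apply HM in H2. lra.
  - intros t Ht. exists p, q. split; [auto|]. rewrite !clamp_id by lra. lra.
Qed.

(** The witness is linear of slope [c] on [[p, q]]. One scale of density at most [c] per point is
    enough, without a Vitali selection: overlaps are accounted for once and for all when an interval
    is bounded. *)
Lemma Small_of_density (M : R -> R) (A : R -> Prop) (p q c : R) : p <= q -> 0 <= c ->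
  (forall t, A t -> exists p' q', p <= p' /\ q' <= q /\ p' < t < q' /\
     M q' - M p' <= c * (q' - p')) ->
  Small M A (c * (q - p)).
Proof.
  intros Hpq Hc HA. exists (fun x => c * (clamp p q x - p)). split; [|split].
  - intros x y Hxy. apply Rmult_le_compat_l; [auto|]. pose proof (clamp_incr p q x y Hxy). lra.
  - intros x. pose proof (clamp_bounds p q x Hpq). split.
    + apply Rmult_le_pos; lra.
    + apply Rmult_le_compat_l; lra.
  - intros t Ht. destruct (HA t Ht) as [p' [q' [H1 [H2 [H3 H4]]]]].
    exists p', q'. split; [auto|]. rewrite !clamp_id by lra. lra.
Qed.

(** * Closed differential forms on a half plane *)

Lemma differentiable_pt_lim_is_derive_l (f : R -> R -> R) (x t lx lt : R) :
  differentiable_pt_lim f x t lx lt -> is_derive (fun u => f u t) x lx.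
Proof.
  intros H. apply is_derive_Reals. replace lx with (lx * 1 + lt * 0) by ring.
  apply (derivable_pt_lim_comp_2d f (fun u => u) (fun _ => t)); [exact H| |].
  - apply derivable_pt_lim_id.
  - apply derivable_pt_lim_const.
Qed.

Lemma differentiable_pt_lim_is_derive_r (f : R -> R -> R) (x t lx lt : R) :
  differentiable_pt_lim f x t lx lt -> is_derive (f x) t lt.
Proof.
  intros H. apply is_derive_Reals. replace lt with (lx * 0 + lt * 1) by ring.
  apply (derivable_pt_lim_comp_2d f (fun _ => x) (fun u => u)); [exact H| |].
  - apply derivable_pt_lim_const.
  - apply derivable_pt_lim_id.
Qed.

(** Repeated quartering that keeps a bad cell at each stage. The lower left corners are
    nondecreasing and the upper right ones nonincreasing, so the suprema of the former lie in every
    closed cell. *)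
Lemma bisection_point (Bad : nat -> R -> R -> Prop) (x0 t0 W H : R) :
  0 <= W -> 0 <= H -> Bad O x0 t0 ->
  (forall n x t, Bad n x t -> exists x' t', Bad (S n) x' t' /\
     (x' = x \/ x' = x + W / 2 ^ S n) /\ (t' = t \/ t' = t + H / 2 ^ S n)) ->
  exists p q, forall n, exists x t, Bad n x t /\
    x <= p <= x + W / 2 ^ n /\ t <= q <= t + H / 2 ^ n.
Proof.
  intros HW HH H0 Hstep.
  assert (Hs : forall n (c : R * R), exists c' : R * R,
    Bad n (fst c) (snd c) -> Bad (S n) (fst c') (snd c') /\
     (fst c' = fst c \/ fst c' = fst c + W / 2 ^ S n) /\
     (snd c' = snd c \/ snd c' = snd c + H / 2 ^ S n)).
  { intros n c. destruct (classic (Bad n (fst c) (snd c))) as [Hb|Hb].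
    - destruct (Hstep n _ _ Hb) as [x' [t' Hxt]]. exists (x', t'). intros _. exact Hxt.
    - exists c. intros Hc. contradiction. }
  set (nxt := fun n c => proj1_sig (constructive_indefinite_description _ (Hs n c))).
  assert (Hnxt : forall n c, Bad n (fst c) (snd c) -> Bad (S n) (fst (nxt n c)) (snd (nxt n c)) /\
     (fst (nxt n c) = fst c \/ fst (nxt n c) = fst c + W / 2 ^ S n) /\
     (snd (nxt n c) = snd c \/ snd (nxt n c) = snd c + H / 2 ^ S n)).
  { intros n c. apply (proj2_sig (constructive_indefinite_description _ (Hs n c))). }
  clearbody nxt. clear Hs.
  set (c := fix c n := match n with O => (x0, t0) | S n => nxt n (c n) end).
  assert (Hc : forall n, Bad n (fst (c n)) (snd (c n))).
  { induction n as [|n IH]; [exact H0|]. apply (Hnxt n (c n) IH). }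
  assert (Hlim : forall (u : nat -> R) L, 0 <= L ->
    (forall n, u (S n) = u n \/ u (S n) = u n + L / 2 ^ S n) ->
    exists l, forall n, u n <= l <= u n + L / 2 ^ n).
  { intros u L HL Hu.
    assert (Hpos : forall n, 0 <= L / 2 ^ n).
    { intros n. apply Rle_div_r; [apply pow_lt; lra|]. rewrite Rmult_0_l. exact HL. }
    assert (Hhalf : forall n, L / 2 ^ n = L / 2 ^ S n + L / 2 ^ S n).
    { intros n. simpl. field. apply pow_nonzero. lra. }
    assert (Hup : forall n m, u n <= u (n + m)%nat).
    { intros n m. induction m as [|m IH].
      - rewrite Nat.add_0_r. lra.
      - rewrite Nat.add_succ_r. pose proof (Hpos (S (n + m))).
        destruct (Hu (n + m)%nat) as [E|E]; rewrite E; lra. }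
    assert (Hdn : forall n m, u (n + m)%nat + L / 2 ^ (n + m) <= u n + L / 2 ^ n).
    { intros n m. induction m as [|m IH].
      - rewrite Nat.add_0_r. lra.
      - rewrite Nat.add_succ_r. pose proof (Hpos (S (n + m))).
        pose proof (Hhalf (n + m)%nat).
        destruct (Hu (n + m)%nat) as [E|E]; rewrite E; lra. }
    destruct (completeness (fun y => exists n, y = u n)) as [l [Hl1 Hl2]].
    - exists (u O + L / 2 ^ 0). intros y [n ->].
      pose proof (Hdn O n) as E. rewrite !Nat.add_0_l in E. pose proof (Hpos n). lra.
    - exists (u O). now exists O.
    - exists l. intros n. split; [apply Hl1; now exists n|].
      apply Hl2. intros y [m ->].
      destruct (Nat.le_ge_cases n m) as [Hnm|Hnm].
      + replace m with (n + (m - n))%nat by lia.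
        pose proof (Hdn n (m - n)%nat). pose proof (Hpos (n + (m - n))%nat). lra.
      + pose proof (Hup m (n - m)%nat) as E. replace (m + (n - m))%nat with n in E by lia.
        pose proof (Hpos n). lra. }
  destruct (Hlim (fun n => fst (c n)) W HW) as [p Hp].
  { intros n. apply (Hnxt n (c n) (Hc n)). }
  destruct (Hlim (fun n => snd (c n)) H HH) as [q Hq].
  { intros n. apply (Hnxt n (c n) (Hc n)). }
  exists p, q. intros n. exists (fst (c n)), (snd (c n)). auto.
Qed.

(* The differential form [A dt + B dx] on the half plane [x > 0]. *)
Definition closed_form (A B : R -> R -> R) : Prop := forall x t, 0 < x ->
  exists l k m, differentiable_pt_lim A x t l k /\ differentiable_pt_lim B x t m l.

Lemma closed_form_continuous_r A B x t : closed_form A B -> 0 < x -> continuous (A x) t.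
Proof.
  intros H Hx. destruct (H x t Hx) as [l [k [m [HA _]]]].
  apply (ex_derive_continuous (A x)). eexists. eapply differentiable_pt_lim_is_derive_r, HA.
Qed.

Lemma closed_form_continuous_l A B x t : closed_form A B -> 0 < x ->
  continuous (fun u => B u t) x.
Proof.
  intros H Hx. destruct (H x t Hx) as [l [k [m [_ HB]]]].
  apply (ex_derive_continuous (fun u => B u t)). eexists.
  eapply differentiable_pt_lim_is_derive_l, HB.
Qed.

Lemma closed_form_ex_RInt_r A B x t1 t2 : closed_form A B -> 0 < x -> ex_RInt (A x) t1 t2.
Proof.
  intros H Hx. apply (ex_RInt_continuous (A x)). intros t _.
  eapply closed_form_continuous_r; eauto.
Qed.

Lemma closed_form_ex_RInt_l A B x1 x2 t : closed_form A B -> 0 < x1 -> 0 < x2 ->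
  ex_RInt (fun u => B u t) x1 x2.
Proof.
  intros H H1 H2. apply (ex_RInt_continuous (fun u => B u t)). intros x Hx.
  eapply closed_form_continuous_l; eauto.
  pose proof (Rmin_glb_lt _ _ _ H1 H2). lra.
Qed.

Lemma RInt_near_const (g : R -> R) (a b c K : R) : a <= b -> ex_RInt g a b ->
  (forall t, a <= t <= b -> Rabs (g t - c) <= K) ->
  Rabs (RInt g a b - c * (b - a)) <= K * (b - a).
Proof.
  intros Hab Hg HK.
  replace (RInt g a b - c * (b - a)) with (RInt (fun t => g t - c) a b).
  - rewrite Rmult_comm. apply abs_RInt_le_const; auto.
    refine (ex_RInt_minus _ _ _ _ Hg _). apply ex_RInt_const.
  - assert (E := RInt_minus g (fun _ => c) a b Hg (ex_RInt_const _ _ _)).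
    unfold minus, plus, opp in E; simpl in E. unfold Rminus. rewrite E.
    rewrite RInt_const. unfold scal; simpl; unfold mult; simpl. ring.
Qed.

(** The integral of [A dt + B dx] counterclockwise along the boundary of [[x, x + w]] times
    [[t, t + h]]. *)
Definition rect_circulation (A B : R -> R -> R) (x t w h : R) : R :=
  RInt (A (x + w)) t (t + h) - RInt (A x) t (t + h)
  - RInt (fun u => B u (t + h)) x (x + w) + RInt (fun u => B u t) x (x + w).

Lemma rect_circulation_split A B x t w h : closed_form A B -> 0 < x -> 0 <= w ->
  rect_circulation A B x t (w + w) (h + h) =
  rect_circulation A B x t w h + rect_circulation A B (x + w) t w h
  + rect_circulation A B x (t + h) w h + rect_circulation A B (x + w) (t + h) w h.
Proof.
  intros H Hx Hw. unfold rect_circulation. rewrite <- !Rplus_assoc.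
  assert (HA : forall u, 0 < u -> RInt (A u) t (t + h + h) =
    RInt (A u) t (t + h) + RInt (A u) (t + h) (t + h + h)).
  { intros u Hu. symmetry.
    apply (RInt_Chasles (A u)); eapply closed_form_ex_RInt_r; eauto. }
  assert (HB : forall s, RInt (fun u => B u s) x (x + w + w) =
    RInt (fun u => B u s) x (x + w) + RInt (fun u => B u s) (x + w) (x + w + w)).
  { intros s. symmetry.
    apply (RInt_Chasles (fun u => B u s)); eapply closed_form_ex_RInt_l; eauto; lra. }
  rewrite !HA, !HB by lra. ring.
Qed.

(** The affine part of the form at [(p, q)] has no circulation: the common value [l] of the two
    mixed derivatives contributes [l * w * h] through the vertical sides and removes it through the
    horizontal ones. Only the first-order remainders are left. *)
Lemma rect_circulation_local A B p q : closed_form A B -> 0 < p ->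
  forall eta, 0 < eta -> exists d, 0 < d /\ forall x t w h,
    0 < x -> x <= p <= x + w -> t <= q <= t + h -> w < d -> h < d ->
    Rabs (rect_circulation A B x t w h) <= 2 * eta * ((w + h) * (w + h)).
Proof.
  intros Hcl Hp eta Heta. destruct (Hcl p q Hp) as [l [k [m [HA HB]]]].
  destruct (HA (mkposreal eta Heta)) as [d1 Hd1]. destruct (HB (mkposreal eta Heta)) as [d2 Hd2].
  exists (Rmin d1 d2). split; [apply Rmin_glb_lt; apply cond_pos|].
  intros x t w h Hx Hxp Htq Hw Hh.
  pose proof (Rmin_l d1 d2). pose proof (Rmin_r d1 d2). simpl in Hd1, Hd2.
  assert (Hmax : forall u v, x <= u <= x + w -> t <= v <= t + h ->
    Rmax (Rabs (u - p)) (Rabs (v - q)) <= w + h).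
  { intros u v Hu Hv. apply Rmax_lub; apply Rabs_le; lra. }
  assert (EA : forall u v, x <= u <= x + w -> t <= v <= t + h ->
    Rabs (A u v - A p q - (l * (u - p) + k * (v - q))) <= eta * (w + h)).
  { intros u v Hu Hv. eapply Rle_trans.
    - apply Hd1; apply Rabs_def1; lra.
    - apply Rmult_le_compat_l; [lra|auto]. }
  assert (EB : forall u v, x <= u <= x + w -> t <= v <= t + h ->
    Rabs (B u v - B p q - (m * (u - p) + l * (v - q))) <= eta * (w + h)).
  { intros u v Hu Hv. eapply Rle_trans.
    - apply Hd2; apply Rabs_def1; lra.
    - apply Rmult_le_compat_l; [lra|auto]. }
  assert (IA : Rabs (RInt (A (x + w)) t (t + h) - RInt (A x) t (t + h) - l * w * h)
    <= 2 * eta * (w + h) * h).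
  { replace (RInt (A (x + w)) t (t + h) - RInt (A x) t (t + h)) with
      (RInt (fun v => A (x + w) v - A x v) t (t + h)).
    - replace (l * w * h) with (l * w * (t + h - t)) by ring.
      replace (2 * eta * (w + h) * h) with (2 * eta * (w + h) * (t + h - t)) by ring.
      apply RInt_near_const; [lra| |].
      + refine (ex_RInt_minus _ _ _ _ _ _); eapply closed_form_ex_RInt_r; eauto; lra.
      + intros v Hv. pose proof (EA (x + w) v ltac:(lra) Hv) as E1.
        pose proof (EA x v ltac:(lra) Hv) as E2.
        apply Rabs_le_between in E1. apply Rabs_le_between in E2.
        apply Rabs_le. lra.
    - refine (RInt_minus _ _ _ _ _ _); eapply closed_form_ex_RInt_r; eauto; lra. }
  assert (IB : Rabs (RInt (fun u => B u (t + h)) x (x + w) - RInt (fun u => B u t) x (x + w)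
      - l * h * w) <= 2 * eta * (w + h) * w).
  { replace (RInt (fun u => B u (t + h)) x (x + w) - RInt (fun u => B u t) x (x + w)) with
      (RInt (fun u => B u (t + h) - B u t) x (x + w)).
    - replace (l * h * w) with (l * h * (x + w - x)) by ring.
      replace (2 * eta * (w + h) * w) with (2 * eta * (w + h) * (x + w - x)) by ring.
      apply RInt_near_const; [lra| |].
      + refine (ex_RInt_minus _ _ _ _ _ _); eapply closed_form_ex_RInt_l; eauto; lra.
      + intros v Hv. pose proof (EB v (t + h) Hv ltac:(lra)) as E1.
        pose proof (EB v t Hv ltac:(lra)) as E2.
        apply Rabs_le_between in E1. apply Rabs_le_between in E2.
        apply Rabs_le. lra.
    - refine (RInt_minus _ _ _ _ _ _); eapply closed_form_ex_RInt_l; eauto; lra. }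
  unfold rect_circulation. apply Rabs_le_between in IA. apply Rabs_le_between in IB.
  apply Rabs_le. lra.
Qed.

(* Goursat's argument: the derivatives are not assumed to be continuous. *)
Lemma rect_circulation_zero A B x1 t1 W H : closed_form A B -> 0 < x1 -> 0 <= W -> 0 <= H ->
  rect_circulation A B x1 t1 W H = 0.
Proof.
  intros Hcl Hx1 HW HH. apply NNPP. intros Hne.
  set (kap := Rabs (rect_circulation A B x1 t1 W H)).
  assert (Hkap : 0 < kap) by (apply Rabs_pos_lt; exact Hne).
  (* At least one of the four quarters of a rectangle carries a quarter of its circulation;
     [x1 <= x] keeps the cells inside the half plane. *)
  destruct (bisection_point (fun n x t => x1 <= x /\
    kap / 4 ^ n <= Rabs (rect_circulation A B x t (W / 2 ^ n) (H / 2 ^ n))) x1 t1 W H HW HH)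
    as [p [q Hpq]].
  { split; [lra|]. simpl. replace (W / 1) with W by field. replace (H / 1) with H by field.
    unfold kap. lra. }
  { intros n x t [Hx Hbad].
    assert (HWn : 0 <= W / 2 ^ S n).
    { apply Rle_div_r; [apply pow_lt; lra|]. lra. }
    replace (W / 2 ^ n) with (W / 2 ^ S n + W / 2 ^ S n) in Hbad
      by (simpl; field; apply pow_nonzero; lra).
    replace (H / 2 ^ n) with (H / 2 ^ S n + H / 2 ^ S n) in Hbad
      by (simpl; field; apply pow_nonzero; lra).
    replace (kap / 4 ^ n) with (4 * (kap / 4 ^ S n)) in Hbad
      by (simpl; field; apply pow_nonzero; lra).
    rewrite rect_circulation_split in Hbad; auto; try lra.
    set (w := W / 2 ^ S n) in *. set (h := H / 2 ^ S n) in *.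
    set (e := kap / 4 ^ S n) in *.
    destruct (Rle_dec e (Rabs (rect_circulation A B x t w h))) as [C1|C1].
    { exists x, t. split; [split; [lra|exact C1]|auto]. }
    destruct (Rle_dec e (Rabs (rect_circulation A B (x + w) t w h))) as [C2|C2].
    { exists (x + w), t. split; [split; [lra|exact C2]|auto]. }
    destruct (Rle_dec e (Rabs (rect_circulation A B x (t + h) w h))) as [C3|C3].
    { exists x, (t + h). split; [split; [lra|exact C3]|auto]. }
    destruct (Rle_dec e (Rabs (rect_circulation A B (x + w) (t + h) w h))) as [C4|C4].
    { exists (x + w), (t + h). split; [split; [lra|exact C4]|auto]. }
    exfalso. revert Hbad. apply Rlt_not_le.
    eapply Rle_lt_trans; [apply Rabs_triang|].
    eapply Rle_lt_trans; [apply Rplus_le_compat_r, Rabs_triang|].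
    eapply Rle_lt_trans; [apply Rplus_le_compat_r, Rplus_le_compat_r, Rabs_triang|]. lra. }
  assert (Hp : 0 < p). { destruct (Hpq O) as [x [t [[Hx _] [Hxp _]]]]. lra. }
  (* With [eta = kap / (4 * S2)] the local bound on the n-th cell is less than half of
     [kap / 4 ^ n]. The [+ 1] keeps [S2] positive for a degenerate rectangle. *)
  set (S2 := (W + H) * (W + H) + 1).
  assert (HS2 : 0 < S2) by (unfold S2; nra).
  destruct (rect_circulation_local A B p q Hcl Hp (kap / (4 * S2))) as [d [Hd Hloc]].
  { apply Rdiv_lt_0_compat; lra. }
  destruct (is_lim_seq_geom (/ 2) ltac:(rewrite Rabs_right; lra)
    (fun y => (W + H + 1) * Rabs y < d)) as [n Hn].
  { assert (Hd' : 0 < d / (W + H + 1)) by (apply Rdiv_lt_0_compat; lra).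
    exists (mkposreal _ Hd'). intros y Hy. unfold ball in Hy; simpl in Hy.
    unfold AbsRing_ball, abs, minus, plus, opp in Hy; simpl in Hy.
    rewrite Ropp_0, Rplus_0_r in Hy.
    apply (Rmult_lt_compat_l (W + H + 1)) in Hy; [|lra].
    replace ((W + H + 1) * (d / (W + H + 1))) with d in Hy by (field; lra). exact Hy. }
  specialize (Hn n (le_n n)). rewrite pow_inv in Hn.
  assert (H2n : 0 < / 2 ^ n) by (apply Rinv_0_lt_compat, pow_lt; lra).
  rewrite (Rabs_right (/ 2 ^ n)) in Hn by lra.
  destruct (Hpq n) as [x [t [[Hx Hbad] [Hxp Htq]]]].
  assert (E4 : kap / 4 ^ n = kap * (/ 2 ^ n * / 2 ^ n)).
  { replace 4 with (2 * 2) by ring. rewrite Rpow_mult_distr. field. apply pow_nonzero; lra. }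
  assert (Hb := Hloc x t (W / 2 ^ n) (H / 2 ^ n) ltac:(lra) Hxp Htq).
  unfold Rdiv in Hb, Hbad, Hn. fold (Rdiv kap (4 ^ n)) in Hbad. rewrite E4 in Hbad.
  set (r := / 2 ^ n) in *.
  assert (Hb' := Hb ltac:(nra) ltac:(nra)).
  assert (E5 : 2 * (kap * / (4 * S2)) * ((W * r + H * r) * (W * r + H * r)) =
     kap * (r * r) * ((W + H) * (W + H) / (2 * S2))) by (field; lra).
  rewrite E5 in Hb'.
  assert (Hfrac : (W + H) * (W + H) / (2 * S2) < 1).
  { apply Rlt_div_l; [lra|]. unfold S2. nra. }
  assert (0 < kap * (r * r)) by (apply Rmult_lt_0_compat; [lra|nra]).
  nra.
Qed.

Lemma closed_form_rectangle A B x1 x2 t1 t2 : closed_form A B -> 0 < x1 -> 0 < x2 ->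
  RInt (A x2) t1 t2 - RInt (A x1) t1 t2 =
  RInt (fun u => B u t2) x1 x2 - RInt (fun u => B u t1) x1 x2.
Proof.
  intros Hcl.
  assert (Hle : forall x1 x2 t1 t2, 0 < x1 -> x1 <= x2 -> t1 <= t2 ->
    RInt (A x2) t1 t2 - RInt (A x1) t1 t2 =
    RInt (fun u => B u t2) x1 x2 - RInt (fun u => B u t1) x1 x2).
  { clear x1 x2 t1 t2. intros x1 x2 t1 t2 H1 H12 Ht.
    assert (E := rect_circulation_zero A B x1 t1 (x2 - x1) (t2 - t1) Hcl H1
      ltac:(lra) ltac:(lra)).
    unfold rect_circulation in E.
    replace (x1 + (x2 - x1)) with x2 in E by ring.
    replace (t1 + (t2 - t1)) with t2 in E by ring. lra. }
  assert (Hx : forall x1 x2 t1 t2, 0 < x1 -> 0 < x2 -> t1 <= t2 ->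
    RInt (A x2) t1 t2 - RInt (A x1) t1 t2 =
    RInt (fun u => B u t2) x1 x2 - RInt (fun u => B u t1) x1 x2).
  { clear x1 x2 t1 t2. intros x1 x2 t1 t2 H1 H2 Ht.
    destruct (Rle_dec x1 x2) as [H12|H12]; [auto|].
    assert (E := Hle x2 x1 t1 t2 H2 ltac:(lra) Ht).
    assert (E1 := opp_RInt_swap (fun u => B u t1) x2 x1 ltac:(eapply closed_form_ex_RInt_l; eauto)).
    assert (E2 := opp_RInt_swap (fun u => B u t2) x2 x1 ltac:(eapply closed_form_ex_RInt_l; eauto)).
    unfold opp in E1, E2; simpl in E1, E2. lra. }
  intros H1 H2. destruct (Rle_dec t1 t2) as [Ht|Ht]; [auto|].
  assert (E := Hx x1 x2 t2 t1 H1 H2 ltac:(lra)).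
  assert (E1 := opp_RInt_swap (A x1) t2 t1 ltac:(eapply closed_form_ex_RInt_r; eauto)).
  assert (E2 := opp_RInt_swap (A x2) t2 t1 ltac:(eapply closed_form_ex_RInt_r; eauto)).
  unfold opp in E1, E2; simpl in E1, E2. lra.
Qed.

Lemma closed_form_potential A B : closed_form A B ->
  exists Y : R -> R -> R, forall x t, 0 < x ->
    is_derive (Y x) t (A x t) /\ is_derive (fun u => Y u t) x (B x t).
Proof.
  intros Hcl.
  (* Integration along the path from [(1, 0)] to [(1, t)] to [(x, t)]. For the derivative in [t] the
     rectangle identity exchanges it for the path through [(x, 0)], so that in both cases only an
     upper bound of integration varies. *)
  exists (fun x t => RInt (A 1) 0 t + RInt (fun u => B u t) 1 x). intros x t Hx. split.
  - apply (is_derive_ext (fun s => RInt (A x) 0 s + RInt (fun u => B u 0) 1 x)).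
    + intros s. pose proof (closed_form_rectangle A B 1 x 0 s Hcl ltac:(lra) Hx).
      change (RInt (A x) 0 s + RInt (fun u => B u 0) 1 x =
        RInt (A 1) 0 s + RInt (fun u => B u s) 1 x). lra.
    + replace (A x t) with (A x t + 0) by ring.
      refine (is_derive_plus (fun s => RInt (A x) 0 s) (fun _ => RInt (fun u => B u 0) 1 x)
        t (A x t) 0 _ _).
      * apply (is_derive_RInt (A x) (fun s => RInt (A x) 0 s) 0).
        -- exists (mkposreal 1 Rlt_0_1). intros s _.
           apply (RInt_correct (A x)). eapply closed_form_ex_RInt_r; eauto.
        -- eapply closed_form_continuous_r; eauto.
      * refine (is_derive_const _ _).
  - replace (B x t) with (0 + B x t) by ring.
    refine (is_derive_plus (fun _ => RInt (A 1) 0 t) (fun s => RInt (fun u => B u t) 1 s)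
        x 0 (B x t) _ _).
    + refine (is_derive_const _ _).
    + apply (is_derive_RInt (fun u => B u t) (fun s => RInt (fun u => B u t) 1 s) 1).
      * exists (mkposreal x Hx). intros s Hs. unfold ball in Hs; simpl in Hs.
        unfold AbsRing_ball, abs, minus, plus, opp in Hs; simpl in Hs.
        apply Rabs_lt_between in Hs.
        apply (RInt_correct (fun u => B u t)). eapply closed_form_ex_RInt_l; eauto; lra.
      * eapply closed_form_continuous_l; eauto.
Qed.

(** * Contractive holomorphic pairs *)

Lemma Rpower_small (A beta eps : R) : 0 <= A -> 0 < beta -> 0 < eps ->
  exists y0, 0 < y0 <= 1 /\ forall y, 0 < y <= y0 -> A * Rpower y beta < eps.
Proof.
  intros HA Hb He.
  assert (Hq : 0 < eps / (A + 1)) by (apply Rdiv_lt_0_compat; lra).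
  set (y1 := Rpower (eps / (A + 1)) (/ beta)).
  assert (Hy1 : 0 < y1) by apply exp_pos.
  exists (Rmin 1 y1). split; [split; [apply Rmin_glb_lt; lra|apply Rmin_l]|].
  intros y Hy. pose proof (Rmin_r 1 y1).
  assert (H1 : Rpower y beta <= Rpower y1 beta) by (apply Rle_Rpower_l; lra).
  unfold y1 in H1. rewrite Rpower_mult in H1. replace (/ beta * beta) with 1 in H1 by (field; lra).
  rewrite Rpower_1 in H1 by auto.
  apply Rle_lt_trans with (A * (eps / (A + 1))); [apply Rmult_le_compat_l; auto|].
  replace (A * (eps / (A + 1))) with (eps * (A / (A + 1))) by (field; lra).
  rewrite <- (Rmult_1_r eps) at 2. apply Rmult_lt_compat_l; [auto|].
  apply Rlt_div_l; lra.
Qed.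

Lemma le_of_le_plus_Rpower (u v A beta : R) : 0 <= A -> 0 < beta ->
  (exists y1, 0 < y1 /\ forall y, 0 < y <= y1 -> u <= v + A * Rpower y beta) -> u <= v.
Proof.
  intros HA Hb [y1 [Hy1 H]]. apply le_epsilon. intros eps He.
  destruct (Rpower_small A beta eps HA Hb He) as [y0 [Hy0 Hs]].
  pose proof (Rmin_l y1 y0). pose proof (Rmin_r y1 y0).
  assert (0 < Rmin y1 y0) by (apply Rmin_glb_lt; lra).
  specialize (H (Rmin y1 y0) ltac:(lra)). specialize (Hs (Rmin y1 y0) ltac:(lra)). lra.
Qed.

(** The modulus says that [phi - A x^beta] is nonincreasing and [phi + A x^beta] nondecreasing in
    [x]; the limit at 0 is the supremum of the former, and it lies below every value of the
    latter. *)
Lemma limit_of_Rpower_modulus (phi : R -> R) (A beta : R) : 0 <= A -> 0 < beta ->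
  (forall y x, 0 < y -> y <= x -> x <= 1 ->
     Rabs (phi x - phi y) <= A * (Rpower x beta - Rpower y beta)) ->
  exists l, forall x, 0 < x <= 1 -> Rabs (phi x - l) <= A * Rpower x beta.
Proof.
  intros HA Hb H.
  assert (Hpos : forall x, 0 < Rpower x beta) by (intros x; apply exp_pos).
  destruct (completeness (fun v => exists y, 0 < y <= 1 /\ v = phi y - A * Rpower y beta))
    as [l [Hl1 Hl2]].
  - exists (phi 1 + A * Rpower 1 beta). intros v [y [Hy ->]].
    pose proof (H y 1 ltac:(lra) ltac:(lra) ltac:(lra)) as E.
    apply Rabs_le_between in E. pose proof (Hpos y). pose proof (Hpos 1). nra.
  - exists (phi 1 - A * Rpower 1 beta), 1. split; [lra|reflexivity].
  - exists l. intros x Hx. apply Rabs_le. split.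
    + assert (l <= phi x + A * Rpower x beta); [|lra]. apply Hl2. intros v [y [Hy ->]].
      pose proof (Hpos x). pose proof (Hpos y).
      destruct (Rle_dec y x) as [Hyx|Hyx].
      * pose proof (H y x ltac:(lra) ltac:(lra) ltac:(lra)) as E.
        apply Rabs_le_between in E. nra.
      * pose proof (H x y ltac:(lra) ltac:(lra) ltac:(lra)) as E.
        apply Rabs_le_between in E. nra.
    + assert (phi x - A * Rpower x beta <= l); [|lra]. apply Hl1. exists x. auto.
Qed.

(* [U + i V] is a holomorphic function of [- x + i t], with derivative [P + i Q]. *)
Definition holomorphic_pair (U V P Q : R -> R -> R) : Prop := forall x t, 0 < x ->
  differentiable_pt_lim U x t (- P x t) (- Q x t) /\
  differentiable_pt_lim V x t (- Q x t) (P x t).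

(** Both parts of the derivative are bounded separately, as they are used: [P] governs [U] in [x]
    and [V] in [t], while [Q] governs [U] in [t] and [V] in [x]. *)
Definition contractive_pair (D : R) (U V P Q : R -> R -> R) : Prop :=
  holomorphic_pair U V P Q /\ forall x t, 0 < x -> 0 < U x t /\
    Rabs (P x t) <= D * U x t / x /\ Rabs (Q x t) <= D * U x t / x.

Lemma differentiable_pt_lim_opp (f : R -> R -> R) (x t l k : R) :
  differentiable_pt_lim f x t l k ->
  differentiable_pt_lim (fun u v => - f u v) x t (- l) (- k).
Proof.
  intros H eps. destruct (H eps) as [d Hd]. exists d. intros u v Hu Hv.
  rewrite <- Rabs_Ropp.
  replace (- (- f u v - - f x t - (- l * (u - x) + - k * (v - t)))) with
    (f u v - f x t - (l * (u - x) + k * (v - t))) by ring. auto.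
Qed.

(** [U dt - V dx] is the imaginary part of [(U + i V) d(- x + i t)], and [V dt + U dx] is the
    opposite of its real part: the two potentials are conjugate, up to sign. *)
Lemma holomorphic_pair_closed_im U V P Q : holomorphic_pair U V P Q ->
  closed_form U (fun x t => - V x t).
Proof.
  intros H x t Hx. destruct (H x t Hx) as [HU HV].
  exists (- P x t), (- Q x t), (- - Q x t). split; [exact HU|].
  apply differentiable_pt_lim_opp, HV.
Qed.

Lemma holomorphic_pair_closed_re U V P Q : holomorphic_pair U V P Q -> closed_form V U.
Proof.
  intros H x t Hx. destruct (H x t Hx) as [HU HV].
  exists (- Q x t), (P x t), (- P x t). auto.
Qed.

(** Dividing the contraction bound by [U] shows that, along each coordinate direction, [ln U] is
    Lipschitz of ratio [D] for the hyperbolic length element [1 / x]. Growth, decay and the Harnack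
    inequality are exponentials of this. *)
Lemma contractive_ln_vertical D U V P Q : contractive_pair D U V P Q ->
  forall y x t, 0 < y -> y <= x ->
  Rabs (ln (U x t) - ln (U y t)) <= D * (ln x - ln y).
Proof.
  intros [Hh Hc] y x t Hy Hyx. rewrite Rmult_minus_distr_l.
  apply (increment_abs_dominated (fun u => ln (U u t)) (fun u => D * ln u)
    (fun u => - P u t / U u t) (fun u => D / u)); auto.
  - intros u Hu. destruct (Hc u t ltac:(lra)) as [Hpos _].
    destruct (Hh u t ltac:(lra)) as [HU _]. apply differentiable_pt_lim_is_derive_l in HU.
    unfold Rdiv. refine (is_derive_comp ln (fun u => U u t) u (/ U u t) _ _ HU).
    apply is_derive_Reals, derivable_pt_lim_ln, Hpos.
  - intros u Hu. auto_derive; [lra|]. field. lra.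
  - intros u Hu. destruct (Hc u t ltac:(lra)) as [Hpos [HP _]].
    unfold Rdiv. rewrite Rabs_mult, Rabs_Ropp, (Rabs_right (/ U u t));
      [|left; apply Rinv_0_lt_compat, Hpos].
    apply Rle_div_l; [lra|]. replace (D * / u * U u t) with (D * U u t / u); [exact HP|].
    unfold Rdiv. ring.
Qed.

Lemma contractive_ln_horizontal D U V P Q : contractive_pair D U V P Q ->
  forall x t t', 0 < x -> t <= t' ->
  Rabs (ln (U x t') - ln (U x t)) <= D / x * (t' - t).
Proof.
  intros [Hh Hc] x t t' Hx Htt. rewrite Rmult_minus_distr_l.
  apply (increment_abs_dominated (fun u => ln (U x u)) (fun u => D / x * u)
    (fun u => - Q x u / U x u) (fun u => D / x)); auto.
  - intros u Hu. destruct (Hc x u Hx) as [Hpos _].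
    destruct (Hh x u Hx) as [HU _]. apply differentiable_pt_lim_is_derive_r in HU.
    unfold Rdiv. refine (is_derive_comp ln (fun u => U x u) u (/ U x u) _ _ HU).
    apply is_derive_Reals, derivable_pt_lim_ln, Hpos.
  - intros u Hu. auto_derive; [auto|]. ring.
  - intros u Hu. destruct (Hc x u Hx) as [Hpos [_ HQ]].
    unfold Rdiv. rewrite Rabs_mult, Rabs_Ropp, (Rabs_right (/ U x u));
      [|left; apply Rinv_0_lt_compat, Hpos].
    apply Rle_div_l; [lra|]. replace (D * / x * U x u) with (D * U x u / x); [exact HQ|].
    unfold Rdiv. ring.
Qed.

Lemma le_mult_exp_of_ln (a b c : R) : 0 < a -> 0 < b -> ln a - ln b <= c -> a <= b * exp c.
Proof.
  intros Ha Hb H. rewrite <- (exp_ln a Ha), <- (exp_ln b Hb) at 1. rewrite <- exp_plus.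
  destruct (Rle_lt_or_eq_dec (ln a) (ln b + c) ltac:(lra)) as [E|E];
    [left; now apply exp_increasing|rewrite E; lra].
Qed.

(** Here and below [exp (D * (ln x - ln y))] is the power [(x / y)^D], in a form that is easy to
    differentiate. *)
Lemma contractive_growth D U V P Q : contractive_pair D U V P Q ->
  forall y x t, 0 < y -> y <= x -> U y t <= U x t * exp (D * (ln x - ln y)).
Proof.
  intros H y x t Hy Hyx. pose proof (contractive_ln_vertical D U V P Q H y x t Hy Hyx) as E.
  apply Rabs_le_between in E.
  apply le_mult_exp_of_ln; [apply H; lra|apply H; lra|lra].
Qed.

Lemma contractive_decay D U V P Q : contractive_pair D U V P Q ->
  forall y x t, 0 < y -> y <= x -> U x t <= U y t * exp (D * (ln x - ln y)).
Proof.
  intros H y x t Hy Hyx. pose proof (contractive_ln_vertical D U V P Q H y x t Hy Hyx) as E.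
  apply Rabs_le_between in E.
  apply le_mult_exp_of_ln; [apply H; lra|apply H; lra|lra].
Qed.

Lemma contractive_horizontal D U V P Q : contractive_pair D U V P Q ->
  forall x t t', 0 < x -> U x t' <= U x t * exp (D / x * Rabs (t' - t)).
Proof.
  intros H x t t' Hx. apply le_mult_exp_of_ln; [apply H; lra|apply H; lra|].
  destruct (Rle_dec t t') as [Htt|Htt].
  - pose proof (contractive_ln_horizontal D U V P Q H x t t' Hx Htt) as E.
    apply Rabs_le_between in E. rewrite (Rabs_right (t' - t)) by lra. lra.
  - pose proof (contractive_ln_horizontal D U V P Q H x t' t Hx ltac:(lra)) as E.
    apply Rabs_le_between in E. rewrite (Rabs_left (t' - t)) by lra.
    replace (- (t' - t)) with (t - t') by ring. lra.
Qed.

(** A horizontal move by at most [x] at height [x] has hyperbolic length at most 1, so it costs a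
    factor [e^D], which is at most 3. *)
Lemma contractive_harnack D U V P Q : contractive_pair D U V P Q -> 0 <= D < 1 ->
  forall x t t', 0 < x -> Rabs (t' - t) <= x -> U x t' <= 3 * U x t.
Proof.
  intros H HD x t t' Hx Htt. pose proof (contractive_horizontal D U V P Q H x t t' Hx).
  assert (exp (D / x * Rabs (t' - t)) <= 3).
  { apply Rle_trans with (exp 1); [|apply exp_le_3].
    assert (D / x * Rabs (t' - t) <= 1).
    { replace (D / x * Rabs (t' - t)) with (D * Rabs (t' - t) / x) by (unfold Rdiv; ring).
      apply Rle_div_l; [lra|]. pose proof (Rabs_pos (t' - t)). nra. }
    destruct (Rle_lt_or_eq_dec _ _ H1) as [E|E]; [left; now apply exp_increasing|rewrite E; lra]. }
  assert (0 < U x t) by (apply H; auto). nra.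
Qed.

Lemma is_derive_exp_ln_ratio (D x u : R) : 0 < u ->
  is_derive (fun u => exp (D * (ln x - ln u))) u (- (D / u * exp (D * (ln x - ln u)))).
Proof. intros Hu. auto_derive; [auto|]. unfold Rdiv, Rminus. ring. Qed.

Lemma is_derive_mult_exp_ln_ratio (D x u : R) : 0 < u ->
  is_derive (fun u => u * exp (D * (ln x - ln u))) u ((1 - D) * exp (D * (ln x - ln u))).
Proof. intros Hu. auto_derive; [auto|]. unfold Rminus. field. lra. Qed.

(** The growth of [U] bounds the derivative of [V] at height [u] by [D / u * (x / u)^D * U x t],
    which has the explicit primitive [- (x / u)^D * U x t]. So [V] grows no faster than [U]. *)
Lemma contractive_V_vertical D U V P Q : contractive_pair D U V P Q -> 0 <= D ->
  forall y x t, 0 < y -> y <= x ->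
  Rabs (V x t - V y t) <= U x t * exp (D * (ln x - ln y)).
Proof.
  intros H HD y x t Hy Hyx.
  assert (HU : 0 < U x t) by (apply H; lra).
  assert (E : Rabs (V x t - V y t) <=
    - U x t * exp (D * (ln x - ln x)) - - U x t * exp (D * (ln x - ln y))).
  { apply (increment_abs_dominated (fun u => V u t)
      (fun u => - U x t * exp (D * (ln x - ln u)))
      (fun u => - Q u t) (fun u => - U x t * (- (D / u * exp (D * (ln x - ln u)))))); auto.
    - intros u Hu. destruct H as [Hh _]. destruct (Hh u t ltac:(lra)) as [_ HV].
      eapply differentiable_pt_lim_is_derive_l, HV.
    - intros u Hu. refine (is_derive_scal _ _ _ _ _). apply is_derive_exp_ln_ratio. lra.
    - intros u Hu. rewrite Rabs_Ropp.
      destruct H as [Hh Hc]. destruct (Hc u t ltac:(lra)) as [_ [_ HQ]].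
      pose proof (contractive_growth D U V P Q (conj Hh Hc) u x t ltac:(lra) ltac:(lra)) as G.
      eapply Rle_trans; [exact HQ|].
      replace (- U x t * - (D / u * exp (D * (ln x - ln u)))) with
        (D / u * (U x t * exp (D * (ln x - ln u)))) by ring.
      replace (D * U u t / u) with (D / u * U u t) by (unfold Rdiv; ring).
      apply Rmult_le_compat_l; [|exact G].
      apply Rle_div_r; lra. }
  replace (D * (ln x - ln x)) with 0 in E by ring. rewrite exp_0 in E. lra.
Qed.

Lemma contractive_V_horizontal D U V P Q : contractive_pair D U V P Q -> 0 <= D < 1 ->
  forall x t, 0 < x -> Rabs (V x (t + x) - V x (t - x)) <= 6 * U x t.
Proof.
  intros H HD x t Hx.
  replace (6 * U x t) with (3 * U x t / x * (t + x) - 3 * U x t / x * (t - x)) by (field; lra).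
  apply (increment_abs_dominated (V x) (fun s => 3 * U x t / x * s) (P x)
    (fun _ => 3 * U x t / x)); [lra| | |].
  - intros s _. destruct H as [Hh _]. destruct (Hh x s Hx) as [_ HV].
    eapply differentiable_pt_lim_is_derive_r, HV.
  - intros s _. auto_derive; [auto|]. ring.
  - intros s Hs. pose proof (contractive_harnack D U V P Q H HD x t s Hx
      ltac:(apply Rabs_le; lra)) as Hk.
    destruct H as [Hh Hc]. destruct (Hc x s Hx) as [Hp [HP _]].
    eapply Rle_trans; [exact HP|]. apply Rmult_le_compat_r; [left; apply Rinv_0_lt_compat, Hx|].
    nra.
Qed.

Lemma exp_ln_ratio_ge1 (D x u : R) : 0 <= D -> 0 < u -> u <= x -> 1 <= exp (D * (ln x - ln u)).
Proof.
  intros HD Hu Hux. assert (ln u <= ln x) by (apply ln_le; auto).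
  assert (0 <= D * (ln x - ln u)) by (apply Rmult_le_pos; lra).
  pose proof (exp_ineq1_le (D * (ln x - ln u))). lra.
Qed.

(* The exponent [D < 1] makes the bound on [V] integrable down to the boundary [x = 0], so the
   mass of an interval is controlled by the value of [U] above it at height its half-length. *)
Lemma contractive_increment D U V P Q Y : contractive_pair D U V P Q -> 0 <= D < 1 ->
  (forall x t, 0 < x -> is_derive (Y x) t (U x t) /\ is_derive (fun u => Y u t) x (- V x t)) ->
  forall y x t, 0 < y -> y <= x ->
  Y y (t + x) - Y y (t - x) <= (6 + 12 / (1 - D)) * x * U x t.
Proof.
  intros H HD HY y x t Hy Hyx. assert (Hx : 0 < x) by lra.
  assert (HU : 0 < U x t) by (apply H; lra).
  (* At height [x] itself, the Harnack inequality over a length [2 * x] suffices. *)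
  assert (E1 : Y x (t + x) - Y x (t - x) <= 6 * x * U x t).
  { replace (6 * x * U x t) with (3 * U x t * (t + x) - 3 * U x t * (t - x)) by ring.
    apply (increment_dominated (Y x) (fun s => 3 * U x t * s) (U x) (fun _ => 3 * U x t));
      [lra| | |].
    - intros s _. apply HY. auto.
    - intros s _. auto_derive; [auto|]. ring.
    - intros s Hs. eapply contractive_harnack; eauto. apply Rabs_le; lra. }
  (* Passing from height [x] down to [y]. The constant 12 is 3 + 3, from comparing [V] at heights
     [u] and [x] above the two ends, plus 6 from the increment of [V] at height [x]; integrating
     [(x / u)^D] gives the factor [x / (1 - D)]. *)
  assert (E2 : Rabs ((Y x (t + x) - Y x (t - x)) - (Y y (t + x) - Y y (t - x))) <=
    12 * U x t / (1 - D) * (x * exp (D * (ln x - ln x))) -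
    12 * U x t / (1 - D) * (y * exp (D * (ln x - ln y)))).
  { apply (increment_abs_dominated (fun u => Y u (t + x) - Y u (t - x))
      (fun u => 12 * U x t / (1 - D) * (u * exp (D * (ln x - ln u))))
      (fun u => - V u (t + x) - - V u (t - x))
      (fun u => 12 * U x t / (1 - D) * ((1 - D) * exp (D * (ln x - ln u))))); auto.
    - intros u Hu. refine (is_derive_minus (fun u => Y u (t + x)) (fun u => Y u (t - x))
        u _ _ _ _); apply HY; lra.
    - intros u Hu. refine (is_derive_scal _ _ _ _ _). apply is_derive_mult_exp_ln_ratio. lra.
    - intros u Hu.
      pose proof (contractive_V_vertical D U V P Q H ltac:(lra) u x (t + x) ltac:(lra) ltac:(lra)) as A1.
      pose proof (contractive_V_vertical D U V P Q H ltac:(lra) u x (t - x) ltac:(lra) ltac:(lra)) as A2.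
      pose proof (contractive_V_horizontal D U V P Q H HD x t Hx) as A3.
      pose proof (contractive_harnack D U V P Q H HD x t (t + x) Hx ltac:(apply Rabs_le; lra)).
      pose proof (contractive_harnack D U V P Q H HD x t (t - x) Hx ltac:(apply Rabs_le; lra)).
      pose proof (exp_ln_ratio_ge1 D x u ltac:(lra) ltac:(lra) ltac:(lra)).
      set (e := exp (D * (ln x - ln u))) in *.
      replace (12 * U x t / (1 - D) * ((1 - D) * e)) with (12 * U x t * e) by (field; lra).
      apply Rabs_le_between in A1. apply Rabs_le_between in A2. apply Rabs_le_between in A3.
      assert (U x (t + x) * e <= 3 * U x t * e) by (apply Rmult_le_compat_r; lra).
      assert (U x (t - x) * e <= 3 * U x t * e) by (apply Rmult_le_compat_r; lra).
      assert (6 * U x t <= 6 * U x t * e) by nra.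
      apply Rabs_le. lra. }
  replace (D * (ln x - ln x)) with 0 in E2 by ring. rewrite exp_0 in E2.
  assert (0 <= 12 * U x t / (1 - D) * (y * exp (D * (ln x - ln y)))).
  { apply Rmult_le_pos; [|left; apply Rmult_lt_0_compat; [lra|apply exp_pos]].
    apply Rle_div_r; lra. }
  apply Rabs_le_between in E2.
  replace ((6 + 12 / (1 - D)) * x * U x t) with
    (6 * x * U x t + 12 * U x t / (1 - D) * (x * 1)) by (field; lra).
  lra.
Qed.

Lemma mult_exp_ln_Rpower (D x : R) : 0 < x ->
  x * exp (D * (ln 1 - ln x)) = Rpower x (1 - D).
Proof.
  intros Hx. rewrite <- (exp_ln x Hx) at 1. rewrite <- exp_plus. unfold Rpower.
  f_equal. rewrite ln_1. ring.
Qed.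

Lemma power_growth_increment (g dg : R -> R) (D A : R) : 0 <= D < 1 ->
  (forall u, 0 < u -> is_derive g u (dg u)) ->
  (forall u, 0 < u <= 1 -> Rabs (dg u) <= A * exp (D * (ln 1 - ln u))) ->
  forall y x, 0 < y -> y <= x -> x <= 1 ->
  Rabs (g x - g y) <= A / (1 - D) * (Rpower x (1 - D) - Rpower y (1 - D)).
Proof.
  intros HD Hg Hb y x Hy Hyx Hx. rewrite <- !mult_exp_ln_Rpower by lra.
  rewrite Rmult_minus_distr_l.
  apply (increment_abs_dominated g (fun u => A / (1 - D) * (u * exp (D * (ln 1 - ln u)))) dg
    (fun u => A / (1 - D) * ((1 - D) * exp (D * (ln 1 - ln u))))); auto.
  - intros u Hu. apply Hg. lra.
  - intros u Hu. refine (is_derive_scal _ _ _ _ _). apply is_derive_mult_exp_ln_ratio. lra.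
  - intros u Hu. replace (A / (1 - D) * ((1 - D) * exp (D * (ln 1 - ln u)))) with
      (A * exp (D * (ln 1 - ln u))) by (field; lra). apply Hb. lra.
Qed.

Lemma contractive_V_growth D U V P Q : contractive_pair D U V P Q -> 0 <= D ->
  forall u t, 0 < u <= 1 ->
  Rabs (V u t) <= (Rabs (V 1 t) + U 1 t) * exp (D * (ln 1 - ln u)).
Proof.
  intros H HD u t Hu.
  pose proof (contractive_V_vertical D U V P Q H HD u 1 t ltac:(lra) ltac:(lra)) as E.
  pose proof (exp_ln_ratio_ge1 D 1 u HD ltac:(lra) ltac:(lra)).
  set (e := exp (D * (ln 1 - ln u))) in *.
  assert (Rabs (V 1 t) <= Rabs (V 1 t) * e) by (pose proof (Rabs_pos (V 1 t)); nra).
  pose proof (Rabs_triang_inv (V u t) (V 1 t)) as T. rewrite Rabs_minus_sym in T. lra.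
Qed.

Lemma is_derive_RInt_of_potential U V P Q Y : holomorphic_pair U V P Q ->
  (forall x t, 0 < x -> is_derive (Y x) t (U x t) /\ is_derive (fun u => Y u t) x (- V x t)) ->
  forall x s1 s2, 0 < x ->
  is_derive (fun u => RInt (Y u) s1 s2) x (RInt (fun t => - V x t) s1 s2).
Proof.
  intros Hh HY x s1 s2 Hx.
  assert (HD : forall u v, 0 < u -> Derive (fun z => Y z v) u = - V u v).
  { intros u v Hu. apply is_derive_unique, HY, Hu. }
  assert (Hnear : locally x (fun u : R => 0 < u)).
  { exists (mkposreal x Hx). intros s Hs. unfold ball in Hs; simpl in Hs.
    unfold AbsRing_ball, abs, minus, plus, opp in Hs; simpl in Hs.
    apply Rabs_lt_between in Hs. lra. }
  rewrite (RInt_ext _ (fun t => Derive (fun u => Y u t) x)); [|intros t _; symmetry; auto].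
  apply (is_derive_RInt_param Y s1 s2 x).
  - revert Hnear. apply filter_imp. intros u Hu t _. exists (- V u t). exact (proj2 (HY u t Hu)).
  - intros t _. apply continuity_2d_pt_ext_loc with (f := fun u v => - V u v).
    + exists (mkposreal x Hx). simpl. intros u v Hu _. apply Rabs_lt_between in Hu.
      symmetry. apply HD. lra.
    + apply (continuity_2d_pt_opp V). apply differentiable_continuity_pt.
      destruct (Hh x t Hx) as [_ HV]. eexists. eexists. exact HV.
  - revert Hnear. apply filter_imp. intros u Hu.
    apply (ex_RInt_continuous (Y u)). intros t _. apply (ex_derive_continuous (Y u)).
    exists (U u t). exact (proj1 (HY u t Hu)).
Qed.

Lemma RInt_of_derive (g dg : R -> R) (a b : R) :
  (forall t, is_derive g t (dg t)) -> (forall t, continuous dg t) ->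
  RInt dg a b = g b - g a.
Proof.
  intros Hg Hc. apply is_RInt_unique. apply (is_RInt_derive g dg); auto.
Qed.

Lemma RInt_monotone_bounds (g : R -> R) (a b : R) : a <= b -> ex_RInt g a b ->
  (forall t, a <= t <= b -> g a <= g t <= g b) ->
  g a * (b - a) <= RInt g a b <= g b * (b - a).
Proof.
  intros Hab Hg Hm.
  assert (Hc : forall c, RInt (fun _ => c) a b = c * (b - a)).
  { intros c. rewrite RInt_const. unfold scal; simpl; unfold mult; simpl. ring. }
  rewrite <- !Hc. split; apply RInt_le; auto; try apply ex_RInt_const; intros t Ht;
    apply Hm; lra.
Qed.

(* Averaging the potential over an interval on which its boundary values are constant improves
   the modulus [x^(1-D)] to [x]: the derivative of the average is an increment of the conjugate
   potential, which is bounded. *)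
Lemma potential_average_linear D U V P Q Y M k s1 s2 :
  contractive_pair D U V P Q -> 0 <= D < 1 ->
  (forall x t, 0 < x -> is_derive (Y x) t (U x t) /\ is_derive (fun u => Y u t) x (- V x t)) ->
  (forall t x, 0 < x <= 1 ->
     Rabs (Y x t - M t) <= (Rabs (V 1 t) + U 1 t) / (1 - D) * Rpower x (1 - D)) ->
  s1 <= s2 -> M s1 = k -> M s2 = k ->
  exists A, 0 <= A /\ forall x, 0 < x <= 1 ->
    Rabs (RInt (Y x) s1 s2 - k * (s2 - s1)) <= A * x.
Proof.
  intros H HD HY HM Hs Hk1 Hk2. destruct H as [Hh Hc].
  destruct (closed_form_potential V U (holomorphic_pair_closed_re U V P Q Hh)) as [X HX].
  (* [X] is the conjugate potential, with derivatives [V] in [t] and [U] in [x]. As [U] is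
     [O(x^(-D))], it stays bounded down to the boundary, by [B s] above [s]. *)
  set (B := fun s => Rabs (X 1 s) + U 1 s / (1 - D)).
  assert (HB : forall s x, 0 < x <= 1 -> Rabs (X x s) <= B s).
  { intros s x Hx.
    pose proof (power_growth_increment (fun u => X u s) (fun u => U u s) D (U 1 s) HD) as E.
    assert (E' : Rabs (X 1 s - X x s) <= U 1 s / (1 - D) * (Rpower 1 (1 - D) - Rpower x (1 - D))).
    { apply E; try lra.
      - intros u Hu. apply HX, Hu.
      - intros u Hu. destruct (Hc u s ltac:(lra)) as [Hp _]. rewrite Rabs_right by lra.
        apply (contractive_growth D U V P Q (conj Hh Hc)); lra. }
    assert (Hr1 : Rpower 1 (1 - D) = 1).
    { unfold Rpower. rewrite ln_1, Rmult_0_r. apply exp_0. }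
    rewrite Hr1 in E'.
    assert (0 < Rpower x (1 - D)) by apply exp_pos.
    assert (0 <= U 1 s / (1 - D)).
    { apply Rle_div_r; [lra|]. destruct (Hc 1 s ltac:(lra)). lra. }
    assert (U 1 s / (1 - D) * (1 - Rpower x (1 - D)) <= U 1 s / (1 - D)) by nra.
    unfold B. pose proof (Rabs_triang_inv (X x s) (X 1 s)) as T.
    rewrite Rabs_minus_sym in T. lra. }
  assert (HVc : forall x t, 0 < x -> continuous (V x) t).
  { intros x t Hx. eapply closed_form_continuous_r; [|exact Hx].
    apply (holomorphic_pair_closed_re U V P Q Hh). }
  assert (HYi : forall x, 0 < x -> ex_RInt (Y x) s1 s2).
  { intros x Hx. apply (ex_RInt_continuous (Y x)). intros t _.
    apply (ex_derive_continuous (Y x)). exists (U x t). exact (proj1 (HY x t Hx)). }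
  assert (HA0 : 0 <= B s1 + B s2).
  { pose proof (HB s1 1 ltac:(lra)). pose proof (HB s2 1 ltac:(lra)).
    pose proof (Rabs_pos (X 1 s1)). pose proof (Rabs_pos (X 1 s2)). lra. }
  exists (B s1 + B s2). split; [exact HA0|].
  assert (Hlip : forall y x, 0 < y -> y <= x -> x <= 1 ->
    Rabs (RInt (Y x) s1 s2 - RInt (Y y) s1 s2) <= (B s1 + B s2) * x - (B s1 + B s2) * y).
  { intros y x Hy Hyx Hx1.
    apply (increment_abs_dominated (fun u => RInt (Y u) s1 s2) (fun u => (B s1 + B s2) * u)
      (fun u => RInt (fun t => - V u t) s1 s2) (fun _ => B s1 + B s2)); auto.
    - intros u Hu. apply (is_derive_RInt_of_potential U V P Q Y Hh HY). lra.
    - intros u Hu. auto_derive; [auto|]. ring.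
    - intros u Hu.
      rewrite (RInt_of_derive (fun t => - X u t) (fun t => - V u t)).
      + pose proof (HB s1 u ltac:(lra)) as B1. pose proof (HB s2 u ltac:(lra)) as B2.
        apply Rabs_le_between in B1. apply Rabs_le_between in B2. apply Rabs_le. lra.
      + intros t. refine (is_derive_opp _ _ _ _). apply HX. lra.
      + intros t. refine (continuous_opp _ _ _). apply HVc. lra. }
  assert (Hmono : forall x t t', 0 < x -> t <= t' -> Y x t <= Y x t').
  { intros x t t' Hx Htt.
    assert (0 * t' - 0 * t <= Y x t' - Y x t); [|lra].
    apply (increment_dominated (fun s => 0 * s) (Y x) (fun _ => 0) (U x)); auto.
    - intros s _. auto_derive; [auto|ring].
    - intros s _. apply HY, Hx.
    - intros s _. left. apply Hc, Hx. }
  intros x Hx.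
  set (G := fun t => (Rabs (V 1 t) + U 1 t) / (1 - D)).
  assert (HG : forall t, 0 <= G t).
  { intros t. unfold G. apply Rle_div_r; [lra|]. destruct (Hc 1 t ltac:(lra)) as [Hp _].
    pose proof (Rabs_pos (V 1 t)). lra. }
  (* As [y] tends to 0, [Y y] is nondecreasing between end values that are both within [O(y^(1-D))]
     of [k], so its integral tends to [k * (s2 - s1)] and the Lipschitz bound can be anchored at
     height 0. *)
  apply (le_of_le_plus_Rpower _ _ ((G s1 + G s2) * (s2 - s1)) (1 - D)); [|lra|].
  { pose proof (HG s1). pose proof (HG s2). apply Rmult_le_pos; lra. }
  exists x. split; [lra|]. intros y Hy.
  pose proof (Hlip y x ltac:(lra) ltac:(lra) ltac:(lra)) as L.
  pose proof (RInt_monotone_bounds (Y y) s1 s2 Hs (HYi y ltac:(lra))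
    ltac:(intros t Ht; split; apply Hmono; lra)) as Bd.
  pose proof (HM s1 y ltac:(lra)) as M1. pose proof (HM s2 y ltac:(lra)) as M2.
  fold (G s1) in M1. fold (G s2) in M2. rewrite Hk1 in M1. rewrite Hk2 in M2.
  apply Rabs_le_between in L. apply Rabs_le_between in M1. apply Rabs_le_between in M2.
  assert (0 < Rpower y (1 - D)) by apply exp_pos.
  set (r := Rpower y (1 - D)) in *.
  assert (0 <= (B s1 + B s2) * y) by (apply Rmult_le_pos; lra).
  assert (K1 : (k - G s1 * r) * (s2 - s1) <= Y y s1 * (s2 - s1))
    by (apply Rmult_le_compat_r; lra).
  assert (K2 : Y y s2 * (s2 - s1) <= (k + G s2 * r) * (s2 - s1))
    by (apply Rmult_le_compat_r; lra).
  assert (0 <= G s1 * r * (s2 - s1))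
    by (pose proof (HG s1); apply Rmult_le_pos; [apply Rmult_le_pos|]; lra).
  assert (0 <= G s2 * r * (s2 - s1))
    by (pose proof (HG s2); apply Rmult_le_pos; [apply Rmult_le_pos|]; lra).
  apply Rabs_le. lra.
Qed.

(** [M t] is the limit of [Y x t] as [x] tends to 0; it exists because the derivative [- V] of [Y]
    in [x] is [O(x^(-D))]. The first two clauses are limits of the corresponding facts about [Y];
    only strict monotonicity needs a new argument. *)
Lemma contractive_boundary_mass D U V P Q : contractive_pair D U V P Q -> 0 <= D < 1 ->
  exists M : R -> R, (forall x y, x <= y -> M x <= M y) /\
    (forall t x, 0 < x -> M (t + x) - M (t - x) <= (6 + 12 / (1 - D)) * x * U x t) /\
    (forall a b, a < b -> M a < M b).
Proof.
  intros H HD. pose proof H as [Hh Hc].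
  destruct (closed_form_potential _ _ (holomorphic_pair_closed_im U V P Q Hh)) as [Y HY].
  set (G := fun t => (Rabs (V 1 t) + U 1 t) / (1 - D)).
  assert (HG : forall t, 0 <= G t).
  { intros t. unfold G. apply Rle_div_r; [lra|]. destruct (Hc 1 t ltac:(lra)) as [Hp _].
    pose proof (Rabs_pos (V 1 t)). lra. }
  assert (Hlim : forall t, exists l, forall x, 0 < x <= 1 ->
    Rabs (Y x t - l) <= G t * Rpower x (1 - D)).
  { intros t. apply (limit_of_Rpower_modulus (fun x => Y x t)); [apply HG|lra|].
    intros y x Hy Hyx Hx. unfold G.
    apply (power_growth_increment (fun u => Y u t) (fun u => - V u t) D _ HD); auto.
    - intros u Hu. apply HY, Hu.
    - intros u Hu. rewrite Rabs_Ropp. eapply contractive_V_growth; eauto. lra. }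
  set (M := fun t => proj1_sig (constructive_indefinite_description _ (Hlim t))).
  assert (HM : forall t x, 0 < x <= 1 -> Rabs (Y x t - M t) <= G t * Rpower x (1 - D)).
  { intros t. apply (proj2_sig (constructive_indefinite_description _ (Hlim t))). }
  clearbody M. clear Hlim.
  assert (HYmono : forall x t t', 0 < x -> t <= t' -> Y x t <= Y x t').
  { intros x t t' Hx Htt.
    assert (0 * t' - 0 * t <= Y x t' - Y x t); [|lra].
    apply (increment_dominated (fun s => 0 * s) (Y x) (fun _ => 0) (U x)); auto.
    - intros s _. auto_derive; [auto|ring].
    - intros s _. apply HY, Hx.
    - intros s _. left. apply Hc, Hx. }
  assert (HMmono : forall x y, x <= y -> M x <= M y).
  { intros s s' Hss.
    apply (le_of_le_plus_Rpower _ _ (G s + G s') (1 - D)).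
    - pose proof (HG s). pose proof (HG s'). lra.
    - lra.
    - exists 1. split; [lra|]. intros y Hy.
      pose proof (HM s y Hy) as E1. pose proof (HM s' y Hy) as E2.
      apply Rabs_le_between in E1. apply Rabs_le_between in E2.
      pose proof (HYmono y s s' ltac:(lra) Hss). lra. }
  exists M. split; [exact HMmono|]. split.
  - intros t x Hx. apply (le_of_le_plus_Rpower _ _ (G (t + x) + G (t - x)) (1 - D)).
    + pose proof (HG (t + x)). pose proof (HG (t - x)). lra.
    + lra.
    + exists (Rmin 1 x). split; [apply Rmin_glb_lt; lra|]. intros y Hy.
      pose proof (Rmin_l 1 x). pose proof (Rmin_r 1 x).
      pose proof (HM (t + x) y ltac:(lra)) as E1. pose proof (HM (t - x) y ltac:(lra)) as E2.
      apply Rabs_le_between in E1. apply Rabs_le_between in E2.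
      pose proof (contractive_increment D U V P Q Y H HD HY y x t ltac:(lra) ltac:(lra)). lra.
  (* If [M] were constant on [[a, b]], the averages of [Y x] over the outer thirds would both be
     within [O(x)] of that constant, while [Y x] gains at least a multiple of [x^D] across the
     middle third. This is impossible for small [x], since [D < 1]. *)
  - intros a b Hab. apply Rnot_le_lt. intros Hba.
    assert (HMk : forall s, a <= s <= b -> M s = M a).
    { intros s Hs. pose proof (HMmono a s ltac:(lra)). pose proof (HMmono s b ltac:(lra)). lra. }
    set (h := (b - a) / 3). assert (Hh0 : 0 < h) by (unfold h; lra).
    set (t1 := a + h). set (t2 := a + 2 * h).
    assert (Ht3 : b = t2 + h) by (unfold t2, h; field).
    assert (Hord : t1 = a + h /\ t2 = t1 + h) by (unfold t1, t2; split; ring).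
    clearbody t1 t2 h. destruct Hord as [Ht1 Ht2].
    destruct (potential_average_linear D U V P Q Y M (M a) a t1 H HD HY HM ltac:(lra)
      eq_refl (HMk t1 ltac:(lra))) as [A1 [HA1 E1]].
    destruct (potential_average_linear D U V P Q Y M (M a) t2 b H HD HY HM ltac:(lra)
      (HMk t2 ltac:(lra)) (HMk b ltac:(lra))) as [A2 [HA2 E2]].
    (* A lower bound for [U 1] on the middle third, which becomes [c x^D] at height [x]. *)
    set (c := U 1 t1 * exp (- (D * h))).
    assert (Hc0 : 0 < c).
    { unfold c. apply Rmult_lt_0_compat; [apply Hc; lra|apply exp_pos]. }
    destruct (Rpower_small (A1 + A2) (1 - D) (h * (h * c)) ltac:(lra) ltac:(lra)) as [x [Hx Hsm]].
    { apply Rmult_lt_0_compat; [lra|]. apply Rmult_lt_0_compat; lra. }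
    specialize (Hsm x ltac:(lra)). specialize (E1 x Hx). specialize (E2 x Hx).
    assert (HYi : forall s s', ex_RInt (Y x) s s').
    { intros s s'. apply (ex_RInt_continuous (Y x)). intros t _.
      apply (ex_derive_continuous (Y x)). exists (U x t). apply (HY x t). lra. }
    pose proof (RInt_monotone_bounds (Y x) a t1 ltac:(lra) (HYi _ _)
      ltac:(intros t Ht; split; apply HYmono; lra)) as B1.
    pose proof (RInt_monotone_bounds (Y x) t2 b ltac:(lra) (HYi _ _)
      ltac:(intros t Ht; split; apply HYmono; lra)) as B2.
    assert (HUlow : forall t, t1 <= t <= t2 -> c * Rpower x D <= U x t).
    { intros t Ht.
      pose proof (contractive_decay D U V P Q H x 1 t ltac:(lra) ltac:(lra)) as G1.
      pose proof (contractive_horizontal D U V P Q H 1 t t1 ltac:(lra)) as G2.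
      rewrite ln_1 in G1. unfold c, Rpower.
      assert (He : exp (D / 1 * Rabs (t1 - t)) <= exp (D * h)).
      { assert (Hle : D / 1 * Rabs (t1 - t) <= D * h).
        { replace (D / 1) with D by field. apply Rmult_le_compat_l; [lra|].
          apply Rabs_le. lra. }
        destruct (Rle_lt_or_eq_dec _ _ Hle) as [E|E];
          [left; now apply exp_increasing|rewrite E; lra]. }
      assert (G3 : U 1 t1 * exp (- (D * h)) <= U 1 t).
      { assert (U 1 t1 <= U 1 t * exp (D * h)).
        { eapply Rle_trans; [exact G2|]. apply Rmult_le_compat_l; [|exact He].
          left. apply Hc. lra. }
        rewrite exp_Ropp. apply Rle_div_l; [apply exp_pos|]. auto. }
      apply Rle_trans with (U 1 t * exp (D * ln x)).
      - apply Rmult_le_compat_r; [left; apply exp_pos|exact G3].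
      - replace (U x t) with (U x t * exp (D * (0 - ln x)) * exp (D * ln x)).
        + apply Rmult_le_compat_r; [left; apply exp_pos|exact G1].
        + rewrite Rmult_assoc, <- exp_plus.
          replace (D * (0 - ln x) + D * ln x) with 0 by ring. rewrite exp_0. ring. }
    assert (Hinc : c * Rpower x D * t2 - c * Rpower x D * t1 <= Y x t2 - Y x t1).
    { apply (increment_dominated (fun s => c * Rpower x D * s) (Y x)
        (fun _ => c * Rpower x D) (U x)); [lra| | |auto].
      - intros s _. auto_derive; [auto|ring].
      - intros s _. apply HY. lra. }
    assert (Hrp : Rpower x (1 - D) * Rpower x D = x).
    { rewrite <- Rpower_plus. replace (1 - D + D) with 1 by ring. apply Rpower_1. lra. }
    assert (0 < Rpower x D) by apply exp_pos.
    set (r := Rpower x D) in *. set (r' := Rpower x (1 - D)) in *.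
    apply Rabs_le_between in E1. apply Rabs_le_between in E2.
    replace (t1 - a) with h in * by lra. replace (b - t2) with h in * by lra.
    assert (K1 : h * (Y x t2 - Y x t1) <= (A1 + A2) * x) by lra.
    assert (K2 : h * (h * c) * r <= h * (Y x t2 - Y x t1)).
    { replace (h * (h * c) * r) with (h * (c * r * h)) by ring.
      apply Rmult_le_compat_l; [lra|]. replace (c * r * h) with (c * r * (t2 - t1)).
      - lra.
      - f_equal. lra. }
    assert (K3 : (A1 + A2) * r' * r < h * (h * c) * r) by (apply Rmult_lt_compat_r; lra).
    rewrite Rmult_assoc, Hrp in K3. lra.
Qed.

(** * Mass of the set of non-convergence *)

(** A condition on the lower limit of [U x t] as [x] tends to 0: covering arguments need only one
    arbitrarily small scale at each point. *)
Definition recurs_below (U : R -> R -> R) (K t : R) : Prop :=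
  forall d, 0 < d -> exists x, 0 < x < d /\ U x t < K.

Definition mass_controlled (U : R -> R -> R) (M : R -> R) (C : R) : Prop :=
  forall t x, 0 < x -> M (t + x) - M (t - x) <= C * x * U x t.

(** At a scale [x < delta] with [U x t < K], the density of [M] on [(t - x, t + x)] is at most
    [C * K]; the margin [delta] on either side contains these intervals. *)
Lemma Small_of_recurs_below U M C K A p q delta : mass_controlled U M C ->
  0 <= C -> 0 <= K -> 0 < delta -> p <= q ->
  (forall t, A t -> p <= t <= q /\ recurs_below U K t) ->
  Small M A (C * K * (q - p + 2 * delta)).
Proof.
  intros HM HC HK Hd Hpq HA.
  replace (q - p + 2 * delta) with ((q + delta) - (p - delta)) by ring.
  assert (HCK : 0 <= C * K) by (apply Rmult_le_pos; auto).
  apply Small_of_density; [lra|auto|].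
  intros t Ht. destruct (HA t Ht) as [Htpq Hrec]. destruct (Hrec delta Hd) as [x [Hx HU]].
  exists (t - x), (t + x). split; [lra|]. split; [lra|]. split; [lra|].
  eapply Rle_trans; [apply HM; lra|].
  replace (C * K * (t + x - (t - x))) with (2 * (C * x * K)) by ring.
  assert (C * x * U x t <= C * x * K).
  { apply Rmult_le_compat_l; [apply Rmult_le_pos; lra|lra]. }
  assert (0 <= C * x * K) by (apply Rmult_le_pos; [apply Rmult_le_pos|]; lra). lra.
Qed.

(** Absolute continuity where the density is finite along some scales: the n-th interval of a thin
    cover of [N] is enlarged by [dl n], with a small total. The shift [c] makes translates of [N]
    usable, [N] being known on one period only. *)
Lemma Null_of_null_set U M C K N c A : mass_controlled U M C -> 0 <= C -> 0 <= K ->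
  null_set N -> (forall t, A t -> N (t + c) /\ recurs_below U K t) -> Null M A.
Proof.
  intros HM HC HK HN HA e He.
  assert (HCK : 0 <= C * K) by (apply Rmult_le_pos; auto).
  set (e' := e / (3 * (C * K) + 1)).
  assert (He' : 0 < e') by (apply Rdiv_lt_0_compat; lra).
  destruct (HN e' He') as [a [b [L [Hab [Hcov [HL HLe]]]]]].
  set (dl := fun n => e' * (/ 2) ^ S n).
  assert (Hdl : forall n, 0 < dl n).
  { intros n. apply Rmult_lt_0_compat; [auto|apply pow_lt; lra]. }
  apply Small_mono with (B := fun t => exists n, A t /\ a n <= t + c <= b n)
    (e := C * K * (L + 2 * e')).
  - intros t Ht. destruct (HA t Ht) as [HNt _]. destruct (Hcov _ HNt) as [n Hn].
    exists n. auto.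
  - apply Rle_trans with (C * K * (3 * e')); [apply Rmult_le_compat_l; lra|].
    unfold e'. replace (C * K * (3 * (e / (3 * (C * K) + 1)))) with
      (e * (3 * (C * K) / (3 * (C * K) + 1))) by (field; lra).
    rewrite <- (Rmult_1_r e) at 2. apply Rmult_le_compat_l; [lra|].
    apply Rle_div_l; lra.
  - apply Small_countable_union with (e := fun n => C * K * (b n - a n + 2 * dl n)).
    + intros n. replace (b n - a n) with ((b n - c) - (a n - c)) by ring.
      apply (Small_of_recurs_below U); auto.
      * specialize (Hab n). lra.
      * intros t [Ht Hn]. split; [lra|]. apply HA, Ht.
    + assert (H2 : is_series (fun n => 2 * dl n) (2 * e'))
        by exact (is_series_scal 2 dl e' (is_series_half_pow e')).
      exact (is_series_scal (C * K) _ _ (is_series_plus _ _ _ _ HL H2)).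
Qed.

(** Comparison with the fixed height 10 gives [U x t = O(x^(-D))] uniformly, hence mass [O(x^(1-D))]
    for an interval of length comparable to [x]. The term [e] pays for an arc reduced to a point,
    whose [powr] is 0 but which must still be covered by an open interval. *)
Lemma Small_arc D U V P Q M W : contractive_pair D U V P Q -> 0 <= D < 1 ->
  (forall x y, x <= y -> M x <= M y) -> mass_controlled U M (6 + 12 / (1 - D)) ->
  exists C, 0 <= C /\ forall p q e, Rabs p <= W -> p <= q <= p + 2 * PI -> 0 < e ->
    Small M (fun t => p <= t <= q) (C * powr (arc_len p q) (1 - D) + e).
Proof.
  intros H HD HMm HM.
  assert (HC : 0 <= 6 + 12 / (1 - D)).
  { assert (0 <= 12 / (1 - D)) by (apply Rle_div_r; lra). lra. }
  pose proof PI_RGT_0. pose proof PI_4.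
  (* Height 10 exceeds the longest arc, of length [2 * PI], and [W + 4] exceeds the distance from 0
     to its midpoint. The factor 8 used below dominates [(2 * PI)^(1-D)], which comes from
     normalized lengths. *)
  set (C1 := (6 + 12 / (1 - D)) * (U 10 0 * exp (W + 4) * exp (D * ln 10))).
  assert (HU10 : 0 < U 10 0) by (apply H; lra).
  assert (HC1 : 0 <= C1).
  { unfold C1. apply Rmult_le_pos; [auto|]. left.
    apply Rmult_lt_0_compat; [apply Rmult_lt_0_compat; [auto|]|]; apply exp_pos. }
  assert (Hmass : forall p q x, Rabs p <= W -> p <= q <= p + 2 * PI -> 0 < x <= 10 ->
    M ((p + q) / 2 + x) - M ((p + q) / 2 - x) <= C1 * Rpower x (1 - D)).
  { intros p q x Hp Hpq Hx. set (t := (p + q) / 2).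
    eapply Rle_trans; [apply HM; lra|].
    pose proof (contractive_growth D U V P Q H x 10 t ltac:(lra) ltac:(lra)) as G1.
    pose proof (contractive_horizontal D U V P Q H 10 0 t ltac:(lra)) as G2.
    assert (He : exp (D / 10 * Rabs (t - 0)) <= exp (W + 4)).
    { assert (Hle : D / 10 * Rabs (t - 0) < W + 4).
      { apply Rabs_le_between in Hp. rewrite Rminus_0_r.
        assert (Rabs t <= W + PI) by (apply Rabs_le; unfold t; lra).
        pose proof (Rabs_pos t). nra. }
      left. now apply exp_increasing. }
    assert (Hxp : x * exp (D * (ln 10 - ln x)) = exp (D * ln 10) * Rpower x (1 - D)).
    { rewrite <- mult_exp_ln_Rpower by lra. rewrite ln_1.
      replace (D * (ln 10 - ln x)) with (D * ln 10 + D * (0 - ln x)) by ring.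
      rewrite exp_plus. ring. }
    unfold C1.
    replace ((6 + 12 / (1 - D)) * (U 10 0 * exp (W + 4) * exp (D * ln 10)) * Rpower x (1 - D))
      with ((6 + 12 / (1 - D)) * (U 10 0 * exp (W + 4) * (x * exp (D * (ln 10 - ln x)))))
      by (rewrite Hxp; ring).
    rewrite Rmult_assoc. apply Rmult_le_compat_l; [auto|].
    replace (U 10 0 * exp (W + 4) * (x * exp (D * (ln 10 - ln x)))) with
      (x * (U 10 0 * exp (W + 4) * exp (D * (ln 10 - ln x)))) by ring.
    apply Rmult_le_compat_l; [lra|]. eapply Rle_trans; [exact G1|].
    apply Rmult_le_compat_r; [left; apply exp_pos|]. eapply Rle_trans; [exact G2|].
    apply Rmult_le_compat_l; [lra|exact He]. }
  exists (C1 * 8). split; [lra|]. intros p q e Hp Hpq He.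
  destruct (Req_dec p q) as [E|E].
  - subst q. destruct (Rpower_small C1 (1 - D) e HC1 ltac:(lra) He) as [x [Hx Hsm]].
    specialize (Hsm x ltac:(lra)). specialize (Hmass p p x Hp Hpq ltac:(lra)).
    replace ((p + p) / 2) with p in Hmass by field.
    apply Small_mono with (B := fun t => p - x < t < p + x) (e := M (p + x) - M (p - x)).
    + intros t Ht. lra.
    + assert (Hpow : powr (arc_len p p) (1 - D) = 0).
      { unfold powr, arc_len. destruct (Req_EM_T ((p - p) / (2 * PI)) 0) as [Z|Z]; [auto|].
        exfalso. apply Z. unfold Rminus. rewrite Rplus_opp_r. unfold Rdiv. ring. }
      rewrite Hpow. lra.
    + apply Small_of_interval; [auto|lra].
  - set (l := arc_len p q).
    assert (Hl : 0 < l) by (unfold l, arc_len; apply Rdiv_lt_0_compat; lra).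
    assert (Hql : q - p = 2 * PI * l) by (unfold l, arc_len; field; lra).
    specialize (Hmass p q (q - p) Hp Hpq ltac:(lra)).
    apply Small_mono with (B := fun t => (p + q) / 2 - (q - p) < t < (p + q) / 2 + (q - p))
      (e := M ((p + q) / 2 + (q - p)) - M ((p + q) / 2 - (q - p))).
    + intros t Ht. lra.
    + assert (Hpow : powr l (1 - D) = Rpower l (1 - D)).
      { unfold powr. destruct (Req_EM_T l 0); [lra|auto]. }
      rewrite Hpow. eapply Rle_trans; [exact Hmass|].
      rewrite Hql, <- Rpower_mult_distr by lra.
      assert (Rpower (2 * PI) (1 - D) <= 8).
      { apply Rle_trans with (Rpower (2 * PI) 1).
        - apply Rle_Rpower; [pose proof PI2_1; lra|lra].
        - rewrite Rpower_1 by lra. lra. }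
      assert (0 < Rpower l (1 - D)) by apply exp_pos.
      set (r := Rpower l (1 - D)) in *. set (r' := Rpower (2 * PI) (1 - D)) in *.
      assert (C1 * (r' * r) <= C1 * (8 * r)) by (apply Rmult_le_compat_l; nra). lra.
    + apply Small_of_interval; [auto|lra].
Qed.

(** The real-variable core of the theorem: [[a, b]] is the union of [F], of the points of zero lower
    density, and of the translates of [N] by nonnegative and by nonpositive periods. Each has
    arbitrarily small mass, against the strict monotonicity of [M]. *)
Lemma contractive_content_not_small D U V P Q (F N : R -> Prop) (a b W : R) :
  contractive_pair D U V P Q -> 0 <= D < 1 -> a < b -> null_set N ->
  (forall t, a <= t <= b -> ~ F t -> exists K, recurs_below U K t) ->
  (forall t, a <= t <= b -> ~ F t ->
     (forall K, 0 < K -> recurs_below U K t) \/ (exists k : Z, N (t + 2 * PI * IZR k))) ->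
  (forall e, 0 < e -> exists (p q : nat -> R) (L : R),
     (forall j, Rabs (p j) <= W /\ p j <= q j <= p j + 2 * PI) /\
     is_series (fun j => powr (arc_len (p j) (q j)) (1 - D)) L /\ L <= e /\
     forall t, a <= t <= b -> F t -> exists j (k : nat), (k < 3)%nat /\
       p j + 2 * PI * INR k <= t <= q j + 2 * PI * INR k) -> False.
Proof.
  intros H HD Hab HN Hfin Hgood Hcov.
  destruct (contractive_boundary_mass D U V P Q H HD) as [M [HMm [HM HMs]]].
  assert (HC : 0 <= 6 + 12 / (1 - D)).
  { assert (0 <= 12 / (1 - D)) by (apply Rle_div_r; lra). lra. }
  (* The 16 absorbs a translation by two periods, [4 * PI]. *)
  destruct (Small_arc D U V P Q M (W + 16) H HD HMm HM) as [C [HC0 Harc]].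
  set (c0 := 6 + 12 / (1 - D)) in *.
  assert (HF : forall e, 0 < e -> Small M (fun t => a <= t <= b /\ F t) e).
  { intros e He. set (e' := e / (3 * (C + 1))).
    assert (He' : 0 < e') by (apply Rdiv_lt_0_compat; lra).
    destruct (Hcov e' He') as [p [q [L [Hpq [HL [HLe Ht]]]]]].
    assert (Hk : forall k, (k < 3)%nat ->
      Small M (fun t => exists j, p j + 2 * PI * INR k <= t <= q j + 2 * PI * INR k)
        (C * L + e')).
    { intros k Hk. apply Small_countable_union with
        (e := fun j => C * powr (arc_len (p j) (q j)) (1 - D) + e' * (/ 2) ^ S j).
      - intros j. destruct (Hpq j) as [Hp1 Hp2].
        replace (arc_len (p j) (q j)) with
          (arc_len (p j + 2 * PI * INR k) (q j + 2 * PI * INR k))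
          by (unfold arc_len; f_equal; ring).
        apply Harc; [|lra|apply Rmult_lt_0_compat; [lra|apply pow_lt; lra]].
        pose proof PI_RGT_0. pose proof PI_4. pose proof (pos_INR k).
        assert (INR k <= 2) by (change 2 with (INR 2); apply le_INR; lia).
        apply Rabs_le_between in Hp1. apply Rabs_le. nra.
      - exact (is_series_plus _ _ _ _ (is_series_scal C _ _ HL) (is_series_half_pow e')). }
    eapply Small_mono; [| |exact (Small_or _ _ _ _ _ (Hk 0%nat ltac:(lia))
      (Small_or _ _ _ _ _ (Hk 1%nat ltac:(lia)) (Hk 2%nat ltac:(lia))))].
    - intros t [Hat HFt]. destruct (Ht t Hat HFt) as [j [k [Hk3 Hj]]].
      destruct k as [|[|[|k]]]; [left|right; left|right; right|lia]; now exists j.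
    - assert (C * L <= C * e') by (apply Rmult_le_compat_l; lra).
      replace e with (3 * (C * e' + e')); [lra|]. unfold e'. field. lra. }
  assert (HG : Null M (fun t => a <= t <= b /\ forall K, 0 < K -> recurs_below U K t)).
  { intros e He. set (K := e / (c0 * (b - a + 2) + 1)).
    assert (0 <= c0 * (b - a + 2)) by (apply Rmult_le_pos; lra).
    assert (HK : 0 < K) by (apply Rdiv_lt_0_compat; lra).
    apply Small_mono with (B := fun t => a <= t <= b /\ forall K, 0 < K -> recurs_below U K t)
      (e := c0 * K * (b - a + 2 * 1)); [auto| |].
    - unfold K. replace (c0 * (e / (c0 * (b - a + 2) + 1)) * (b - a + 2 * 1)) with
        (e * (c0 * (b - a + 2) / (c0 * (b - a + 2) + 1))) by (field; lra).
      rewrite <- (Rmult_1_r e) at 2. apply Rmult_le_compat_l; [lra|].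
      apply Rle_div_l; lra.
    - apply (Small_of_recurs_below U); auto; try lra. intros t [Ht Hr]. auto. }
  (* [s] is the sign of the translation. The bound [K], which depends on the point, is replaced by
     an integer [m] to make the union countable. *)
  assert (HB : forall s : R, Null M (fun t => exists n m : nat,
     N (t + s * (2 * PI * INR n)) /\ recurs_below U (INR m) t)).
  { intros s. apply Null_countable_union. intros n. apply Null_countable_union. intros m.
    apply (Null_of_null_set U M c0 (INR m) N (s * (2 * PI * INR n))); auto.
    apply pos_INR. }
  (* Four sets of mass at most [e], doubled by the bound for intervals, reach only half of
     [M b - M a]. *)
  set (e := (M b - M a) / 16).
  assert (He : 0 < e) by (unfold e; specialize (HMs a b Hab); lra).
  assert (Hall : Small M (fun t => a <= t <= b) (e + (e + (e + e)))).
  { eapply Small_mono; [| |exact (Small_or _ _ _ _ _ (HF e He) (Small_or _ _ _ _ _ (HG e He)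
      (Small_or _ _ _ _ _ (HB 1 e He) (HB (-1) e He))))]; [|lra].
    intros t Ht. destruct (classic (F t)) as [Hf|Hf]; [now left|right].
    destruct (Hgood t Ht Hf) as [Hg|[k Hk]]; [now left|right].
    destruct (Hfin t Ht Hf) as [K HK].
    assert (Hm : exists m : nat, recurs_below U (INR m) t).
    { destruct (INR_unbounded K) as [m Hm]. exists m. intros d Hd.
      destruct (HK d Hd) as [x [Hx HU]]. exists x. split; [auto|lra]. }
    destruct Hm as [m Hm].
    destruct (Z.le_ge_cases 0 k) as [Hk0|Hk0]; [left|right];
      exists (Z.abs_nat k), m; (split; [|exact Hm]);
      rewrite INR_IZR_INZ, Zabs2Nat.id_abs.
    - rewrite Z.abs_eq by lia. rewrite Rmult_1_l. exact Hk.
    - rewrite Z.abs_neq by lia. rewrite opp_IZR.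
      replace (-1 * (2 * PI * - IZR k)) with (2 * PI * IZR k) by ring. exact Hk. }
  apply Small_interval_increment in Hall; [|auto|lra].
  unfold e in Hall. specialize (HMs a b Hab). lra.
Qed.

(** * Bounded convergence off a null set *)

Definition continuous_everywhere (g : R -> R) : Prop := forall t, continuous g t.

Lemma continuous_everywhere_Rmax g h : continuous_everywhere g -> continuous_everywhere h ->
  continuous_everywhere (fun t => Rmax (g t) (h t)).
Proof.
  intros Hg Hh t.
  apply (continuous_ext (fun t => / 2 * ((g t + h t) + Rabs (g t - h t)))).
  - intros s. change (/ 2 * ((g s + h s) + Rabs (g s - h s)) = Rmax (g s) (h s)).
    unfold Rmax. destruct (Rle_dec (g s) (h s)).
    + rewrite Rabs_left1 by lra. field.
    + rewrite Rabs_right by lra. field.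
  - refine (continuous_scal_r (/ 2) _ _ _).
    refine (continuous_plus _ _ _ (continuous_plus _ _ _ (Hg t) (Hh t)) _).
    exact (continuous_Rabs_comp _ _ (continuous_minus g h t (Hg t) (Hh t))).
Qed.

Lemma continuous_everywhere_Rmin g h : continuous_everywhere g -> continuous_everywhere h ->
  continuous_everywhere (fun t => Rmin (g t) (h t)).
Proof.
  intros Hg Hh t.
  apply (continuous_ext (fun t => (g t + h t) - Rmax (g t) (h t))).
  - intros s. change ((g s + h s) - Rmax (g s) (h s) = Rmin (g s) (h s)).
    unfold Rmin, Rmax. destruct (Rle_dec (g s) (h s)); ring.
  - refine (continuous_minus _ _ _ (continuous_plus _ _ _ (Hg t) (Hh t)) _).
    apply (continuous_everywhere_Rmax g h Hg Hh).
Qed.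

Lemma continuous_everywhere_ex_RInt g a b : continuous_everywhere g -> ex_RInt g a b.
Proof. intros Hg. apply (ex_RInt_continuous g). intros z _. apply Hg. Qed.

Lemma continuous_everywhere_RInt_le g h a b : continuous_everywhere g ->
  continuous_everywhere h -> a <= b -> (forall t, g t <= h t) -> RInt g a b <= RInt h a b.
Proof.
  intros Hg Hh Hab Hle. apply RInt_le; auto using continuous_everywhere_ex_RInt.
Qed.

Lemma RInt_const_R (c a b : R) : RInt (fun _ => c) a b = c * (b - a).
Proof. rewrite RInt_const. unfold scal; simpl; unfold mult; simpl. ring. Qed.

Lemma RInt_Rmin_Rmax g h a b : continuous_everywhere g -> continuous_everywhere h ->
  RInt (fun t => Rmin (g t) (h t)) a b =
  RInt g a b + RInt h a b - RInt (fun t => Rmax (g t) (h t)) a b.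
Proof.
  intros Hg Hh.
  pose proof (continuous_everywhere_Rmax g h Hg Hh) as Hmax.
  pose proof (continuous_everywhere_Rmin g h Hg Hh) as Hmin.
  assert (E1 : RInt (fun t => g t + h t) a b = RInt g a b + RInt h a b)
    by (refine (RInt_plus g h a b _ _); auto using continuous_everywhere_ex_RInt).
  assert (E2 : RInt (fun t => Rmin (g t) (h t) + Rmax (g t) (h t)) a b =
     RInt (fun t => Rmin (g t) (h t)) a b + RInt (fun t => Rmax (g t) (h t)) a b)
    by (refine (RInt_plus (fun t => Rmin (g t) (h t)) (fun t => Rmax (g t) (h t)) a b _ _);
        auto using continuous_everywhere_ex_RInt).
  assert (E3 : RInt (fun t => Rmin (g t) (h t) + Rmax (g t) (h t)) a b =
    RInt (fun t => g t + h t) a b).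
  { apply RInt_ext. intros t _. change (Rmin (g t) (h t) + Rmax (g t) (h t) = g t + h t).
    unfold Rmin, Rmax. destruct (Rle_dec (g t) (h t)); ring. }
  lra.
Qed.

Fixpoint max_from (phi : nat -> R -> R) (n m : nat) (t : R) : R :=
  match m with O => phi n t | S m => Rmax (max_from phi n m t) (phi (n + S m)%nat t) end.

Lemma max_from_continuous phi n m : (forall n, continuous_everywhere (phi n)) ->
  continuous_everywhere (max_from phi n m).
Proof.
  intros H. induction m as [|m IH]; [apply H|]. simpl.
  apply continuous_everywhere_Rmax; auto.
Qed.

Lemma max_from_ge phi n m k t : (k <= m)%nat -> phi (n + k)%nat t <= max_from phi n m t.
Proof.
  induction m as [|m IH]; intros Hk; simpl.
  - replace k with 0%nat by lia. rewrite Nat.add_0_r. lra.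
  - destruct (Nat.eq_dec k (S m)) as [->|Hne]; [apply Rmax_r|].
    eapply Rle_trans; [apply IH; lia|apply Rmax_l].
Qed.

Lemma max_from_le phi n m t c : (forall k, (k <= m)%nat -> phi (n + k)%nat t <= c) ->
  max_from phi n m t <= c.
Proof.
  induction m as [|m IH]; intros Hk; simpl.
  - rewrite <- (Nat.add_0_r n). apply Hk. lia.
  - apply Rmax_lub; [apply IH; auto|apply Hk; lia].
Qed.

Lemma near_maximal_index (u : nat -> R) (B e : R) : 0 < e -> (forall m, u m <= B) ->
  exists m, forall k, u k <= u m + e.
Proof.
  intros He Hu. destruct (completeness (fun y => exists m, y = u m)) as [l [Hl1 Hl2]].
  - exists B. intros y [m ->]. auto.
  - exists (u O). now exists O.
  - apply NNPP. intros Hn.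
    assert (l <= l - e); [|lra]. apply Hl2. intros y [m ->].
    apply Rnot_lt_le. intros Hm. apply Hn. exists m. intros k.
    assert (u k <= l) by (apply Hl1; now exists k). lra.
Qed.

(* [psi n] is the minimum of near-optimal finite maxima [g k] of [phi k, phi (k+1), ...] over
   [k <= n]; since min + max is a sum, each step loses at most the defect of [g k] in the integral. *)
Lemma min_chain_exists (phi : nat -> R -> R) (a b K e : R) : a <= b -> 0 < e ->
  (forall n, continuous_everywhere (phi n)) -> (forall n t, 0 <= phi n t <= K) ->
  exists psi : nat -> R -> R, (forall n, continuous_everywhere (psi n)) /\
    (forall n t, 0 <= psi n t <= K) /\ (forall n t, psi (S n) t <= psi n t) /\
    (forall n, RInt (phi n) a b <= RInt (psi n) a b + e) /\
    (forall n t c, (forall m, (n <= m)%nat -> phi m t <= c) -> psi n t <= c).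
Proof.
  intros Hab He Hc Hb.
  assert (HG : forall n m, continuous_everywhere (max_from phi n m))
    by (intros; now apply max_from_continuous).
  assert (Hcst : forall c, continuous_everywhere (fun _ => c)) by (intros c t; apply continuous_const).
  assert (HGK : forall n m t, 0 <= max_from phi n m t <= K).
  { intros n m t. split.
    - eapply Rle_trans; [apply (Hb (n + 0)%nat t)|]. apply max_from_ge. lia.
    - apply max_from_le. intros k _. apply Hb. }
  assert (Hidx : forall n, exists m, forall k, RInt (max_from phi n k) a b <=
    RInt (max_from phi n m) a b + e * (/ 2) ^ S n).
  { intros n. apply (near_maximal_index (fun m => RInt (max_from phi n m) a b) (K * (b - a))).
    - apply Rmult_lt_0_compat; [auto|apply pow_lt; lra].
    - intros m. rewrite <- RInt_const_R. apply continuous_everywhere_RInt_le; auto.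
      intros t. apply HGK. }
  set (m := fun n => proj1_sig (constructive_indefinite_description _ (Hidx n))).
  assert (Hm : forall n k, RInt (max_from phi n k) a b <=
    RInt (max_from phi n (m n)) a b + e * (/ 2) ^ S n).
  { intros n. apply (proj2_sig (constructive_indefinite_description _ (Hidx n))). }
  clearbody m. clear Hidx.
  set (g := fun n => max_from phi n (m n)).
  set (psi := fix psi n := match n with O => g O | S n => fun t => Rmin (psi n t) (g (S n) t) end).
  assert (Hpc : forall n, continuous_everywhere (psi n)).
  { induction n as [|n IH]; [apply HG|]. apply continuous_everywhere_Rmin; auto. apply HG. }
  assert (Hpg : forall n t, psi n t <= g n t).
  { intros [|n] t; simpl; [lra|apply Rmin_r]. }
  assert (Hdef : forall n, RInt (g n) a b - RInt (psi n) a b <= e * (1 - (/ 2) ^ n)).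
  { induction n as [|n IH]; [simpl; lra|].
    change (psi (S n)) with (fun t => Rmin (psi n t) (g (S n) t)).
    rewrite RInt_Rmin_Rmax; [|apply Hpc|apply HG].
    assert (Hmx : RInt (fun t => Rmax (psi n t) (g (S n) t)) a b <=
      RInt (g n) a b + e * (/ 2) ^ S n).
    (* This range starting at [n] is long enough for its maximum to dominate both [g n], hence
       [psi n], and [g (S n)]. *)
    { eapply Rle_trans; [|apply (Hm n (m n + S (m (S n)))%nat)].
      apply continuous_everywhere_RInt_le; auto.
      - apply continuous_everywhere_Rmax; [apply Hpc|apply HG].
      - intros t. apply Rmax_lub.
        + eapply Rle_trans; [apply Hpg|]. apply max_from_le. intros k Hk.
          apply max_from_ge. lia.
        + apply max_from_le. intros k Hk.
          replace (S n + k)%nat with (n + S k)%nat by lia. apply max_from_ge. lia. }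
    simpl. simpl in Hmx. lra. }
  exists psi. split; [exact Hpc|]. split; [|split; [|split]].
  - intros n t. split.
    + induction n as [|n IH]; [apply HGK|]. apply Rmin_glb; [exact IH|apply HGK].
    + eapply Rle_trans; [apply Hpg|apply HGK].
  - intros n t. apply Rmin_l.
  - intros n. specialize (Hdef n).
    assert (RInt (phi n) a b <= RInt (g n) a b).
    { apply continuous_everywhere_RInt_le; auto; [apply HG|]. intros t.
      rewrite <- (Nat.add_0_r n) at 1. apply max_from_ge. lia. }
    assert (0 < e * (/ 2) ^ n) by (apply Rmult_lt_0_compat; [auto|apply pow_lt; lra]). lra.
  - intros n t c Hle. eapply Rle_trans; [apply Hpg|]. apply max_from_le.
    intros k _. apply Hle. lia.
Qed.

(** Dini's theorem up to a null set, by the covering calculus: the limits of the integrals over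
    [[a, x]] define [M], whose increments lie below the integrals of every [psi n]. The bound [K]
    takes care of [N]; elsewhere some [psi n] is small near the point, by continuity. *)
Lemma dini_null (psi : nat -> R -> R) (N : R -> Prop) (a b K e : R) : a <= b -> 0 < e ->
  (forall n, continuous_everywhere (psi n)) -> (forall n t, 0 <= psi n t <= K) ->
  (forall n t, psi (S n) t <= psi n t) -> null_set N ->
  (forall t, a <= t <= b -> ~ N t -> forall c, 0 < c -> exists n, psi n t < c) ->
  exists n, RInt (psi n) a b <= e.
Proof.
  intros Hab He Hc Hb Hdec HN Hz.
  assert (HK : 0 <= K) by (pose proof (Hb O 0); lra).
  assert (Hei : forall n x y, ex_RInt (psi n) x y)
    by (intros; now apply continuous_everywhere_ex_RInt).
  assert (Hex : forall x, ex_finite_lim_seq (fun n => RInt (psi n) a (clamp a b x))).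
  { intros x. pose proof (clamp_bounds a b x Hab). apply (ex_finite_lim_seq_decr _ 0).
    - intros n. apply continuous_everywhere_RInt_le; auto. lra.
    - intros n. rewrite <- (Rmult_0_l (clamp a b x - a)), <- RInt_const_R.
      apply continuous_everywhere_RInt_le; auto; [|lra|intros t; apply Hb].
      intros t. apply continuous_const. }
  set (M := fun x => proj1_sig (constructive_indefinite_description _ (Hex x))).
  assert (HM : forall x, is_lim_seq (fun n => RInt (psi n) a (clamp a b x)) (M x)).
  { intros x. apply (proj2_sig (constructive_indefinite_description _ (Hex x))). }
  clearbody M. clear Hex.
  assert (Hdiff : forall p q, is_lim_seq
    (fun n => RInt (psi n) (clamp a b p) (clamp a b q)) (M q - M p)).
  { intros p q. apply is_lim_seq_ext with
      (u := fun n => RInt (psi n) a (clamp a b q) - RInt (psi n) a (clamp a b p)).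
    - intros n. assert (E := RInt_Chasles (psi n) a (clamp a b p) (clamp a b q) (Hei _ _ _) (Hei _ _ _)).
      unfold plus in E; simpl in E. lra.
    - now apply is_lim_seq_minus'. }
  assert (Hpos : forall n p q, p <= q -> 0 <= RInt (psi n) (clamp a b p) (clamp a b q)).
  { intros n p q Hpq. pose proof (clamp_incr a b p q Hpq).
    rewrite <- (Rmult_0_l (clamp a b q - clamp a b p)), <- RInt_const_R.
    apply continuous_everywhere_RInt_le; auto; [|intros t; apply Hb].
    intros t. apply continuous_const. }
  assert (HMm : forall x y, x <= y -> M x <= M y).
  { intros x y Hxy. assert (0 <= M y - M x); [|lra].
    apply (is_lim_seq_le (fun _ => 0) _ 0 (M y - M x) (fun n => Hpos n x y Hxy));
      [apply is_lim_seq_const|apply Hdiff]. }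
  assert (Hup : forall n p q, p <= q -> M q - M p <= RInt (psi n) (clamp a b p) (clamp a b q)).
  { intros n p q Hpq.
    apply (is_lim_seq_decr_compare (fun n => RInt (psi n) (clamp a b p) (clamp a b q)));
      [apply Hdiff|].
    intros k. apply continuous_everywhere_RInt_le; auto. now apply clamp_incr. }
  assert (Hclamp : forall p q, p <= q -> clamp a b q - clamp a b p <= q - p).
  { intros p q Hpq. unfold clamp, Rmax, Rmin.
    destruct (Rle_dec b q), (Rle_dec b p);
      repeat match goal with |- context [Rle_dec ?x ?y] => destruct (Rle_dec x y) end; lra. }
  assert (Hden : forall n p q c, p <= q -> 0 <= c -> (forall t, p <= t <= q -> psi n t <= c) ->
    a <= q -> p <= b -> M q - M p <= c * (q - p)).
  { intros n p q c Hpq Hc0 Hle Haq Hpb. eapply Rle_trans; [apply (Hup n p q Hpq)|].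
    apply Rle_trans with (c * (clamp a b q - clamp a b p));
      [|apply Rmult_le_compat_l; auto].
    rewrite <- RInt_const_R. apply RInt_le; auto.
    - now apply clamp_incr.
    - apply ex_RInt_const.
    - intros t Ht. apply Hle. revert Ht. unfold clamp, Rmax, Rmin.
      destruct (Rle_dec b q), (Rle_dec b p);
        repeat match goal with |- context [Rle_dec ?x ?y] => destruct (Rle_dec x y) end; lra. }
  (* Two sets of mass at most [d], doubled, leave the limit of the integrals at most [e / 2]. *)
  set (d := e / 8). assert (Hd : 0 < d) by (unfold d; lra).
  assert (HNull : Small M (fun t => a <= t <= b /\ N t) d).
  (* With the constant 2 in the role of [U], control of the mass is the Lipschitz bound on [M], and
     2 trivially recurs below 3. *)
  { apply (Null_of_null_set (fun _ _ => 2) M K 3 N 0); auto; try lra.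
    - intros t x Hx. replace (K * x * 2) with (K * ((t + x) - (t - x))) by ring.
      eapply Rle_trans; [apply (Hup O); lra|].
      apply Rle_trans with (K * (clamp a b (t + x) - clamp a b (t - x))).
      + rewrite <- RInt_const_R. apply RInt_le; auto.
        * apply clamp_incr. lra.
        * apply ex_RInt_const.
        * intros s _. apply Hb.
      + apply Rmult_le_compat_l; [auto|]. apply Hclamp. lra.
    - intros t [_ Ht]. rewrite Rplus_0_r. split; [auto|].
      intros d' Hd'. exists (d' / 2). split; lra. }
  assert (Hgood : Small M (fun t => a <= t <= b /\ ~ N t) d).
  { set (c := d / (b - a + 2)). assert (Hc0 : 0 < c) by (apply Rdiv_lt_0_compat; lra).
    replace d with (c * ((b + 1) - (a - 1))) by (unfold c; field; lra).
    apply Small_of_density; [lra|lra|]. intros t [Ht HNt].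
    destruct (Hz t Ht HNt c Hc0) as [n Hn].
    destruct (Hc n t (fun y => y < c)) as [dl Hdl].
    { assert (Hp : 0 < c - psi n t) by lra. exists (mkposreal _ Hp). intros y Hy.
      unfold ball in Hy; simpl in Hy. unfold AbsRing_ball, abs, minus, plus, opp in Hy; simpl in Hy.
      apply Rabs_lt_between in Hy. lra. }
    set (r := Rmin 1 (dl / 2)). pose proof (cond_pos dl).
    pose proof (Rmin_l 1 (dl / 2)). pose proof (Rmin_r 1 (dl / 2)).
    assert (Hr : 0 < r) by (apply Rmin_glb_lt; lra). fold r in H0, H1.
    exists (t - r), (t + r). split; [lra|]. split; [lra|]. split; [lra|].
    apply (Hden n); try lra. intros s Hs. left. apply Hdl.
    unfold ball; simpl. unfold AbsRing_ball, abs, minus, plus, opp; simpl.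
    apply Rabs_def1; lra. }
  assert (Hall : Small M (fun t => a <= t <= b) (d + d)).
  { eapply Small_mono; [| |exact (Small_or _ _ _ _ _ HNull Hgood)]; [|lra].
    intros t Ht. destruct (classic (N t)); [left|right]; auto. }
  apply Small_interval_increment in Hall; auto.
  pose proof (Hdiff a b) as Hl.
  destruct (Hl (fun y => y < e)) as [n Hn].
  { assert (Hp : 0 < e - (M b - M a)) by (unfold d in Hall; lra).
    exists (mkposreal _ Hp). intros y Hy.
    unfold ball in Hy; simpl in Hy. unfold AbsRing_ball, abs, minus, plus, opp in Hy; simpl in Hy.
    apply Rabs_lt_between in Hy. lra. }
  exists n. specialize (Hn n (le_n n)). rewrite !clamp_id in Hn by lra. lra.
Qed.

(** The theorem of Arzela with an exceptional null set. The [phi n] need not be monotone in [n],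
    hence the passage to a nonincreasing sequence of continuous functions whose integrals are almost
    as large. *)
Lemma bounded_convergence_null (phi : nat -> R -> R) (N : R -> Prop) (a b K e : R) :
  a <= b -> 0 < e ->
  (forall n, continuous_everywhere (phi n)) -> (forall n t, 0 <= phi n t <= K) -> null_set N ->
  (forall t, a <= t <= b -> ~ N t -> forall c, 0 < c ->
     exists n, forall m, (n <= m)%nat -> phi m t <= c) ->
  exists n, RInt (phi n) a b <= e.
Proof.
  intros Hab He Hc Hb HN Hz.
  destruct (min_chain_exists phi a b K (e / 2) Hab ltac:(lra) Hc Hb)
    as [psi [H1 [H2 [H3 [H4 H5]]]]].
  destruct (dini_null psi N a b K (e / 2) Hab ltac:(lra) H1 H2 H3 HN) as [n Hn].
  - intros t Ht HNt c Hc0. destruct (Hz t Ht HNt (c / 2) ltac:(lra)) as [n Hn].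
    exists n. specialize (H5 n t (c / 2) Hn). lra.
  - exists n. specialize (H4 n). lra.
Qed.

(** * Holomorphic functions in logarithmic coordinates *)

Lemma Cmod_sq (z : C) : Cmod z * Cmod z = Re z * Re z + Im z * Im z.
Proof. pose proof (Cmod2_alt z). simpl in H. lra. Qed.

Lemma im_le_Cmod (z : C) : Rabs (Im z) <= Cmod z.
Proof. eapply Rle_trans; [apply Rmax_r|apply Rmax_Cmod]. Qed.

Lemma sqrt2_le_2 : sqrt 2 <= 2.
Proof. pose proof (sqrt_sqrt 2 ltac:(lra)). pose proof (sqrt_pos 2). nra. Qed.

Lemma Cmod_le_twice_Rmax (z : C) : Cmod z <= 2 * Rmax (Rabs (Re z)) (Rabs (Im z)).
Proof.
  eapply Rle_trans; [apply Cmod_2Rmax|]. apply Rmult_le_compat_r.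
  - eapply Rle_trans; [apply Rabs_pos|apply Rmax_l].
  - apply sqrt2_le_2.
Qed.

Definition cdiff (f : C -> C) (z l : C) : Prop := forall eps, 0 < eps -> exists d, 0 < d /\
  forall y, Cmod (y - z) < d -> Cmod (f y - f z - l * (y - z)) <= eps * Cmod (y - z).

Lemma is_derive_cdiff (f : C -> C) (z l : C) :
  is_derive (K := C_AbsRing) f z l -> cdiff f z l.
Proof.
  intros [_ H] eps Heps.
  destruct (H z (fun P HP => HP) (mkposreal eps Heps)) as [d Hd].
  exists d. split; [apply cond_pos|]. intros y Hy.
  specialize (Hd y Hy). simpl in Hd.
  replace (l * (y - z))%C with ((y - z) * l)%C by ring. exact Hd.
Qed.

Lemma cdiff_continuous f z l : cdiff f z l -> forall eps, 0 < eps ->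
  exists d, 0 < d /\ forall y, Cmod (y - z) < d -> Cmod (f y - f z) < eps.
Proof.
  intros H eps He. destruct (H 1 Rlt_0_1) as [d [Hd Hy]].
  pose proof (Cmod_ge_0 l). set (d' := eps / (Cmod l + 1)).
  assert (Hd' : 0 < d') by (apply Rdiv_lt_0_compat; lra).
  exists (Rmin d d'). split; [now apply Rmin_glb_lt|]. intros y Hyd.
  pose proof (Rmin_l d d'). pose proof (Rmin_r d d').
  specialize (Hy y ltac:(lra)).
  replace (f y - f z)%C with ((f y - f z - l * (y - z)) + l * (y - z))%C by ring.
  eapply Rle_lt_trans; [apply Cmod_triangle|]. rewrite Cmod_mult.
  apply Rle_lt_trans with ((Cmod l + 1) * Cmod (y - z)); [lra|].
  apply Rlt_le_trans with ((Cmod l + 1) * d'); [apply Rmult_lt_compat_l; lra|].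
  unfold d'. right. field. lra.
Qed.

Lemma cdiff_affine (c k : C) f z l : cdiff f z l -> cdiff (fun y => c * f y + k)%C z (c * l).
Proof.
  intros H eps He. pose proof (Cmod_ge_0 c).
  destruct (H (eps / (Cmod c + 1))) as [d [Hd Hy]]; [apply Rdiv_lt_0_compat; lra|].
  exists d. split; [auto|]. intros y Hyd. specialize (Hy y Hyd).
  replace (c * f y + k - (c * f z + k) - c * l * (y - z))%C with
    (c * (f y - f z - l * (y - z)))%C by ring.
  rewrite Cmod_mult. pose proof (Cmod_ge_0 (y - z)).
  apply Rle_trans with ((Cmod c + 1) * (eps / (Cmod c + 1) * Cmod (y - z))).
  - apply Rmult_le_compat; try lra; apply Cmod_ge_0.
  - right. field. lra.
Qed.

Lemma Cmod_sub_lower (a b : C) : Cmod a - Cmod (b - a) <= Cmod b.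
Proof.
  pose proof (Cmod_triangle b (a - b)) as T. replace (b + (a - b))%C with a in T by ring.
  replace (a - b)%C with (- (b - a))%C in T by ring. rewrite Cmod_opp in T. lra.
Qed.

Lemma cdiff_inv f z l : cdiff f z l -> f z <> 0 ->
  cdiff (fun y => / f y)%C z (- (l / (f z * f z))).
Proof.
  intros H Hf eps He.
  assert (Hm : 0 < Cmod (f z)) by now apply Cmod_gt_0.
  set (m := Cmod (f z)) in *. pose proof (Cmod_ge_0 l) as Hl0.
  (* [e1] and [e2] make both terms of the numerator at most [eps * m^3 / 4 * |y - z|], while
     [|f y| >= m / 2] keeps the denominator above [m^3 / 2]. *)
  set (e1 := eps * (m * m) / 4).
  assert (He1 : 0 < e1) by (apply Rdiv_lt_0_compat; [apply Rmult_lt_0_compat; nra|lra]).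
  destruct (H e1 He1) as [d1 [Hd1 H1]].
  set (e2 := Rmin (m / 2) (eps * (m * m * m) / (4 * (Cmod l + 1)))).
  assert (He2 : 0 < e2).
  { apply Rmin_glb_lt; [lra|]. apply Rdiv_lt_0_compat; [|lra].
    apply Rmult_lt_0_compat; [lra|]. apply Rmult_lt_0_compat; nra. }
  destruct (cdiff_continuous f z l H e2 He2) as [d2 [Hd2 H2]].
  exists (Rmin d1 d2). split; [now apply Rmin_glb_lt|]. intros y Hy.
  pose proof (Rmin_l d1 d2). pose proof (Rmin_r d1 d2).
  specialize (H1 y ltac:(lra)). specialize (H2 y ltac:(lra)).
  pose proof (Rmin_l (m / 2) (eps * (m * m * m) / (4 * (Cmod l + 1)))) as E1.
  pose proof (Rmin_r (m / 2) (eps * (m * m * m) / (4 * (Cmod l + 1)))) as E2.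
  fold e2 in E1, E2.
  pose proof (Cmod_sub_lower (f z) (f y)) as Hlow. fold m in Hlow.
  assert (Hfy0 : 0 < Cmod (f y)) by lra.
  assert (Hfy : f y <> 0) by now apply Cmod_gt_0.
  replace (/ f y - / f z - - (l / (f z * f z)) * (y - z))%C with
    ((- (f y - f z - l * (y - z)) * f z + l * (y - z) * (f y - f z)) *
      / (f y * (f z * f z)))%C.
  2:{ field. split; auto. }
  rewrite Cmod_mult, Cmod_inv, !Cmod_mult by (repeat apply Cmult_neq_0; auto).
  fold m. pose proof (Cmod_ge_0 (y - z)) as Hyz.
  assert (Hden : 0 < Cmod (f y) * (m * m)) by (apply Rmult_lt_0_compat; nra).
  apply Rle_div_l; [exact Hden|].
  assert (N1 : Cmod (- (f y - f z - l * (y - z)) * f z + l * (y - z) * (f y - f z)) <=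
    e1 * Cmod (y - z) * m + Cmod l * Cmod (y - z) * e2).
  { eapply Rle_trans; [apply Cmod_triangle|]. rewrite !Cmod_mult, Cmod_opp. fold m.
    apply Rplus_le_compat.
    - apply Rmult_le_compat_r; lra.
    - apply Rmult_le_compat_l; [apply Rmult_le_pos; lra|lra]. }
  eapply Rle_trans; [exact N1|].
  assert (N2 : Cmod l * e2 <= eps * (m * m * m) / 4).
  { apply Rle_trans with ((Cmod l + 1) * (eps * (m * m * m) / (4 * (Cmod l + 1)))).
    - apply Rmult_le_compat; lra.
    - right. field. lra. }
  apply Rle_trans with (eps * (m * m * m) / 2 * Cmod (y - z)).
  - unfold e1. nra.
  - apply Rle_trans with (eps * Cmod (y - z) * (m / 2 * (m * m))); [right; field|].
    apply Rmult_le_compat_l; [apply Rmult_le_pos; lra|]. apply Rmult_le_compat_r; nra.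
Qed.

Lemma cdiff_re f z l : cdiff f z l ->
  differentiable_pt_lim (fun u v => Re (f (u, v))) (Re z) (Im z) (Re l) (- Im l).
Proof.
  intros H eps. destruct (H (eps / 2)) as [d [Hd Hy]]; [pose proof (cond_pos eps); lra|].
  assert (Hd2 : 0 < d / 2) by lra. exists (mkposreal _ Hd2). simpl. intros u v Hu Hv.
  pose proof (Cmod_le_twice_Rmax ((u, v) - z)) as Hm. destruct z as [z1 z2].
  assert (Hmx : Rmax (Rabs (u - z1)) (Rabs (v - z2)) < d / 2) by (apply Rmax_lub_lt; auto).
  assert (E : Rmax (Rabs (Re ((u, v) - (z1, z2)))) (Rabs (Im ((u, v) - (z1, z2)))) =
    Rmax (Rabs (u - z1)) (Rabs (v - z2))) by reflexivity.
  rewrite E in Hm. specialize (Hy (u, v) ltac:(lra)).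
  pose proof (re_le_Cmod (f (u, v) - f (z1, z2) - l * ((u, v) - (z1, z2)))) as Hre.
  replace (Re (f (u, v) - f (z1, z2) - l * ((u, v) - (z1, z2)))) with
    (Re (f (u, v)) - Re (f (z1, z2)) - (Re l * (u - z1) + - Im l * (v - z2))) in Hre
    by (unfold Re, Im; simpl; ring).
  pose proof (cond_pos eps). eapply Rle_trans; [exact Hre|]. eapply Rle_trans; [exact Hy|].
  apply Rle_trans with (eps / 2 * (2 * Rmax (Rabs (u - z1)) (Rabs (v - z2)))).
  - apply Rmult_le_compat_l; lra.
  - right. simpl. field.
Qed.

Lemma cdiff_im f z l : cdiff f z l ->
  differentiable_pt_lim (fun u v => Im (f (u, v))) (Re z) (Im z) (Im l) (Re l).
Proof.
  intros H. pose proof (cdiff_re _ _ _ (cdiff_affine (- Ci) 0 f z l H)) as E.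
  apply differentiable_pt_lim_ext with (f1 := fun u v => Re (- Ci * f (u, v) + 0)).
  - exists (mkposreal 1 Rlt_0_1). intros u v _ _. unfold Re, Im, Ci; simpl. ring.
  - replace (Im l) with (Re (- Ci * l)) by (unfold Re, Im, Ci; simpl; ring).
    replace (Re l) with (- Im (- Ci * l)) by (unfold Re, Im, Ci; simpl; ring). exact E.
Qed.

Definition disk_point (x t : R) : C := (exp (- x) * cos t, exp (- x) * sin t).

Lemma Cmod_disk_point x t : Cmod (disk_point x t) = exp (- x).
Proof.
  assert (H := Cmod_sq (disk_point x t)). unfold disk_point, Re, Im in H; simpl in H.
  pose proof (sin2_cos2 t) as T. unfold Rsqr in T. pose proof (exp_pos (- x)).
  pose proof (Cmod_ge_0 (disk_point x t)). unfold disk_point in *.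
  set (m := Cmod _) in *. set (e := exp (- x)) in *.
  assert (m * m = e * e).
  { rewrite H. replace (e * cos t * (e * cos t) + e * sin t * (e * sin t)) with
      (e * e * (sin t * sin t + cos t * cos t)) by ring. rewrite T. ring. }
  nra.
Qed.

Lemma disk_point_in_disk x t : 0 < x -> in_disk (disk_point x t).
Proof.
  intros Hx. unfold in_disk. rewrite Cmod_disk_point. rewrite <- exp_0.
  apply exp_increasing. lra.
Qed.

Lemma disk_point_period x t : disk_point x (t + 2 * PI) = disk_point x t.
Proof.
  unfold disk_point. replace (t + 2 * PI) with (t + 2 * INR 1 * PI) by (simpl; ring).
  now rewrite cos_period, sin_period.
Qed.

Lemma differentiable_pt_lim_Rmult a b : differentiable_pt_lim Rmult a b b a.
Proof.
  intros eps. exists eps. intros u v Hu Hv.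
  replace (u * v - a * b - (b * (u - a) + a * (v - b))) with ((u - a) * (v - b)) by ring.
  rewrite Rabs_mult. pose proof (Rmax_l (Rabs (u - a)) (Rabs (v - b))).
  apply Rle_trans with (Rabs (u - a) * eps).
  - apply Rmult_le_compat_l; [apply Rabs_pos|lra].
  - rewrite Rmult_comm. apply Rmult_le_compat_l; [left; apply cond_pos|auto].
Qed.

Lemma differentiable_pt_lim_snd (g : R -> R) x t l : derivable_pt_lim g t l ->
  differentiable_pt_lim (fun _ v => g v) x t 0 l.
Proof.
  intros H. pose proof (differentiable_pt_lim_proj1_0 g t x l H) as E.
  intros eps. destruct (E eps) as [d Hd]. exists d. intros u v Hu Hv.
  specialize (Hd v u Hv Hu). rewrite Rmax_comm.
  replace (0 * (u - x) + l * (v - t)) with (l * (v - t) + 0 * (u - x)) by ring. exact Hd.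
Qed.

Lemma differentiable_disk_point_re x t : differentiable_pt_lim (fun u v => exp (- u) * cos v) x t
  (- (exp (- x) * cos t)) (- (exp (- x) * sin t)).
Proof.
  replace (- (exp (- x) * cos t)) with (cos t * - exp (- x) + exp (- x) * 0) by ring.
  replace (- (exp (- x) * sin t)) with (cos t * 0 + exp (- x) * - sin t) by ring.
  apply (differentiable_pt_lim_comp Rmult (fun u _ => exp (- u)) (fun _ v => cos v)).
  - apply differentiable_pt_lim_Rmult.
  - apply (differentiable_pt_lim_proj1_0 (fun u => exp (- u))). apply is_derive_Reals.
    auto_derive; [auto|ring].
  - apply differentiable_pt_lim_snd, derivable_pt_lim_cos.
Qed.

Lemma differentiable_disk_point_im x t : differentiable_pt_lim (fun u v => exp (- u) * sin v) x t
  (- (exp (- x) * sin t)) (exp (- x) * cos t).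
Proof.
  replace (- (exp (- x) * sin t)) with (sin t * - exp (- x) + exp (- x) * 0) by ring.
  replace (exp (- x) * cos t) with (sin t * 0 + exp (- x) * cos t) by ring.
  apply (differentiable_pt_lim_comp Rmult (fun u _ => exp (- u)) (fun _ v => sin v)).
  - apply differentiable_pt_lim_Rmult.
  - apply (differentiable_pt_lim_proj1_0 (fun u => exp (- u))). apply is_derive_Reals.
    auto_derive; [auto|ring].
  - apply differentiable_pt_lim_snd, derivable_pt_lim_sin.
Qed.

(** Since [z = e^(- x + i t)] is its own derivative with respect to [- x + i t], the derivative of
    [f] in this variable is [z f'(z)]. *)
Lemma cdiff_holomorphic_pair (f df : C -> C) : (forall z, in_disk z -> cdiff f z (df z)) ->
  holomorphic_pair (fun x t => Re (f (disk_point x t))) (fun x t => Im (f (disk_point x t)))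
    (fun x t => Re (disk_point x t * df (disk_point x t)))
    (fun x t => Im (disk_point x t * df (disk_point x t))).
Proof.
  intros H x t Hx. pose proof (H _ (disk_point_in_disk x t Hx)) as Hf.
  pose proof (differentiable_disk_point_re x t) as Du.
  pose proof (differentiable_disk_point_im x t) as Dv.
  pose proof (differentiable_pt_lim_comp _ _ _ _ _ _ _ _ _ _ _ (cdiff_re _ _ _ Hf) Du Dv) as Er.
  pose proof (differentiable_pt_lim_comp _ _ _ _ _ _ _ _ _ _ _ (cdiff_im _ _ _ Hf) Du Dv) as Ei.
  set (l := df (disk_point x t)) in *. split.
  - replace (- Re (disk_point x t * l)) with
      (Re l * - (exp (- x) * cos t) + - Im l * - (exp (- x) * sin t))
      by (unfold Re, Im, disk_point; simpl; ring).
    replace (- Im (disk_point x t * l)) with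
      (Re l * - (exp (- x) * sin t) + - Im l * (exp (- x) * cos t))
      by (unfold Re, Im, disk_point; simpl; ring).
    exact Er.
  - replace (- Im (disk_point x t * l)) with
      (Im l * - (exp (- x) * cos t) + Re l * - (exp (- x) * sin t))
      by (unfold Re, Im, disk_point; simpl; ring).
    replace (Re (disk_point x t * l)) with
      (Im l * - (exp (- x) * sin t) + Re l * (exp (- x) * cos t))
      by (unfold Re, Im, disk_point; simpl; ring).
    exact Ei.
Qed.

Lemma RtoC_exp_cis x t : (RtoC (exp (- x)) * cis t)%C = disk_point x t.
Proof. unfold RtoC, cis, disk_point, Cmult; simpl. f_equal; ring. Qed.

Lemma radial_limit_disk_point f t beta : radial_limit f (cis t) beta <->
  (forall eps, 0 < eps -> exists d, 0 < d /\
     forall x, 0 < x < d -> Cmod (f (disk_point x t) - beta) < eps).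
Proof.
  split.
  - intros H eps He.
    destruct (H (fun y => Cmod (y - beta) < eps)) as [d Hd].
    (* Balls in [C] are comparable to discs for [Cmod] only up to [sqrt 2], hence half the
       radius. *)
    { assert (He2 : 0 < eps / 2) by lra. exists (mkposreal _ He2). intros y Hy.
      apply (C_NormedModule_mixin_compat2 beta y (mkposreal _ He2)) in Hy. simpl in Hy.
      change (Cmod (y - beta) < sqrt 2 * (eps / 2)) in Hy.
      pose proof sqrt2_le_2.
      assert (sqrt 2 * (eps / 2) <= 2 * (eps / 2)) by (apply Rmult_le_compat_r; lra). lra. }
    exists d. split; [apply cond_pos|]. intros x Hx. rewrite <- RtoC_exp_cis.
    assert (H1 : exp (- x) < 1) by (rewrite <- exp_0; apply exp_increasing; lra).
    pose proof (exp_ineq1_le (- x)).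
    apply (Hd (exp (- x))); [|exact H1].
    unfold ball; simpl. unfold AbsRing_ball, abs, minus, plus, opp; simpl.
    apply Rabs_def1; lra.
  - intros H P [eps HP]. destruct (H eps (cond_pos eps)) as [d [Hd Hx]].
    assert (H1 : exp (- d) < 1) by (rewrite <- exp_0; apply exp_increasing; lra).
    assert (H2 : 0 < 1 - exp (- d)) by lra.
    exists (mkposreal _ H2). intros r Hr Hr1.
    unfold ball in Hr; simpl in Hr. unfold AbsRing_ball, abs, minus, plus, opp in Hr; simpl in Hr.
    apply Rabs_lt_between in Hr. pose proof (exp_pos (- d)).
    assert (Hr0 : 0 < r) by lra.
    apply HP. apply C_NormedModule_mixin_compat1.
    rewrite <- (exp_ln r Hr0), <- (Ropp_involutive (ln r)), RtoC_exp_cis.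
    apply Hx. assert (ln r < 0) by (rewrite <- ln_1; apply ln_increasing; lra).
    assert (- d < ln r) by (rewrite <- (ln_exp (- d)); apply ln_increasing; lra). lra.
Qed.

(** * Inner functions with contractive hyperbolic derivative *)

(** Over a full period the two sides of the rectangle in the [x] direction cancel, so the integral
    does not depend on the height; at great height the circle shrinks to 0. *)
Lemma mean_value_disk (f df : C -> C) (c x : R) : (forall z, in_disk z -> cdiff f z (df z)) ->
  0 < x -> RInt (fun t => Re (f (disk_point x t))) c (c + 2 * PI) = 2 * PI * Re (f 0).
Proof.
  intros H Hx. pose proof PI_RGT_0 as Hpi.
  pose proof (cdiff_holomorphic_pair f df H) as Hh.
  pose proof (holomorphic_pair_closed_im _ _ _ _ Hh) as Hcl.
  set (U := fun x t => Re (f (disk_point x t))) in *.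
  set (V := fun x t => Im (f (disk_point x t))) in *.
  assert (Hconst : forall y, 0 < y -> RInt (U y) c (c + 2 * PI) = RInt (U x) c (c + 2 * PI)).
  { intros y Hy. pose proof (closed_form_rectangle _ _ x y c (c + 2 * PI) Hcl Hx Hy) as E.
    rewrite (RInt_ext (fun u => - V u (c + 2 * PI)) (fun u => - V u c)) in E; [lra|].
    intros u _. unfold V. now rewrite disk_point_period. }
  change (RInt (U x) c (c + 2 * PI) = 2 * PI * Re (f 0)).
  apply cond_eq. intros eps He.
  assert (H0 : in_disk 0) by (unfold in_disk; rewrite Cmod_0; lra).
  assert (He' : 0 < eps / (4 * PI)) by (apply Rdiv_lt_0_compat; lra).
  destruct (cdiff_continuous f 0 _ (H 0 H0) _ He') as [d [Hd Hy]].
  set (y := Rmax 1 (- ln (d / 2))).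
  assert (Hy0 : 0 < y) by (pose proof (Rmax_l 1 (- ln (d / 2))); unfold y; lra).
  assert (Hey : exp (- y) < d).
  { apply Rle_lt_trans with (d / 2); [|lra]. rewrite <- (exp_ln (d / 2)) by lra.
    pose proof (Rmax_r 1 (- ln (d / 2))). fold y in H1.
    destruct (Rle_lt_or_eq_dec (- y) (ln (d / 2)) ltac:(lra)) as [E|E];
      [left; now apply exp_increasing|rewrite E; lra]. }
  rewrite <- (Hconst y Hy0).
  assert (E : Rabs (RInt (U y) c (c + 2 * PI) - Re (f 0) * (c + 2 * PI - c)) <=
    eps / (4 * PI) * (c + 2 * PI - c)).
  { apply RInt_near_const; [lra| |].
    - eapply closed_form_ex_RInt_r; eauto.
    - intros t _. left. unfold U.
      replace (Re (f (disk_point y t)) - Re (f 0)) with (Re (f (disk_point y t) - f 0)) by reflexivity.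
      eapply Rle_lt_trans; [apply re_le_Cmod|]. apply Hy.
      replace (disk_point y t - 0)%C with (disk_point y t) by ring.
      rewrite Cmod_disk_point. exact Hey. }
  replace (2 * PI * Re (f 0)) with (Re (f 0) * (c + 2 * PI - c)) by ring.
  eapply Rle_lt_trans; [exact E|]. replace (eps / (4 * PI) * (c + 2 * PI - c)) with (eps / 2) by (field; lra).
  lra.
Qed.

Lemma RInt_zero_interior (g : R -> R) (a b t : R) : continuous_everywhere g ->
  (forall s, 0 <= g s) -> RInt g a b = 0 -> a < t < b -> g t = 0.
Proof.
  intros Hc Hpos H0 Ht.
  assert (Hei : forall x y, ex_RInt g x y) by (intros; now apply continuous_everywhere_ex_RInt).
  assert (Hge : forall x y, x <= y -> 0 <= RInt g x y).
  { intros x y Hxy. rewrite <- (Rmult_0_l (y - x)), <- RInt_const_R.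
    apply continuous_everywhere_RInt_le; auto. intros s. apply continuous_const. }
  assert (Hz : forall y, a <= y <= b -> RInt g a y = 0).
  { intros y Hy. pose proof (RInt_Chasles g a y b (Hei _ _) (Hei _ _)) as E.
    unfold plus in E; simpl in E. pose proof (Hge a y ltac:(lra)). pose proof (Hge y b ltac:(lra)).
    lra. }
  assert (D1 : is_derive (fun y => RInt g a y) t (g t)).
  { apply (is_derive_RInt g (fun y => RInt g a y) a); [|apply Hc].
    exists (mkposreal 1 Rlt_0_1). intros y _. apply (RInt_correct g), Hei. }
  assert (D2 : is_derive (fun y => RInt g a y) t 0).
  { apply (is_derive_ext_loc (fun _ => 0)); [|refine (is_derive_const _ _)].
    set (r := Rmin (t - a) (b - t)). assert (Hr : 0 < r) by (apply Rmin_glb_lt; lra).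
    exists (mkposreal r Hr). intros y Hy. unfold ball in Hy; simpl in Hy.
    unfold AbsRing_ball, abs, minus, plus, opp in Hy; simpl in Hy.
    apply Rabs_lt_between in Hy.
    pose proof (Rmin_l (t - a) (b - t)). pose proof (Rmin_r (t - a) (b - t)). fold r in H, H1.
    symmetry. apply Hz. lra. }
  apply is_derive_unique in D1. apply is_derive_unique in D2. congruence.
Qed.

(** The inequality is available only while [psi] is positive, so it is integrated up to the supremum
    [m] of the interval of positivity. The lower bound obtained there does not degenerate, which
    carries positivity to [m] and beyond. *)
Lemma gronwall_positive (psi dpsi : R -> R) (K : R) :
  (forall s, 0 <= s <= 1 -> is_derive psi s (dpsi s)) -> 0 < psi 0 ->
  (forall s, 0 <= s <= 1 -> 0 < psi s -> - K * psi s <= dpsi s) -> 0 < psi 1.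
Proof.
  intros Hd H0 Hg.
  assert (Hcont : forall s eps, 0 <= s <= 1 -> 0 < eps -> exists d, 0 < d /\
    forall y, Rabs (y - s) < d -> Rabs (psi y - psi s) < eps).
  { intros s eps Hs He.
    assert (Hc : continuous psi s) by (apply (ex_derive_continuous psi); eexists; now apply Hd).
    destruct (Hc (fun y => Rabs (y - psi s) < eps)) as [d Hdd].
    - exists (mkposreal eps He). intros y Hy. exact Hy.
    - exists d. split; [apply cond_pos|]. intros y Hy. apply Hdd. exact Hy. }
  set (S := fun s => 0 <= s <= 1 /\ forall u, 0 <= u <= s -> 0 < psi u).
  destruct (completeness S) as [m [Hub Hlub]].
  { exists 1. intros s [Hs _]. lra. }
  { exists 0. split; [lra|]. intros u Hu. replace u with 0 by lra. auto. }
  assert (Hm0 : 0 <= m).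
  { apply Hub. split; [lra|]. intros u Hu. replace u with 0 by lra. auto. }
  assert (Hm1 : m <= 1) by (apply Hlub; intros s [Hs _]; lra).
  assert (Hlt : forall s, 0 <= s < m -> 0 < psi s).
  { intros s Hs. apply NNPP. intros Hn. apply (Rlt_not_le m s); [lra|].
    apply Hlub. intros v [Hv Hv']. apply Rnot_lt_le. intros Hsv. apply Hn, Hv'. lra. }
  assert (Hlow : forall s, 0 <= s < m -> psi 0 * exp (- Rabs K) <= psi s).
  { intros s Hs.
    assert (E : 0 * s - 0 * 0 <= psi s * exp (K * s) - psi 0 * exp (K * 0)).
    { apply (increment_dominated (fun u => 0 * u) (fun u => psi u * exp (K * u)) (fun _ => 0)
        (fun u => dpsi u * exp (K * u) + psi u * (K * exp (K * u)))); [lra| | |].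
      - intros u _. auto_derive; [auto|ring].
      - intros u Hu. refine (is_derive_mult psi (fun u => exp (K * u)) u _ _ (Hd u _) _ _).
        + lra.
        + auto_derive; [auto|ring].
        + intros; apply Rmult_comm.
      - intros u Hu. pose proof (Hg u ltac:(lra) (Hlt u ltac:(lra))) as G.
        pose proof (exp_pos (K * u)).
        assert (- K * psi u * exp (K * u) <= dpsi u * exp (K * u)) by (apply Rmult_le_compat_r; lra).
        lra. }
    rewrite (Rmult_0_r K), exp_0 in E.
    assert (Hexp : exp (K * s) <= exp (Rabs K)).
    { assert (Hle : K * s <= Rabs K).
      { pose proof (Rle_abs K). pose proof (Rabs_pos K).
        assert (K * s <= Rabs K * s) by (apply Rmult_le_compat_r; lra). nra. }
      destruct (Rle_lt_or_eq_dec _ _ Hle) as [E'|E'];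
        [left; now apply exp_increasing|rewrite E'; lra]. }
    rewrite exp_Ropp. apply Rle_div_l; [apply exp_pos|].
    pose proof (Hlt s Hs). nra. }
  assert (Hpm : 0 < psi m).
  { destruct (Req_dec m 0) as [->|Hne]; [auto|].
    set (c := psi 0 * exp (- Rabs K)) in *.
    assert (Hc0 : 0 < c) by (apply Rmult_lt_0_compat; [auto|apply exp_pos]).
    destruct (Hcont m c ltac:(lra) Hc0) as [d [Hd0 Hdd]].
    set (s := Rmax 0 (m - d / 2)).
    assert (Hs : 0 <= s < m) by (split; [apply Rmax_l|apply Rmax_lub_lt; lra]).
    assert (Hs2 : m - d / 2 <= s) by apply Rmax_r.
    specialize (Hlow s Hs). specialize (Hdd s ltac:(apply Rabs_def1; lra)).
    apply Rabs_lt_between in Hdd. lra. }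
  destruct (Rle_lt_or_eq_dec m 1 Hm1) as [Hm|Hm]; [|now rewrite <- Hm].
  exfalso. destruct (Hcont m (psi m) ltac:(lra) Hpm) as [d [Hd0 Hdd]].
  set (s := Rmin 1 (m + d / 2)).
  assert (Hs : m < s) by (apply Rmin_glb_lt; lra).
  pose proof (Rmin_l 1 (m + d / 2)). pose proof (Rmin_r 1 (m + d / 2)). fold s in H, H1.
  assert (s <= m); [|lra]. apply Hub. split; [lra|]. intros u Hu.
  destruct (Rlt_dec u m) as [Hum|Hum]; [apply Hlt; lra|].
  specialize (Hdd u ltac:(apply Rabs_def1; lra)). apply Rabs_lt_between in Hdd. lra.
Qed.

Lemma Cmod_lt_1_sq (z : C) : Cmod z < 1 <-> 0 < 1 - Cmod z * Cmod z.
Proof. pose proof (Cmod_ge_0 z). split; intros; nra. Qed.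

Lemma Cmod_dot (a b : C) : Rabs (Re a * Re b + Im a * Im b) <= Cmod a * Cmod b.
Proof.
  rewrite <- (Cmod_conj a), <- Cmod_mult.
  replace (Re a * Re b + Im a * Im b) with (Re (Cconj a * b)) by (unfold Re, Im, Cconj; simpl; ring).
  apply re_le_Cmod.
Qed.

(* Along a segment, [1 - |f|^2] decays at most exponentially as long as it is positive. *)
Lemma lt1_propagates (f df : C -> C) (D : R) (z1 z2 : C) :
  (forall z, in_disk z -> cdiff f z (df z)) -> 0 <= D ->
  (forall z, in_disk z -> Cmod (f z) < 1 ->
     (1 - Cmod z * Cmod z) * Cmod (df z) <= D * (1 - Cmod (f z) * Cmod (f z))) ->
  in_disk z1 -> in_disk z2 -> Cmod (f z1) < 1 -> Cmod (f z2) < 1.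
Proof.
  intros Hf HD Hdh Hz1 Hz2 Hf1.
  set (gam := fun s => (Re z1 + s * (Re z2 - Re z1), Im z1 + s * (Im z2 - Im z1)) : C).
  set (m := Rmax (Cmod z1) (Cmod z2)).
  assert (Hm : 0 <= m < 1).
  { split; [eapply Rle_trans; [apply Cmod_ge_0|apply Rmax_l]|]. apply Rmax_lub_lt; auto. }
  assert (Hgam : forall s, 0 <= s <= 1 -> Cmod (gam s) <= m).
  { intros s Hs. replace (gam s) with (RtoC (1 - s) * z1 + RtoC s * z2)%C.
    - eapply Rle_trans; [apply Cmod_triangle|]. rewrite !Cmod_mult, !Cmod_R.
      rewrite !Rabs_right by lra.
      pose proof (Rmax_l (Cmod z1) (Cmod z2)). pose proof (Rmax_r (Cmod z1) (Cmod z2)).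
      fold m in H, H0. nra.
    - unfold gam, RtoC, Cplus, Cmult, Re, Im; simpl. f_equal; ring. }
  assert (Hgd : forall s, 0 <= s <= 1 -> in_disk (gam s)).
  { intros s Hs. unfold in_disk. specialize (Hgam s Hs). lra. }
  set (w := (z2 - z1)%C).
  assert (HA : forall s, 0 <= s <= 1 -> is_derive (fun u => Re (f (gam u))) s (Re (df (gam s) * w))).
  { intros s Hs. pose proof (cdiff_re _ _ _ (Hf _ (Hgd s Hs))) as E.
    apply is_derive_Reals.
    replace (Re (df (gam s) * w)) with
      (Re (df (gam s)) * (Re z2 - Re z1) + - Im (df (gam s)) * (Im z2 - Im z1))
      by (unfold w, Re, Im; simpl; ring).
    apply (derivable_pt_lim_comp_2d _ (fun u => Re z1 + u * (Re z2 - Re z1))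
      (fun u => Im z1 + u * (Im z2 - Im z1)) s _ _ _ _ E);
      apply is_derive_Reals; auto_derive; auto; ring. }
  assert (HB : forall s, 0 <= s <= 1 -> is_derive (fun u => Im (f (gam u))) s (Im (df (gam s) * w))).
  { intros s Hs. pose proof (cdiff_im _ _ _ (Hf _ (Hgd s Hs))) as E.
    apply is_derive_Reals.
    replace (Im (df (gam s) * w)) with
      (Im (df (gam s)) * (Re z2 - Re z1) + Re (df (gam s)) * (Im z2 - Im z1))
      by (unfold w, Re, Im; simpl; ring).
    apply (derivable_pt_lim_comp_2d _ (fun u => Re z1 + u * (Re z2 - Re z1))
      (fun u => Im z1 + u * (Im z2 - Im z1)) s _ _ _ _ E);
      apply is_derive_Reals; auto_derive; auto; ring. }
  assert (Hsq : forall (g : R -> R) (s l : R), is_derive g s l ->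
    is_derive (fun u => g u * g u) s (l * g s + g s * l)).
  { intros g s l Hg. refine (is_derive_mult g g s _ _ Hg Hg _). intros; apply Rmult_comm. }
  assert (E1 : gam 1 = z2) by (unfold gam, Re, Im; destruct z2; simpl; f_equal; ring).
  assert (E0 : gam 0 = z1) by (unfold gam, Re, Im; destruct z1; simpl; f_equal; ring).
  apply Cmod_lt_1_sq. rewrite <- E1.
  (* On the segment [|z| <= m], so [|f'|] is at most [D / (1 - m^2)] times [1 - |f|^2]; the 2 comes
     from differentiating the square, and [|f| < 1] removes the remaining factor. *)
  set (K := 2 * (D / (1 - m * m)) * Cmod w).
  assert (Hmm : 0 < 1 - m * m) by nra.
  apply (gronwall_positive (fun s => 1 - Cmod (f (gam s)) * Cmod (f (gam s)))
    (fun s => 0 - ((Re (df (gam s) * w) * Re (f (gam s)) + Re (f (gam s)) * Re (df (gam s) * w)) +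
                   (Im (df (gam s) * w) * Im (f (gam s)) + Im (f (gam s)) * Im (df (gam s) * w)))) K).
  - intros s Hs. apply (is_derive_ext (fun s => 1 - (Re (f (gam s)) * Re (f (gam s)) +
      Im (f (gam s)) * Im (f (gam s))))).
    + intros u. apply f_equal. symmetry. apply Cmod_sq.
    + refine (is_derive_minus (fun _ => 1) (fun s => Re (f (gam s)) * Re (f (gam s)) +
        Im (f (gam s)) * Im (f (gam s))) s 0 _ (is_derive_const _ _) _).
      refine (is_derive_plus _ _ s _ _ (Hsq (fun u => Re (f (gam u))) _ _ (HA s Hs))
        (Hsq (fun u => Im (f (gam u))) _ _ (HB s Hs))).
  - rewrite E0. now apply Cmod_lt_1_sq.
  - intros s Hs Hpos. pose proof (proj2 (Cmod_lt_1_sq _) Hpos) as Hlt.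
    specialize (Hdh _ (Hgd s Hs) Hlt). specialize (Hgam s Hs).
    pose proof (Cmod_dot (f (gam s)) (df (gam s) * w)) as Hdot. rewrite Cmod_mult in Hdot.
    pose proof (Cmod_ge_0 (gam s)). pose proof (Cmod_ge_0 (df (gam s))) as Hdf0.
    pose proof (Cmod_ge_0 w). pose proof (Cmod_ge_0 (f (gam s))).
    set (psi := 1 - Cmod (f (gam s)) * Cmod (f (gam s))) in *.
    assert (Hdf : Cmod (df (gam s)) <= D / (1 - m * m) * psi).
    { replace (D / (1 - m * m) * psi) with (D * psi / (1 - m * m)) by (field; lra).
      apply Rle_div_r; [auto|]. eapply Rle_trans; [|exact Hdh].
      rewrite Rmult_comm. apply Rmult_le_compat_r; [auto|nra]. }
    assert (Hb : Cmod (f (gam s)) * (Cmod (df (gam s)) * Cmod w) <= D / (1 - m * m) * psi * Cmod w).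
    { rewrite <- (Rmult_1_l (D / (1 - m * m) * psi * Cmod w)).
      apply Rmult_le_compat; try lra; [apply Rmult_le_pos; auto|].
      apply Rmult_le_compat_r; auto. }
    unfold K. apply Rabs_le_between in Hdot. lra.
Qed.

Lemma disk_point_surjective (z : C) : in_disk z -> z <> 0 ->
  exists x t, 0 < x /\ z = disk_point x t.
Proof.
  intros Hz Hz0. apply Cmod_gt_0 in Hz0. unfold in_disk in Hz.
  pose proof (Cmod_sq z) as Hsq. set (m := Cmod z) in *.
  set (c := Re z / m). set (s := Im z / m).
  assert (Hc : Re z = m * c) by (unfold c; field; lra).
  assert (Hs : Im z = m * s) by (unfold s; field; lra).
  assert (Hcs : c * c + s * s = 1).
  { rewrite Hc, Hs in Hsq. assert (m * m * (c * c + s * s) = m * m * 1) by lra.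
    apply Rmult_eq_reg_l in H; nra. }
  assert (Hc1 : -1 <= c <= 1) by nra.
  assert (Ht : exists t, cos t = c /\ sin t = s).
  { assert (Hsin : sin (acos c) = Rabs s).
    { rewrite sin_acos by lra. rewrite <- sqrt_Rsqr_abs. f_equal. unfold Rsqr. lra. }
    destruct (Rle_dec 0 s) as [H0|H0].
    - exists (acos c). rewrite cos_acos, Hsin by lra. rewrite Rabs_right; lra.
    - exists (- acos c). rewrite cos_neg, sin_neg, cos_acos, Hsin by lra.
      rewrite Rabs_left; lra. }
  destruct Ht as [t [Ht1 Ht2]]. exists (- ln m), t. split.
  - assert (ln m < 0) by (rewrite <- ln_1; apply ln_increasing; lra). lra.
  - unfold disk_point. rewrite Ropp_involutive, exp_ln, Ht1, Ht2 by lra.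
    rewrite <- Hc, <- Hs. now destruct z.
Qed.

Lemma continuous_Re_disk_point (f df : C -> C) x :
  (forall z, in_disk z -> cdiff f z (df z)) -> 0 < x ->
  continuous_everywhere (fun t => Re (f (disk_point x t))).
Proof.
  intros H Hx t.
  pose proof (holomorphic_pair_closed_im _ _ _ _ (cdiff_holomorphic_pair f df H)) as Hcl.
  exact (closed_form_continuous_r _ _ x t Hcl Hx).
Qed.

Lemma continuous_Cmod_disk_point (f df : C -> C) x :
  (forall z, in_disk z -> cdiff f z (df z)) -> 0 < x ->
  continuous_everywhere (fun t => Cmod (f (disk_point x t))).
Proof.
  intros H Hx t.
  pose proof (continuous_Re_disk_point f df x H Hx t) as Hr.
  assert (Hi : continuous (fun t => Im (f (disk_point x t))) t).
  { pose proof (holomorphic_pair_closed_re _ _ _ _ (cdiff_holomorphic_pair f df H)) as Hcl.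
    exact (closed_form_continuous_r _ _ x t Hcl Hx). }
  apply (continuous_ext (fun t => sqrt (Re (f (disk_point x t)) * Re (f (disk_point x t)) +
    Im (f (disk_point x t)) * Im (f (disk_point x t))))).
  - intros s. rewrite <- Cmod_sq. apply sqrt_square, Cmod_ge_0.
  - refine (continuous_comp (fun t => Re (f (disk_point x t)) * Re (f (disk_point x t)) +
      Im (f (disk_point x t)) * Im (f (disk_point x t))) sqrt t _ _).
    + refine (continuous_plus _ _ _ _ _).
      * exact (continuous_mult _ _ _ Hr Hr).
      * exact (continuous_mult _ _ _ Hi Hi).
    + apply continuous_sqrt.
Qed.

Lemma inner_center_le1 (f df : C -> C) : inner f ->
  (forall z, in_disk z -> cdiff f z (df z)) ->
  (forall z, in_disk z -> 1 <= Cmod (f z)) -> Cmod (f 0) <= 1.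
Proof.
  intros [_ [[B HB] HN]] Hf Hge. pose proof PI_RGT_0 as Hpi.
  apply le_epsilon. intros e He.
  set (x := fun n : nat => / INR (S n)).
  assert (Hx : forall n, 0 < x n).
  { intros n. apply Rinv_0_lt_compat, lt_0_INR. lia. }
  match type of HN with null_set ?N0 => set (N := N0) in HN end.
  destruct (bounded_convergence_null (fun n t => Cmod (f (disk_point (x n) t)) - 1)
    N 0 (2 * PI) (B - 1) (2 * PI * e) ltac:(lra) ltac:(nra)) as [n Hn].
  - intros n t. refine (continuous_minus _ _ _ _ (continuous_const _ _)).
    apply (continuous_Cmod_disk_point f df); auto.
  - intros n t. pose proof (disk_point_in_disk (x n) t (Hx n)) as Hd.
    specialize (Hge _ Hd). specialize (HB _ Hd). lra.
  - exact HN.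
  - intros t Ht HNt c Hc.
    assert (Hlim : exists alpha, Cmod alpha = 1 /\ radial_limit f (cis t) alpha).
    { apply NNPP. intros Hn. apply HNt. split; auto. }
    destruct Hlim as [al [Hal Hr]]. rewrite radial_limit_disk_point in Hr.
    destruct (Hr c Hc) as [d [Hd Hdx]].
    destruct (INR_unbounded (/ d)) as [n Hn]. exists n. intros m Hm.
    assert (Hxm : x m < d).
    { unfold x. rewrite <- (Rinv_inv d). apply Rinv_lt_contravar.
      - apply Rmult_lt_0_compat; [now apply Rinv_0_lt_compat|apply lt_0_INR; lia].
      - apply Rlt_le_trans with (INR n); [lra|]. apply le_INR. lia. }
    specialize (Hdx (x m) (conj (Hx m) Hxm)).
    pose proof (Cmod_sub_lower (f (disk_point (x m) t)) al) as T.
    replace (al - f (disk_point (x m) t))%C with (- (f (disk_point (x m) t) - al))%C in T by ring.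
    rewrite Cmod_opp in T. lra.
  - set (m := Cmod (f 0)).
    assert (Hm1 : 1 <= m) by (apply Hge; unfold in_disk; rewrite Cmod_0; lra).
    (* Rotation by [c] turns [f 0] into the positive number [|f 0|], so that the mean value property
       for the real part bounds [|f 0|] by the mean of [|f|]. *)
    set (c := (Cconj (f 0) / m)%C).
    assert (Hmc : RtoC m <> 0).
    { intros E. apply RtoC_inj in E. lra. }
    assert (Hc : Cmod c = 1).
    { unfold c. rewrite Cmod_div, Cmod_conj, Cmod_R, Rabs_right by (auto; lra).
      fold m. field. lra. }
    assert (Hcf : Re (c * f 0 + 0) = m).
    { assert (E : (c * f 0 + 0 = m)%C).
      { unfold c. pose proof (Cmod2_conj (f 0)) as E. fold m in E.
        replace (Cconj (f 0) / m * f 0 + 0)%C with (f 0 * Cconj (f 0) / m)%C by (field; auto).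
        rewrite <- E. rewrite RtoC_pow. field. auto. }
      rewrite E. reflexivity. }
    pose proof (mean_value_disk (fun z => c * f z + 0)%C (fun z => c * df z)%C 0 (x n)
      (fun z Hz => cdiff_affine c 0 f z _ (Hf z Hz)) (Hx n)) as MV.
    cbv beta in MV. rewrite Hcf, Rplus_0_l in MV.
    assert (Hle : RInt (fun t => Re (c * f (disk_point (x n) t) + 0)) 0 (2 * PI) <=
      RInt (fun t => Cmod (f (disk_point (x n) t))) 0 (2 * PI)).
    { apply continuous_everywhere_RInt_le.
      - apply (continuous_Re_disk_point (fun z => c * f z + 0)%C (fun z => c * df z)%C); auto.
        intros z Hz. apply (cdiff_affine c 0 f z _ (Hf z Hz)).
      - apply (continuous_Cmod_disk_point f df); auto.
      - lra.
      - intros t. rewrite Cplus_0_r. eapply Rle_trans; [apply Rle_abs|].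
        eapply Rle_trans; [apply re_le_Cmod|]. rewrite Cmod_mult, Hc. lra. }
    assert (Hsub : RInt (fun t => Cmod (f (disk_point (x n) t)) - 1) 0 (2 * PI) =
      RInt (fun t => Cmod (f (disk_point (x n) t))) 0 (2 * PI) - RInt (fun _ => 1) 0 (2 * PI)).
    { refine (RInt_minus _ _ _ _ _ _).
      - apply continuous_everywhere_ex_RInt, (continuous_Cmod_disk_point f df); auto.
      - apply ex_RInt_const. }
    rewrite RInt_const_R in Hsub. nra.
Qed.

(** Provides the starting point from which [|f| < 1] propagates. Where [|f| > 1] an upper bound on
    the nonpositive quotient [Dh f] says nothing about [|f'|], so this point has to come from the
    boundary values. *)
Lemma inner_exists_lt1 (f df : C -> C) : inner f ->
  (forall z, in_disk z -> cdiff f z (df z)) ->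
  (exists z1 z2, in_disk z1 /\ in_disk z2 /\ f z1 <> f z2) ->
  exists z, in_disk z /\ Cmod (f z) < 1.
Proof.
  intros Hin Hf [z1 [z2 [Hz1 [Hz2 Hne]]]]. apply NNPP. intros HN.
  assert (Hge : forall z, in_disk z -> 1 <= Cmod (f z)).
  { intros z Hz. apply Rnot_lt_le. intros Hlt. apply HN. now exists z. }
  pose proof (inner_center_le1 f df Hin Hf Hge) as H01. pose proof PI_RGT_0 as Hpi.
  assert (Hnz : forall z, in_disk z -> f z <> 0).
  { intros z Hz. apply Cmod_gt_0. specialize (Hge z Hz). lra. }
  assert (H0 : in_disk 0) by (unfold in_disk; rewrite Cmod_0; lra).
  set (q := fun z => (f 0 * / f z + 0)%C).
  assert (Hq : forall z, in_disk z -> cdiff q z (f 0 * - (df z / (f z * f z)))%C).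
  { intros z Hz. apply (cdiff_affine (f 0) 0 (fun z => / f z)%C). apply cdiff_inv; auto. }
  assert (Hq1 : forall z, in_disk z -> Cmod (q z) <= 1).
  { intros z Hz. unfold q. rewrite Cplus_0_r, Cmod_mult, Cmod_inv by auto.
    specialize (Hge z Hz). apply Rle_div_l; lra. }
  assert (Hall : forall z, in_disk z -> f z = f 0).
  { intros z Hz. destruct (Ceq_dec z 0) as [->|Hz0]; [auto|].
    destruct (disk_point_surjective z Hz Hz0) as [x [t [Hx ->]]].
    (* Starting the period at [t - PI] puts [t] in its interior, where the nonnegative continuous
       function [1 - Re q], of zero mean, must vanish. *)
    pose proof (mean_value_disk q _ (t - PI) x Hq Hx) as MV.
    replace (q 0) with (RtoC 1) in MV by (unfold q; field; auto).
    change (Re 1) with 1 in MV.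
    pose proof (continuous_Re_disk_point q _ x Hq Hx) as Hc.
    assert (Hre : Re (q (disk_point x t)) = 1).
    { assert (1 - Re (q (disk_point x t)) = 0); [|lra].
      apply (RInt_zero_interior (fun s => 1 - Re (q (disk_point x s)))
        (t - PI) (t - PI + 2 * PI)); [| | |lra].
      - intros s. exact (continuous_minus (fun _ => 1) _ s (continuous_const _ _) (Hc s)).
      - intros s. pose proof (Hq1 _ (disk_point_in_disk x s Hx)).
        pose proof (re_le_Cmod (q (disk_point x s))). pose proof (Rle_abs (Re (q (disk_point x s)))).
        lra.
      - transitivity (RInt (fun _ => 1) (t - PI) (t - PI + 2 * PI) -
          RInt (fun s => Re (q (disk_point x s))) (t - PI) (t - PI + 2 * PI)).
        + refine (RInt_minus _ _ _ _ _ _); [apply ex_RInt_const|].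
          now apply continuous_everywhere_ex_RInt.
        + rewrite MV, RInt_const_R. lra. }
    pose proof (Hq1 _ Hz) as Hle. pose proof (Cmod_sq (q (disk_point x t))) as Hsq.
    pose proof (Cmod_ge_0 (q (disk_point x t))).
    assert (Him : Im (q (disk_point x t)) = 0) by (rewrite Hre in Hsq; nra).
    assert (Hq11 : q (disk_point x t) = 1).
    { destruct (q (disk_point x t)) as [q1 q2]. unfold Re, Im in *; simpl in *.
      subst. reflexivity. }
    unfold q in Hq11. rewrite Cplus_0_r in Hq11.
    pose proof (Hnz _ Hz) as Hfz.
    assert (E : (f 0 * / f (disk_point x t) * f (disk_point x t) = 1 * f (disk_point x t))%C)
      by now rewrite Hq11.
    rewrite <- Cmult_assoc, Cinv_l, Cmult_1_r, Cmult_1_l in E by auto. now symmetry. }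
  apply Hne. now rewrite (Hall z1 Hz1), (Hall z2 Hz2).
Qed.

(** This is [x <= sinh x]: in logarithmic coordinates the hyperbolic density of the disk,
    [1 / sinh x], is at most the density [1 / x] of the half plane. *)
Lemma two_mul_exp_le (x : R) : 0 < x -> 2 * x * exp (- x) <= 1 - exp (- x) * exp (- x).
Proof.
  intros Hx.
  assert (H : 2 * x - 2 * 0 <= (exp x - exp (- x)) - (exp 0 - exp (- 0))).
  { apply (increment_dominated (fun u => 2 * u) (fun u => exp u - exp (- u)) (fun _ => 2)
      (fun u => exp u + exp (- u))); [lra| | |].
    - intros u _. auto_derive; [auto|ring].
    - intros u _. auto_derive; [auto|ring].
    - intros u _. pose proof (exp_ineq1_le u). pose proof (exp_ineq1_le (- u)). lra. }
  rewrite Ropp_0 in H. pose proof (exp_pos (- x)).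
  assert (exp x * exp (- x) = 1) by (rewrite <- exp_plus, Rplus_opp_r; apply exp_0).
  nra.
Qed.

(** Equal to [(alpha + f) / (alpha - f)] off the zeros of the denominator, in a form where [f]
    occurs once, inside an inverse. *)
Definition cayley (alpha : C) (f : C -> C) (z : C) : C := (2 * alpha * / (alpha - f z) - 1)%C.

Lemma cayley_neq alpha w : Cmod alpha = 1 -> Cmod w < 1 -> (alpha - w)%C <> 0.
Proof.
  intros Ha Hw E. assert (alpha = w).
  { replace alpha with ((alpha - w) + w)%C by ring. rewrite E. ring. }
  subst. lra.
Qed.

Lemma cayley_re alpha f z : Cmod alpha = 1 -> Cmod (f z) < 1 ->
  Re (cayley alpha f z) =
  (1 - Cmod (f z) * Cmod (f z)) / (Cmod (alpha - f z) * Cmod (alpha - f z)).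
Proof.
  intros Ha Hf. pose proof (cayley_neq alpha (f z) Ha Hf) as Hne.
  apply Cmod_gt_0 in Hne. pose proof (Cmod_sq alpha) as Sa. rewrite Ha in Sa.
  unfold cayley. pose proof (Cmod_sq (f z)) as Sf. pose proof (Cmod_sq (alpha - f z)) as S.
  assert (Hp : 0 < Cmod (alpha - f z) * Cmod (alpha - f z)) by nra.
  rewrite S in Hp. rewrite S, Sf. clear S Sf Hne.
  destruct alpha as [a1 a2]. destruct (f z) as [w1 w2]. unfold Re, Im in *; simpl in *.
  unfold Rdiv. field_simplify; [|nra|nra].
  f_equal. nra.
Qed.

(** * The Cayley transform *)

Lemma cdiff_ext (f g : C -> C) z l : (forall y, f y = g y) -> cdiff f z l -> cdiff g z l.
Proof.
  intros E H eps He. destruct (H eps He) as [d [Hd Hy]]. exists d. split; [auto|].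
  intros y Hyd. rewrite <- !E. auto.
Qed.

Definition cayley_derive (alpha : C) (f df : C -> C) (z : C) : C :=
  (2 * alpha * (df z / ((alpha - f z) * (alpha - f z))))%C.

Lemma cayley_cdiff alpha f df z : cdiff f z (df z) -> (alpha - f z)%C <> 0 ->
  cdiff (cayley alpha f) z (cayley_derive alpha f df z).
Proof.
  intros H Hne.
  assert (H1 : cdiff (fun y => alpha - f y)%C z (- (1) * df z)).
  { apply (cdiff_ext (fun y => - (1) * f y + alpha)%C); [intros y; ring|].
    now apply cdiff_affine. }
  apply (cdiff_ext (fun y => 2 * alpha * / (alpha - f y) + - (1))%C); [intros y; reflexivity|].
  replace (cayley_derive alpha f df z) with
    (2 * alpha * - (- (1) * df z / ((alpha - f z) * (alpha - f z))))%C.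
  - apply (cdiff_affine (2 * alpha) (- (1)) (fun y => / (alpha - f y))%C).
    now apply (cdiff_inv (fun y => alpha - f y)%C).
  - unfold cayley_derive. field. exact Hne.
Qed.

Lemma cayley_derive_Cmod alpha f df z : Cmod alpha = 1 -> (alpha - f z)%C <> 0 ->
  Cmod (cayley_derive alpha f df z) =
  2 * Cmod (df z) / (Cmod (alpha - f z) * Cmod (alpha - f z)).
Proof.
  intros Ha Hne. unfold cayley_derive.
  rewrite !Cmod_mult, Cmod_div, Cmod_mult, Ha, Cmod_R, Rabs_right by
    (try lra; now apply Cmult_neq_0).
  unfold Rdiv. ring.
Qed.

(** The derivative of [w] has modulus [2 |f'| / |alpha - f|^2] and [U] is
    [(1 - |f|^2) / |alpha - f|^2]: in the quotient [alpha] disappears, and the bound on [Dh f]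
    applies as it is. *)
Lemma cayley_contractive (alpha : C) (f df : C -> C) (D : R) : Cmod alpha = 1 -> 0 <= D ->
  (forall z, in_disk z -> cdiff f z (df z)) ->
  (forall z, in_disk z -> Cmod (f z) < 1) ->
  (forall z, in_disk z -> (1 - Cmod z * Cmod z) * Cmod (df z) <= D * (1 - Cmod (f z) * Cmod (f z))) ->
  exists V P Q, contractive_pair D (fun x t => Re (cayley alpha f (disk_point x t))) V P Q.
Proof.
  intros Ha HD Hf Hlt Hdh.
  assert (Hne : forall z, in_disk z -> (alpha - f z)%C <> 0).
  { intros z Hz. apply cayley_neq; auto. }
  do 3 eexists. split.
  - apply (cdiff_holomorphic_pair (cayley alpha f) (cayley_derive alpha f df)).
    intros z Hz. apply cayley_cdiff; auto.
  - intros x t Hx. set (z := disk_point x t).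
    assert (Hz : in_disk z) by now apply disk_point_in_disk.
    rewrite cayley_re by auto. pose proof (Hne z Hz) as Hn. apply Cmod_gt_0 in Hn.
    set (m := Cmod (alpha - f z)) in *.
    pose proof (proj1 (Cmod_lt_1_sq _) (Hlt z Hz)) as Hpos.
    assert (Hmm : 0 < m * m) by nra.
    assert (HU : 0 < (1 - Cmod (f z) * Cmod (f z)) / (m * m)) by now apply Rdiv_lt_0_compat.
    split; [exact HU|].
    assert (Hb : Cmod (z * cayley_derive alpha f df z) <=
      D * ((1 - Cmod (f z) * Cmod (f z)) / (m * m)) / x).
    { rewrite Cmod_mult, cayley_derive_Cmod by auto. fold m.
      specialize (Hdh z Hz). unfold z in Hdh at 1 2. rewrite Cmod_disk_point in Hdh.
      unfold z at 1. rewrite Cmod_disk_point.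
      pose proof (two_mul_exp_le x Hx) as He. pose proof (exp_pos (- x)) as Hex.
      pose proof (Cmod_ge_0 (df z)) as Hdf.
      set (e := exp (- x)) in *. set (psi := 1 - Cmod (f z) * Cmod (f z)) in *.
      apply (proj1 (Rle_div_r _ _ x Hx)).
      replace (e * (2 * Cmod (df z) / (m * m)) * x) with (2 * x * e * Cmod (df z) / (m * m))
        by (field; nra).
      replace (D * (psi / (m * m))) with (D * psi / (m * m)) by (field; nra).
      apply Rmult_le_compat_r; [left; now apply Rinv_0_lt_compat|].
      eapply Rle_trans; [|exact Hdh]. apply Rmult_le_compat_r; auto. }
    split; (eapply Rle_trans; [|exact Hb]); [apply re_le_Cmod|apply im_le_Cmod].
Qed.

(** Follows from [|alpha - f| >= 1 - |f|]. Large values of [U] thus force [f] to be close to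
    [alpha], whence the radial limit when no bound on [U] recurs. *)
Lemma cayley_re_upper alpha f z : Cmod alpha = 1 -> Cmod (f z) < 1 ->
  Re (cayley alpha f z) * Cmod (f z - alpha) <= 2.
Proof.
  intros Ha Hf. rewrite cayley_re by auto.
  pose proof (cayley_neq alpha (f z) Ha Hf) as Hn. apply Cmod_gt_0 in Hn.
  replace (f z - alpha)%C with (- (alpha - f z))%C by ring. rewrite Cmod_opp.
  pose proof (Cmod_sub_lower alpha (f z)) as T. rewrite Ha in T.
  replace (f z - alpha)%C with (- (alpha - f z))%C in T by ring. rewrite Cmod_opp in T.
  pose proof (Cmod_ge_0 (f z)). set (m := Cmod (alpha - f z)) in *. set (r := Cmod (f z)) in *.
  replace ((1 - r * r) / (m * m) * m) with ((1 - r * r) / m) by (field; lra).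
  apply Rle_div_l; nra.
Qed.

Lemma recurs_below_of_not_limit alpha f t : Cmod alpha = 1 ->
  (forall z, in_disk z -> Cmod (f z) < 1) -> ~ radial_limit f (cis t) alpha ->
  exists K, recurs_below (fun x t => Re (cayley alpha f (disk_point x t))) K t.
Proof.
  intros Ha Hlt Hn. apply NNPP. intros HN. apply Hn. apply radial_limit_disk_point.
  intros eps He. set (K := 4 / eps). assert (HK : 0 < K) by (apply Rdiv_lt_0_compat; lra).
  assert (Hd : exists d, 0 < d /\ forall x, 0 < x < d -> K <= Re (cayley alpha f (disk_point x t))).
  { apply NNPP. intros Hnd. apply HN. exists K. intros d Hd. apply NNPP. intros Hx.
    apply Hnd. exists d. split; [auto|]. intros x Hxd. apply Rnot_lt_le. intros Hlt'.
    apply Hx. now exists x. }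
  destruct Hd as [d [Hd Hx]]. exists d. split; [auto|]. intros x Hxd. specialize (Hx x Hxd).
  pose proof (cayley_re_upper alpha f (disk_point x t) Ha
    (Hlt _ (disk_point_in_disk x t ltac:(lra)))) as Hu.
  pose proof (Cmod_ge_0 (f (disk_point x t) - alpha)).
  set (m := Cmod (f (disk_point x t) - alpha)) in *.
  assert (K * m <= 2) by nra. unfold K in H0.
  apply Rnot_le_lt. intros Hem. assert (4 / eps * eps <= 4 / eps * m).
  { apply Rmult_le_compat_l; [fold K; lra|auto]. }
  replace (4 / eps * eps) with 4 in H1 by (field; lra). lra.
Qed.

Lemma recurs_below_of_other_limit alpha beta f t : Cmod alpha = 1 -> Cmod beta = 1 ->
  alpha <> beta -> (forall z, in_disk z -> Cmod (f z) < 1) -> radial_limit f (cis t) beta ->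
  forall K, 0 < K -> recurs_below (fun x t => Re (cayley alpha f (disk_point x t))) K t.
Proof.
  intros Ha Hb Hab Hlt Hr K HK d Hd. rewrite radial_limit_disk_point in Hr.
  assert (Hdl : 0 < Cmod (alpha - beta)).
  { apply Cmod_gt_0. intros E. apply Hab. replace alpha with ((alpha - beta) + beta)%C by ring.
    rewrite E. ring. }
  set (dl := Cmod (alpha - beta)) in *.
  (* The first term keeps [|alpha - f|] above [dl / 2]; the second makes [1 - |f|^2 < 2 * e] smaller
     than [K * dl^2 / 4]. *)
  set (e := Rmin (dl / 2) (K * (dl * dl) / 16)).
  assert (He : 0 < e).
  { apply Rmin_glb_lt; [lra|]. apply Rdiv_lt_0_compat; [|lra].
    apply Rmult_lt_0_compat; nra. }
  pose proof (Rmin_l (dl / 2) (K * (dl * dl) / 16)) as E1.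
  pose proof (Rmin_r (dl / 2) (K * (dl * dl) / 16)) as E2. fold e in E1, E2.
  destruct (Hr e He) as [d' [Hd' Hx]].
  set (x := Rmin d d' / 2). assert (0 < Rmin d d') by now apply Rmin_glb_lt.
  pose proof (Rmin_l d d'). pose proof (Rmin_r d d').
  exists x. split; [unfold x; lra|].
  specialize (Hx x ltac:(unfold x; lra)).
  assert (Hz : in_disk (disk_point x t)) by (apply disk_point_in_disk; unfold x; lra).
  specialize (Hlt _ Hz). rewrite cayley_re by auto.
  set (w := f (disk_point x t)) in *. pose proof (Cmod_ge_0 w).
  pose proof (Cmod_sub_lower beta w) as T1. rewrite Hb in T1.
  assert (T2 : dl / 2 <= Cmod (alpha - w)).
  { pose proof (Cmod_sub_lower (alpha - beta) (alpha - w)) as T. fold dl in T.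
    replace (alpha - w - (alpha - beta))%C with (- (w - beta))%C in T by ring.
    rewrite Cmod_opp in T. lra. }
  set (m := Cmod (alpha - w)) in *. set (r := Cmod w) in *.
  apply Rlt_div_l; [nra|].
  assert (dl * dl / 4 <= m * m) by nra.
  assert (1 - r * r < 2 * e) by nra.
  assert (K * (dl * dl / 4) <= K * (m * m)) by (apply Rmult_le_compat_l; lra).
  lra.
Qed.

(** * Periodicity, covers by arcs and the conclusion *)

Lemma cis_eq_period (s t : R) : cis s = cis t -> exists k : Z, s = t + 2 * PI * IZR k.
Proof.
  intros H. unfold cis in H. injection H as Hc Hs.
  assert (H1 : cos (s - t) = 1).
  { rewrite cos_minus, Hc, Hs. pose proof (sin2_cos2 t) as T. unfold Rsqr in T. lra. }
  assert (H2 : sin ((s - t) / 2) = 0).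
  { pose proof (cos_2a_sin ((s - t) / 2)) as E.
    replace (2 * ((s - t) / 2)) with (s - t) in E by field. rewrite H1 in E. nra. }
  destruct (sin_eq_0_0 _ H2) as [k Hk]. exists k. lra.
Qed.

Lemma cis_period (t : R) (k : Z) : cis (t + 2 * PI * IZR k) = cis t.
Proof.
  assert (Hn : forall s (n : nat), cis (s + 2 * PI * INR n) = cis s).
  { intros s n. unfold cis. replace (s + 2 * PI * INR n) with (s + 2 * INR n * PI) by ring.
    now rewrite cos_period, sin_period. }
  destruct (Z.le_ge_cases 0 k) as [Hk|Hk].
  - rewrite <- (Z2Nat.id k Hk), <- INR_IZR_INZ. apply Hn.
  - rewrite <- (Hn (t + 2 * PI * IZR k) (Z.to_nat (- k))).
    rewrite INR_IZR_INZ, Z2Nat.id, opp_IZR by lia. f_equal. ring.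
Qed.

Lemma shift_into_period (a t : R) : exists k : Z, a <= t + 2 * PI * IZR k < a + 2 * PI.
Proof.
  pose proof PI_RGT_0. set (y := (a - t) / (2 * PI)).
  assert (Hy : a - t = 2 * PI * y) by (unfold y; field; lra).
  destruct (archimed y) as [H1 H2].
  (* [up y] lies in [(y, y + 1]]; the end [y + 1], reached when [y] is an integer, falls outside the
     half-open period and is moved back by one. *)
  destruct (Req_dec (IZR (up y) - y) 1) as [E|E].
  - exists (up y - 1)%Z. rewrite minus_IZR. split; nra.
  - exists (up y). split; nra.
Qed.

Lemma hcontent_covers (s : R) (F : C -> Prop) : ~ Rbar_lt 0 (hcontent s F) ->
  forall e, 0 < e -> exists (p q : nat -> R) (L : R), (forall j, is_arc_param (p j) (q j)) /\
    (forall xi, F xi -> exists j, arc (p j) (q j) xi) /\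
    is_series (fun j => powr (arc_len (p j) (q j)) s) L /\ L <= e.
Proof.
  intros H e He. apply NNPP. intros Hn. apply H. unfold hcontent.
  match goal with |- Rbar_lt _ (Glb_Rbar ?E) => destruct (Glb_Rbar_correct E) as [_ Hg] end.
  apply Rbar_lt_le_trans with (Finite e); [exact He|]. apply Hg.
  intros x [p [q [H1 [H2 H3]]]]. simpl. apply Rnot_lt_le. intros Hx. apply Hn.
  exists p, q, x. repeat split; auto; try apply H1. lra.
Qed.

(** Arcs may be parametrized arbitrarily far away, whereas the mass estimate is uniform only for
    bounded left ends. These are brought into one period before [a], at the price of three
    translates. *)
Lemma arc_cover_normalized (a b : R) (F : C -> Prop) (p q : nat -> R) : b <= a + 2 * PI ->
  (forall j, is_arc_param (p j) (q j)) ->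
  (forall t, a <= t <= b -> F (cis t) -> exists j, arc (p j) (q j) (cis t)) ->
  exists p' q' : nat -> R, (forall j, a - 2 * PI <= p' j < a) /\
    (forall j, p' j <= q' j <= p' j + 2 * PI) /\
    (forall j, arc_len (p' j) (q' j) = arc_len (p j) (q j)) /\
    forall t, a <= t <= b -> F (cis t) -> exists j (k : nat), (k < 3)%nat /\
      p' j + 2 * PI * INR k <= t <= q' j + 2 * PI * INR k.
Proof.
  intros Hb Hpq Hcov. pose proof PI_RGT_0 as Hpi.
  set (k := fun j => proj1_sig (constructive_indefinite_description _
    (shift_into_period (a - 2 * PI) (p j)))).
  assert (Hk : forall j, a - 2 * PI <= p j + 2 * PI * IZR (k j) < a - 2 * PI + 2 * PI).
  { intros j. apply (proj2_sig (constructive_indefinite_description _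
      (shift_into_period (a - 2 * PI) (p j)))). }
  clearbody k.
  exists (fun j => p j + 2 * PI * IZR (k j)), (fun j => q j + 2 * PI * IZR (k j)).
  split; [|split; [|split]].
  - intros j. specialize (Hk j). lra.
  - intros j. specialize (Hpq j). unfold is_arc_param in Hpq. lra.
  - intros j. unfold arc_len. f_equal. ring.
  - intros t Ht HF. destruct (Hcov t Ht HF) as [j [t' [Ht' E]]].
    apply cis_eq_period in E. destruct E as [n Hn].
    specialize (Hk j). specialize (Hpq j). unfold is_arc_param in Hpq.
    set (i := (n - k j)%Z).
    assert (Hi : IZR n = IZR i + IZR (k j)) by (unfold i; rewrite minus_IZR; ring).
    rewrite Hi in Hn.
    (* The shifted arc ends before [a + 2 * PI] and [t >= a], so [i > -1]; it starts at or after
       [a - 2 * PI] and [t <= a + 2 * PI], so [i <= 2]. *)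
    assert (Hi1 : -1 < IZR i) by nra.
    assert (Hi2 : IZR i < 3) by nra.
    apply lt_IZR in Hi1. apply lt_IZR in Hi2.
    exists j, (Z.to_nat i). split; [lia|].
    rewrite INR_IZR_INZ, Z2Nat.id by lia. lra.
Qed.

(** The second hypothesis excludes unimodular constants, which satisfy [inner] with [Dh f] equal to
    0 although the preimages of all other points are empty. *)
Theorem theorem4 (f : C -> C) (D : R) :
  inner f ->
  (exists z1 z2 : C, in_disk z1 /\ in_disk z2 /\ f z1 <> f z2) ->
  is_lub (fun x => exists z, in_disk z /\ x = Dh f z) D ->
  D < 1 ->
  forall (alpha : C) (a b : R),
    Cmod alpha = 1 ->
    a < b <= a + 2 * PI ->
    Rbar_lt (Finite 0)
      (hcontent (1 - D) (fun xi => preimage_bd f alpha xi /\ arc a b xi)).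
Proof.
  intros Hin Hnc [Hub _] HD1 alpha a b Ha Hab.
  assert (Hf : forall z, in_disk z -> cdiff f z (C_derive f z)).
  { intros z Hz. destruct Hin as [Han _]. destruct (Han z Hz) as [l Hl].
    rewrite (is_C_derive_unique f z l Hl). now apply is_derive_cdiff. }
  assert (Hsq : forall z, Cmod z ^ 2 = Cmod z * Cmod z) by (intros z; ring).
  assert (Hdh : forall z, in_disk z -> Cmod (f z) < 1 ->
    (1 - Cmod z * Cmod z) * Cmod (C_derive f z) <= D * (1 - Cmod (f z) * Cmod (f z))).
  { intros z Hz Hfz. apply Cmod_lt_1_sq in Hfz.
    assert (Hle : Dh f z <= D) by (apply Hub; now exists z).
    unfold Dh in Hle. rewrite !Hsq in Hle. apply Rle_div_l in Hle; [exact Hle|lra]. }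
  destruct (inner_exists_lt1 f (C_derive f) Hin Hf Hnc) as [z0 [Hz0 Hfz0]].
  assert (HD0 : 0 <= D).
  { pose proof (Hdh z0 Hz0 Hfz0) as H. apply Cmod_lt_1_sq in Hfz0.
    apply Cmod_lt_1_sq in Hz0. pose proof (Cmod_ge_0 (C_derive f z0)).
    assert (0 <= (1 - Cmod z0 * Cmod z0) * Cmod (C_derive f z0)) by (apply Rmult_le_pos; lra).
    nra. }
  assert (Hlt : forall z, in_disk z -> Cmod (f z) < 1).
  { intros z Hz. apply (lt1_propagates f (C_derive f) D z0); auto. }
  destruct (cayley_contractive alpha f (C_derive f) D Ha HD0 Hf Hlt
    (fun z Hz => Hdh z Hz (Hlt z Hz))) as [V [P [Q Hcp]]].
  apply NNPP. intros Hc.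
  destruct Hin as [_ [_ HN]].
  match type of HN with null_set ?N0 => set (N := N0) in HN end.
  apply (contractive_content_not_small D _ V P Q (fun t => radial_limit f (cis t) alpha) N
    a b (Rabs a + 2 * PI) Hcp (conj HD0 HD1) ltac:(lra) HN).
  - intros t _ Ht. now apply recurs_below_of_not_limit.
  (* The exceptional set is given in [[0, 2 * PI]] only, so [t] is first brought there. Off that set
     the radial limit is unimodular, and it differs from [alpha] because [t] is not in the
     preimage. *)
  - intros t _ Ht. destruct (shift_into_period 0 t) as [k Hk].
    destruct (classic (N (t + 2 * PI * IZR k))) as [HNt|HNt]; [right; now exists k|left].
    assert (Hlim : exists beta, Cmod beta = 1 /\ radial_limit f (cis t) beta).
    { apply NNPP. intros Hn. apply HNt. split; [lra|]. now rewrite cis_period. }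
    destruct Hlim as [beta [Hb Hr]].
    apply (recurs_below_of_other_limit alpha beta f t); auto.
    intros E. apply Ht. now rewrite E.
  - intros e He. destruct (hcontent_covers _ _ Hc e He) as [p [q [L [Hpq [Hcov [HL HLe]]]]]].
    destruct (arc_cover_normalized a b (fun xi => preimage_bd f alpha xi /\ arc a b xi) p q)
      as [p' [q' [H1 [H2 [H3 H4]]]]]; [lra|auto|auto|].
    exists p', q', L. split; [|split; [|split; [exact HLe|]]].
    + intros j. specialize (H1 j). split; [|apply H2].
      pose proof (Rle_abs a). pose proof (Rabs_maj2 a). pose proof PI_RGT_0. apply Rabs_le. lra.
    + refine (is_series_ext _ _ _ _ HL). intros j. now rewrite H3.
    + intros t Ht Hr. apply H4; [auto|]. split; [split; [|exact Hr]|].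
      * pose proof (Cmod_disk_point 0 t) as E. rewrite <- RtoC_exp_cis in E.
        rewrite Ropp_0, exp_0, Cmult_1_l in E. exact E.
      * exists t. auto.
Qed.
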